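(* For any moderate solution $X$ on $[0,T]$ and for all $s<1$, the $L^2(\Omega;H^s)$-norm of $X(t)$ is finite and continuous as a function of $t\in(0,T]$. In particular, $X(t)\in l^2$ almost surely for all positive $t$.
   Context: Fix $\lambda>1$, $k_n:=\lambda^n$ for $n\ge0$, a constant $\sigma\ge0$, a time $T>0$, a filtered probability space $(\Omega,\mathcal F,\mathcal F_t,P)$ and independent Brownian motions $(W_n)_{n\ge0}$ on it. For $s\in\mathbb R$, $H^s:=\{x\in\mathbb R^{\mathbb N}:\|x\|_{H^s}:=(\sum_{n\ge1}k_n^{2s}x_n^2)^{1/2}<\infty\}$; $H^0=l^2$. The linear stochastic dyadic model with forcing $\sigma$ is the It\^o system $$dX_1=\sigma\,dW_0-k_1X_2\,dW_1-\tfrac12k_1^2X_1\,dt,$$ $$dX_n=k_{n-1}X_{n-1}\,dW_{n-1}-k_nX_{n+1}\,dW_n-\tfrac12(k_{n-1}^2+k_n^2)X_n\,dt,\quad n\ge2,$$ with $X(0)=\overline X$, where $\overline X$ is an $\mathcal F_0$-measurable random variable taking values in some $H^s$. A process $X=(X_n(t))_{n\ge1,t\in[0,T]}$ is a componentwise solution with initial condition $\overline X$ if it has adapted, continuous components and satisfies this system. A componentwise solution is a proper solution if $X\in L^2([0,T]\times\Omega;l^2)$ and $X_n\in L^4([0,T]\times\Omega)$ for all $n\ge1$. A componentwise solution $X$ is a moderate solution with initial condition $\overline X$ if $\overline X\in L^2(\Omega;H^{-1})$, $X\in L^2([0,T]\times\Omega;H^{-1})$, and there is a sequence $(X^{(N)})_{N\ge1}$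 of proper solutions converging to $X$ in $L^2([0,T]\times\Omega;H^{-1})$ whose initial conditions $\overline X^{(N)}$ converge to $\overline X$ in $L^2(\Omega;H^{-1})$. *)

(* Defs.v *)
From HB Require Import structures.
From mathcomp Require Import all_boot all_order all_algebra.
From mathcomp Require Import all_classical all_reals all_analysis.
From mathcomp Require Import measurable_realfun.

Set Implicit Arguments.
Unset Strict Implicit.
Unset Printing Implicit Defensive.

Import Order.TTheory GRing.Theory Num.Theory.
Import numFieldNormedType.Exports.

Local Open Scope classical_set_scope.
Local Open Scope ring_scope.

(* MathComp-Analysis. Sequences in R^N are functions [nat -> R] of which only
   the coordinates [n >= 1] are meaningful: the value at [0] is never used.
   A sequence-valued process is [X : R -> Omega -> nat -> R], so that [X t w n]
   stands for X_n(t)(w); all times are taken in [0, T]. *)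

Section weighted_spaces.
Context {R : realType} (lambda : R).
Implicit Types (s : R) (x : nat -> R).

Definition wave n : R := lambda ^+ n.

Definition Hnorm s x : \bar R :=
  sqrte (\sum_(1 <= n <oo) (wave n `^ (2 * s) * x n ^+ 2)%:E)%E.

Definition L2Hnorm d (U : measurableType d) (mu : set U -> \bar R)
    (D : set U) s (Y : U -> nat -> R) : \bar R :=
  sqrte (\int[mu]_(z in D) (Hnorm s (Y z) ^+ 2))%E.

(* For s fixed, measurability of an H^s-valued map amounts to measurability of
   its coordinates. *)
Definition in_L2H d (U : measurableType d) (mu : set U -> \bar R)
    (D : set U) s (Y : U -> nat -> R) : Prop :=
  (forall n, (1 <= n)%N -> measurable_fun D (fun z => Y z n)) /\
  (L2Hnorm mu D s Y < +oo)%E.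

Definition cvg_L2H d (U : measurableType d) (mu : set U -> \bar R)
    (D : set U) s (Y_ : nat -> U -> nat -> R) (Y : U -> nat -> R) : Prop :=
  [/\ forall N, in_L2H mu D s (Y_ N),
      in_L2H mu D s Y &
      L2Hnorm mu D s (fun z n => Y_ N z n - Y z n) @[N --> \oo] --> 0%E].

End weighted_spaces.

Section stochastic_basis.
Context {R : realType} d {Omega : measurableType d} (P : probability Omega R).
Variable (T : R).
Implicit Types (F : R -> set (set Omega)) (W H I : R -> Omega -> R).

Definition filtration F : Prop :=
  [/\ forall t, 0 <= t <= T -> sigma_algebra setT (F t),
      forall t, 0 <= t <= T -> F t `<=` measurable &
      forall s t : R, 0 <= s -> s <= t -> t <= T -> F s `<=` F t].

Definition measurable_for (G : set (set Omega)) (Z : Omega -> R) : Prop :=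
  forall B : set R, measurable B -> G (Z @^-1` B).

Definition adapted F H : Prop :=
  forall t, 0 <= t <= T -> measurable_for (F t) (H t).

Definition continuous_paths H : Prop :=
  forall w, {within `[0, T], continuous (fun t => H t w)}.

Record brownian_motion F W : Prop := BrownianMotion {
  bm_adapted : adapted F W ;
  bm_continuous : continuous_paths W ;
  bm_start : {ae P, forall w, W 0 w = 0} ;
  bm_independent : forall s t : R, 0 <= s -> s < t -> t <= T ->
    forall (A : set Omega) (B : set R), F s A -> measurable B ->
    P (A `&` [set w | B (W t w - W s w)]) =
    (P A * P [set w | B (W t w - W s w)%R])%E ;
  bm_normal : forall s t : R, 0 <= s -> s < t -> t <= T ->
    forall B : set R, measurable B ->
    P [set w | B (W t w - W s w)] = normal_prob 0 (Num.sqrt (t - s)) B }.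

Definition sigma_process W : set (set Omega) :=
  <<s [set A | exists (t : R) (B : set R),
    [/\ 0 <= t <= T, measurable B & A = W t @^-1` B]] >>.

Definition independent_processes (W_ : nat -> R -> Omega -> R) : Prop :=
  forall (J : seq nat) (A : nat -> set Omega), uniq J ->
    (forall n, n \in J -> sigma_process (W_ n) (A n)) ->
    P (\bigcap_(n in [set` J]) A n) = (\prod_(n <- J) P (A n))%E.

Definition cvg_probability0 (Y : nat -> Omega -> \bar R) : Prop :=
  (forall m, measurable_fun setT (Y m)) /\
  forall eps : R, 0 < eps ->
    P [set w | (eps%:E <= Y m w)%E] @[m --> \oo] --> 0%E.

(* The process sum_(i < size) coef_i 1_(]time_i, time_(i+1)]). *)
Record simple_process := SimpleProcess {
  sp_size : nat ;
  sp_time : nat -> R ;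
  sp_coef : nat -> Omega -> R }.

Definition simple_adapted F (h : simple_process) : Prop :=
  [/\ forall i, (i <= sp_size h)%N -> 0 <= sp_time h i <= T,
      forall i, (i < sp_size h)%N -> sp_time h i <= sp_time h i.+1,
      forall i, (i < sp_size h)%N ->
        measurable_for (F (sp_time h i)) (sp_coef h i) &
      forall i, (i < sp_size h)%N ->
        exists M : R, forall w, `|sp_coef h i w| <= M].

Definition simple_eval (h : simple_process) (t : R) (w : Omega) : R :=
  \sum_(i < sp_size h)
    sp_coef h i w * \1_(`]sp_time h i, sp_time h i.+1]%classic) t.

Definition simple_integral W (h : simple_process) (t : R) (w : Omega) : R :=
  \sum_(i < sp_size h) sp_coef h i w *
    (W (Num.min (sp_time h i.+1) t) w - W (Num.min (sp_time h i) t) w).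

(* [I t] is a version of the Ito integral of H against W over [0, t]: the limit
   in probability of the integrals of simple adapted processes h_m such that
   the integral of (h_m - H)^2 over [0, T] tends to 0 in probability. This is
   the Ito integral for integrands that are almost surely in L^2(0, T); it is
   determined up to modification. *)
Definition is_ito_integral F W H I : Prop :=
  exists h : nat -> simple_process,
    [/\ forall m, simple_adapted F (h m),
        cvg_probability0 (fun m w =>
          (\int[lebesgue_measure]_(t in `[0%R, T])
             ((simple_eval (h m) t w - H t w) ^+ 2)%:E)%E) &
        forall t, 0 <= t <= T -> cvg_probability0 (fun m w =>
          (`|simple_integral W (h m) t w - I t w|)%:E)].

End stochastic_basis.

Section dyadic_model.
Context {R : realType} d {Omega : measurableType d} (P : probability Omega R).
Variables (T lambda sigma : R) (F : R -> set (set Omega)).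
Variable W : nat -> R -> Omega -> R.
Implicit Types (X : R -> Omega -> nat -> R) (Xbar : Omega -> nat -> R).

Local Notation k := (wave lambda).
Local Notation leb := (@lebesgue_measure R).

Definition dyadic_equation1 X : Prop :=
  exists I J : R -> Omega -> R,
    [/\ is_ito_integral P T F (W 0%N) (fun _ _ => sigma) I,
        is_ito_integral P T F (W 1%N) (fun t w => k 1 * X t w 2) J &
        forall t, 0 <= t <= T -> {ae P, forall w,
          X t w 1 = X 0 w 1 + I t w - J t w
            - \int[leb]_(r in `[0, t]) (2^-1 * k 1 ^+ 2 * X r w 1)}].

Definition dyadic_equation X (n : nat) : Prop :=
  exists I J : R -> Omega -> R,
    [/\ is_ito_integral P T F (W n.-1) (fun t w => k n.-1 * X t w n.-1) I,
        is_ito_integral P T F (W n) (fun t w => k n * X t w n.+1) J &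
        forall t, 0 <= t <= T -> {ae P, forall w,
          X t w n = X 0 w n + I t w - J t w
            - \int[leb]_(r in `[0, t])
                (2^-1 * (k n.-1 ^+ 2 + k n ^+ 2) * X r w n)}].

Record componentwise_solution Xbar X : Prop := ComponentwiseSolution {
  cs_init_measurable : forall n, (1 <= n)%N ->
    measurable_for (F 0) (fun w => Xbar w n) ;
  cs_init_space : exists s : R,
    {ae P, forall w, (Hnorm lambda s (Xbar w) < +oo)%E} ;
  cs_adapted : forall n, (1 <= n)%N -> adapted T F (fun t w => X t w n) ;
  cs_continuous : forall n, (1 <= n)%N ->
    continuous_paths T (fun t w => X t w n) ;
  cs_init : {ae P, forall w, forall n, (1 <= n)%N -> X 0 w n = Xbar w n} ;
  cs_equation1 : dyadic_equation1 X ;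
  cs_equation : forall n, (2 <= n)%N -> dyadic_equation X n }.

Definition time_sample : set (R * Omega) := `[0, T]%classic `*` setT.

Definition on_product X : R * Omega -> nat -> R := fun z => X z.1 z.2.

Definition in_L4 (Y : R * Omega -> R) : Prop :=
  measurable_fun time_sample Y /\
  (\int[leb \x P]_(z in time_sample) (`|Y z| ^+ 4)%:E < +oo)%E.

Record proper_solution Xbar X : Prop := ProperSolution {
  ps_componentwise : componentwise_solution Xbar X ;
  ps_L2 : in_L2H lambda (leb \x P)%E time_sample 0 (on_product X) ;
  ps_L4 : forall n, (1 <= n)%N -> in_L4 (fun z => X z.1 z.2 n) }.

Record moderate_solution Xbar X : Prop := ModerateSolution {
  ms_componentwise : componentwise_solution Xbar X ;
  ms_init_L2 : in_L2H lambda P setT (-1) Xbar ;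
  ms_L2 : in_L2H lambda (leb \x P)%E time_sample (-1) (on_product X) ;
  ms_approx : exists (Xbar_ : nat -> Omega -> nat -> R)
                     (X_ : nat -> R -> Omega -> nat -> R),
    [/\ forall N, proper_solution (Xbar_ N) (X_ N),
        cvg_L2H lambda (leb \x P)%E time_sample (-1)
          (fun N => on_product (X_ N)) (on_product X) &
        cvg_L2H lambda P setT (-1) Xbar_ Xbar] }.

End dyadic_model.

(* Main.v *)
Require Import Defs.
From HB Require Import structures.
From mathcomp Require Import all_boot all_order all_algebra.
From mathcomp Require Import all_classical all_reals all_analysis.
From mathcomp Require Import measurable_realfun.
From mathcomp Require Import lra ring zify.

Set Implicit Arguments.
Unset Strict Implicit.
Unset Printing Implicit Defensive.

Import Order.TTheory GRing.Theory Num.Theory.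
Import numFieldNormedType.Exports.

Local Open Scope classical_set_scope.
Local Open Scope ring_scope.

(** Write [y_n(t)] for the second moment of [X_(n+1)(t)] and [rho = lambda^-2],
    so that [k_n^2 = rho^-n]. The two noises of an equation are independent and
    the drift is the Ito correction, hence the second moments solve a birth-death
    system: [y_n' = phi_n - phi_(n+1)], with [phi_0 = sigma^2] and the flux
    [phi_(n+1) = rho^-(n+1) (y_n - y_(n+1))] through the link between the sites
    [n] and [n+1]. All that follows are upper bounds, so only [<=] is needed
    ([moment_subsol]). It is obtained without Ito's formula: on a short interval
    [X_t + c int X = X_s + N] with [N] orthogonal to [X_s] and [E N^2] bounded by
    the energy of the integrands ([ito_increment]), and expanding the square gives
    the inequality up to an error [o(t - s)] ([component_energy]).

    The rates grow geometrically, so mass may escape to infinity in finite time,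
    and conversely the system determines its solution only with a condition at
    infinity, here that [int_0^T y_n] tends to 0 (the Dirichlet condition). It
    comes from the Green function of the stationary problem killed at infinity,
    [g(max(n, m))] with [g_n = sum_(j >= n) rho^(j+1)]: testing the system against
    it gives ([green])
      [int_0^T y_m <= sum_n g(max(n, m)) y_n(0) + sigma^2 g_m T + int_0^T y_(N+1)].
    A proper solution is square integrable in [l^2], so its last term vanishes. As
    [g_n] is a multiple of [k_(n+1)^-2], the rest is controlled by the [H^-1] norm
    of the initial condition and survives, up to a constant, in the limit that
    defines moderate solutions; and its right-hand side tends to 0 as [m] grows
    ([moderate_dirichlet]).

    With the Dirichlet condition the estimate holds for [X] itself and from any
    starting time, and it can be iterated ([decay]). Fix [q < 1] close to 1. Since
    [int y_m] is bounded in [m], some early time [t0] has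
    [sum_m q^m y_m(t0) < oo]. Restarting there improves the bound to
    [int y_m <= C (rho / q)^m], so some later time [t1] has
    [y_m(t1) <= C (rho / q^2)^m]. Geometric sequences with ratio [r], [rho <= r < 1],
    are stationary supersolutions when the constant is large, so a comparison
    principle, which again rests on the Dirichlet condition, carries the last
    bound to all later times ([comparison]).

    As [q] is arbitrary, for each [s < 1] the terms [k_(n+1)^(2s) y_n(t)] of the
    square of the [L^2(Omega; H^s)] norm are dominated by a convergent geometric
    series, uniformly for [tau <= t <= T] with [tau > 0]. Each [y_n] is continuous,
    hence so is the norm, and [s = 0] gives the last claim. *)

(** * Moments of the normal law *)
Section gaussian.
Variables (R : realType) (s : R).
Hypothesis s_gt0 : 0 < s.
Local Notation mu := (@lebesgue_measure R).
Local Notation p := (normal_pdf 0 s).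
Local Notation K := (normal_peak s).

Let s0 : s != 0. Proof. by rewrite gt_eqF. Qed.

Let pE x : p x = K * expR (- (x ^+ 2 / (s ^+ 2 *+ 2))).
Proof. by rewrite normal_pdfE// /normal_fun subr0 mulNr. Qed.

(** Integration by parts: [F] is a primitive of [(x^2 / s^2 - 1) p] that vanishes
    at 0 and at infinity. The integral over the half-line is cut at [s], where
    this integrand changes sign, so that the improper part has a nonnegative
    integrand. *)
Let F (x : R) : R := - x * p x.

Let is_derive_F (x : R) : is_derive x 1 F ((x ^+ 2 / s ^+ 2 - 1) * p x).
Proof.
have -> : F = (fun y => - y * (K * expR (- (y ^+ 2 / (s ^+ 2 *+ 2))))).
  by apply/funext => y; rewrite /F pE.
have h : is_derive x 1 (fun y => - (y ^+ 2 / (s ^+ 2 *+ 2)) : R) (- (x / s ^+ 2)).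
  apply: is_derive_eq; rewrite /GRing.scale /=; field.
  by [].
have := is_derive1_comp (is_derive_expR _) h; rewrite /comp => h2.
apply: is_derive_eq; rewrite pE /GRing.scale /=; field.
by [].
Qed.

Let cvg_F : F x @[x --> +oo] --> (0 : R).
Proof.
apply/(@norm_cvg0P _ R^o).
have K2 : s ^+ 2 *+ 2 > 0 by rewrite pmulrn_lgt0// exprn_gt0.
apply: (@squeeze_cvgr _ _ _ _ (cst 0) (fun x => (K * (s ^+ 2 *+ 2)) / x)); last 2 first.
  exact: cvg_cst.
  rewrite -[X in _ --> X](mulr0 (K * (s ^+ 2 *+ 2))).
  apply: cvgM; first exact: cvg_cst.
  by apply/gtr0_cvgV0; [exact: nbhs_pinfty_gt | exact: cvg_id].
near=> x.
have x0 : 0 < x by near: x; exact: nbhs_pinfty_gt.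
rewrite normr_ge0 /= /F normrM normrN (gtr0_norm x0) pE ger0_norm ?mulr_ge0 ?expR_ge0 ?normal_peak_ge0//.
rewrite mulrCA -mulrA ler_wpM2l ?normal_peak_ge0//.
rewrite expRN ler_pdivrMr ?expR_gt0//.
apply: (@le_trans _ _ (s ^+ 2 *+ 2 / x * (x ^+ 2 / (s ^+ 2 *+ 2)))).
  rewrite le_eqVlt; apply/orP; left; apply/eqP; field.
  by rewrite s0 gt_eqF.
rewrite ler_wpM2l ?divr_ge0// 1?ltW//.
have := expR_ge1Dx (x ^+ 2 / (s ^+ 2 *+ 2)).
by lra.
Unshelve. all: by end_near. Qed.

Let drF (x : R) : derivable F x 1.
Proof. by case: (is_derive_F x). Qed.

Let cF : continuous F.
Proof. by move=> x; apply: differentiable_continuous; apply/derivable1_diffP; exact: drF. Qed.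

Let q (x : R) : R := x ^+ 2 / s ^+ 2 * p x.
Let f (x : R) : R := (x ^+ 2 / s ^+ 2 - 1) * p x.

Let cq : continuous q.
Proof.
move=> x; apply: cvgM; last exact: continuous_normal_pdf.
by apply: cvgM; [exact: exprn_continuous | exact: cvg_cst].
Qed.

Let cf : continuous f.
Proof.
move=> x; apply: cvgM; last exact: continuous_normal_pdf.
apply: cvgB; last exact: cvg_cst.
by apply: cvgM; [exact: exprn_continuous | exact: cvg_cst].
Qed.

Let dF (x : R) : (F^`())%classic x = f x.
Proof. by rewrite derive1E (@derive_val _ _ _ _ _ _ _ (is_derive_F x)). Qed.

Let qfp x : q x = f x + p x.
Proof. by rewrite /q /f; ring. Qed.

Let q_ge0 x : 0 <= q x.
Proof. by rewrite /q mulr_ge0 ?normal_pdf_ge0// divr_ge0 ?sqr_ge0. Qed.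

Let mq : measurable_fun setT (EFin \o q).
Proof. by apply/measurable_EFinP; exact: continuous_measurable_fun. Qed.
Let mp : measurable_fun setT (EFin \o p).
Proof. by apply/measurable_EFinP; exact: measurable_normal_pdf. Qed.
Let mf : measurable_fun setT (EFin \o f).
Proof. by apply/measurable_EFinP; exact: continuous_measurable_fun. Qed.

Let left_part : (\int[mu]_(x in `[0%R, s]) (q x)%:E + (s * p s)%:E =
  \int[mu]_(x in `[0%R, s]) (p x)%:E)%E.
Proof.
have E : (\int[mu]_(x in `[0%R, s]) (f x)%:E = (F s)%:E - (F 0)%:E)%E.
  apply: continuous_FTC2 => //.
  - exact: continuous_subspaceT.
  - split.
    + by move=> x _; exact: drF.
    + apply: cvg_at_right_filter; exact: cF.
    + apply: cvg_at_left_filter; exact: cF.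
have Ip : mu.-integrable `[0, s] (EFin \o p).
  by apply: (integrableS _ _ (subsetT _)) => //; exact: integrable_normal_pdf.
have If : mu.-integrable `[0, s] (EFin \o f).
  apply: continuous_compact_integrable; first exact: segment_compact.
  exact: continuous_subspaceT.
under eq_integral do rewrite qfp EFinD.
rewrite integralD// E -EFinB /F oppr0 mul0r subr0 mulNr.
by rewrite addeAC -EFinD addNr add0e.
Qed.

Let right_part : (\int[mu]_(x in `[s, +oo[) (q x)%:E = (s * p s)%:E +
  \int[mu]_(x in `[s, +oo[) (p x)%:E)%E.
Proof.
have f0 x : s <= x -> 0 <= f x.
  move=> sx; rewrite mulr_ge0 ?normal_pdf_ge0// subr_ge0 ler_pdivlMr ?exprn_gt0//.
  by rewrite mul1r ler_sqr ?nnegrE// (le_trans (ltW s_gt0)).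
have E : (\int[mu]_(x in `[s, +oo[) (f x)%:E = 0%:E - (F s)%:E)%E.
  apply: ge0_continuous_FTC2y => //.
  - exact: continuous_subspaceT.

  - apply: cvg_at_right_filter; exact: cF.
under eq_integral do rewrite qfp EFinD.
rewrite ge0_integralD//.
- by rewrite E -EFinB /F sub0r mulNr opprK.
- by move=> x /=; rewrite in_itv/= andbT lee_fin; exact: f0.
- exact: measurable_funTS mf.
- by move=> x _; rewrite lee_fin normal_pdf_ge0.
- exact: measurable_funTS mp.
Qed.

Lemma normal_pdf_moment2 : (\int[mu]_x (x ^+ 2 * p x)%:E = (s ^+ 2)%:E)%E.
Proof.
have half (h : R -> R) : (forall x, 0 <= h x) -> measurable_fun setT (EFin \o h) ->
    (\int[mu]_(x in [set x | (0 <= x)%R]) (h x)%:E =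
    \int[mu]_(x in `[0%R, s]) (h x)%:E + \int[mu]_(x in `[s, +oo[) (h x)%:E)%E.
  move=> h0 mh.
  have -> : [set x : R | 0 <= x] = `[0%R, s] `|` `]s, +oo[.
    apply/seteqP; split=> [x /= x0|x /=]; rewrite !in_itv/= ?andbT.
      by have [|] := leP x s; rewrite ?x0 => ?; [left|right].
    by move=> [/andP[]//|] sx; exact: le_trans (ltW s_gt0) (ltW sx).
  rewrite ge0_integral_setU//=.
  - congr (_ + _)%E; apply: integral_itv_obnd_cbnd.
    exact: measurable_funTS mh.
  - exact: measurable_funTS mh.
  - by move=> x _; rewrite lee_fin.
  - apply/disj_setPS => x [/=]; rewrite !in_itv/= => /andP[_ xs] /andP[sx _].
    by move: (lt_le_trans sx xs); rewrite ltxx.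
have qT : (\int[mu]_x (q x)%:E = 1)%E.
  rewrite -(integral_normal_pdf 0 s) ge0_symfun_integralT//; last first.
    by move=> x /=; rewrite /q !pE sqrrN.
  rewrite [RHS]ge0_symfun_integralT//; last 3 first.
    by move=> x; rewrite normal_pdf_ge0.
    exact: continuous_normal_pdf.
    by move=> x /=; rewrite !pE sqrrN.
  congr (_ * _)%E; rewrite !half//; last by move=> x; rewrite normal_pdf_ge0.
  by rewrite right_part addeA left_part.
transitivity (\int[mu]_x ((s ^+ 2)%:E * (q x)%:E))%E.
  apply: eq_integral => x _; rewrite -EFinM; congr EFin; rewrite /q.
  by field.
rewrite ge0_integralZl ?qT ?mule1 ?lee_fin ?sqr_ge0 //.
by move=> x _; rewrite lee_fin.
Qed.

End gaussian.

(** * Integrable and square integrable random variables *)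
Section expectation.
Context {R : realType} d {Omega : measurableType d} (P : probability Omega R).
Implicit Types Y Z : Omega -> R.

Definition int1 Y := P.-integrable setT (EFin \o Y).
Definition sqint Y := measurable_fun setT Y /\ int1 (fun w => Y w ^+ 2).
Definition Ex Y : R := \int[P]_w Y w.

Lemma int1_meas Y : int1 Y -> measurable_fun setT Y.
Proof. by move=> /measurable_int/measurable_EFinP. Qed.

Lemma int1D Y Z : int1 Y -> int1 Z -> int1 (fun w => Y w + Z w).
Proof. by move=> iY iZ; apply: eq_integrable (integrableD _ iY iZ). Qed.

Lemma int1Z c Y : int1 Y -> int1 (fun w => c * Y w).
Proof. by move=> iY; apply: eq_integrable (integrableZl _ c iY). Qed.

Lemma int1B Y Z : int1 Y -> int1 Z -> int1 (fun w => Y w - Z w).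
Proof. by move=> iY iZ; apply: eq_integrable (integrableB _ iY iZ). Qed.

Lemma int1_cst c : int1 (fun=> c).
Proof. by apply: finite_measure_integrable_cst. Qed.

Lemma int1_sum (I : Type) (r : seq I) (Q : pred I) (Y : I -> Omega -> R) :
  (forall i, Q i -> int1 (Y i)) -> int1 (fun w => \sum_(i <- r | Q i) Y i w).
Proof.
move=> iY; elim: r => [|i r IH].
  by under [X in int1 X]eq_fun do rewrite big_nil; exact: int1_cst.
case Qi: (Q i); under [X in int1 X]eq_fun do rewrite big_cons Qi; last by [].
by apply: int1D => //; exact: iY.
Qed.

Lemma int1_le Y Z : measurable_fun setT Y -> (forall w, `|Y w| <= Z w) ->
  int1 Z -> int1 Y.
Proof.
move=> mY YZ; apply: le_integrable => //; first exact/measurable_EFinP.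
by move=> w _ /=; rewrite lee_fin (le_trans (YZ w))// ler_norm.
Qed.

Lemma ExD Y Z : int1 Y -> int1 Z -> Ex (fun w => Y w + Z w) = Ex Y + Ex Z.
Proof. by move=> iY iZ; rewrite /Ex RintegralD. Qed.

Lemma ExB Y Z : int1 Y -> int1 Z -> Ex (fun w => Y w - Z w) = Ex Y - Ex Z.
Proof. by move=> iY iZ; rewrite /Ex RintegralB. Qed.

Lemma ExZ c Y : int1 Y -> Ex (fun w => c * Y w) = c * Ex Y.
Proof. by move=> iY; rewrite /Ex RintegralZl. Qed.

Lemma Ex_cst c : Ex (fun=> c) = c.
Proof. by rewrite /Ex Rintegral_cst//= probability_setT mulr1. Qed.

Lemma Ex_sum (I : Type) (r : seq I) (Q : pred I) (Y : I -> Omega -> R) :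
  (forall i, Q i -> int1 (Y i)) ->
  Ex (fun w => \sum_(i <- r | Q i) Y i w) = \sum_(i <- r | Q i) Ex (Y i).
Proof.
move=> iY; elim: r => [|i r IH].
  by under [X in Ex X]eq_fun do rewrite big_nil; rewrite Ex_cst big_nil.
rewrite big_cons; case Qi: (Q i); under [X in Ex X]eq_fun do rewrite big_cons Qi; last exact: IH.
rewrite ExD ?IH//; first exact: iY.
exact: int1_sum.
Qed.

Lemma Ex_ge0 Y : (forall w, 0 <= Y w) -> 0 <= Ex Y.
Proof. by move=> Y0; apply: Rintegral_ge0 => w _; exact: Y0. Qed.

Lemma Ex_le Y Z : int1 Y -> int1 Z -> (forall w, Y w <= Z w) -> Ex Y <= Ex Z.
Proof. by move=> iY iZ YZ; apply: le_Rintegral. Qed.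

Lemma Ex_EFin Y : int1 Y -> (\int[P]_w (Y w)%:E)%E = (Ex Y)%:E.
Proof. by move=> iY; rewrite /Ex /Rintegral fineK//; exact: integrable_fin_num. Qed.

Lemma int1_ge0P Y : measurable_fun setT Y -> (forall w, 0 <= Y w) ->
  (\int[P]_w (Y w)%:E < +oo)%E -> int1 Y.
Proof.
move=> mY Y0 iY; apply/integrableP; split; first exact/measurable_EFinP.
by under eq_integral do rewrite gee0_abs ?lee_fin//.
Qed.

Lemma sqint_mul Y Z : sqint Y -> sqint Z -> int1 (fun w => Y w * Z w).
Proof.
move=> [mY iY] [mZ iZ].
apply: (@int1_le _ (fun w => Y w ^+ 2 + Z w ^+ 2)); last exact: int1D.
  exact: measurable_funM.
move=> w; rewrite normrM -[Y w ^+ 2]real_normK ?num_real//.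
rewrite -[Z w ^+ 2]real_normK ?num_real//.
have := sqr_ge0 (`|Y w| - `|Z w|); have := mulr_ge0 (normr_ge0 (Y w)) (normr_ge0 (Z w)).
by nra.
Qed.

Lemma sqint_cst c : sqint (fun=> c).
Proof. by split; [exact: measurable_cst|exact: int1_cst]. Qed.

Lemma sqint_int1 Y : sqint Y -> int1 Y.
Proof.
move=> sY; have := sqint_mul sY (sqint_cst 1).
by under [X in int1 X]eq_fun do rewrite mulr1.
Qed.

Lemma sqintD Y Z : sqint Y -> sqint Z -> sqint (fun w => Y w + Z w).
Proof.
move=> sY sZ; split; first by apply: measurable_funD; [exact: sY.1|exact: sZ.1].
under [X in int1 X]eq_fun do rewrite sqrrD.
apply: int1D; last exact: sZ.2.
apply: int1D; first exact: sY.2.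
by under [X in int1 X]eq_fun do rewrite mulr2n; apply: int1D; exact: sqint_mul.
Qed.

Lemma sqintZ c Y : sqint Y -> sqint (fun w => c * Y w).
Proof.
move=> sY; split; first by apply: measurable_funM; [exact: measurable_cst|exact: sY.1].
by under [X in int1 X]eq_fun do rewrite exprMn; apply: int1Z; exact: sY.2.
Qed.

Lemma sqintB Y Z : sqint Y -> sqint Z -> sqint (fun w => Y w - Z w).
Proof.
move=> sY sZ; have := sqintD sY (sqintZ (-1) sZ).
by under [X in sqint X]eq_fun do rewrite mulN1r.
Qed.

Lemma sqint_sum (I : Type) (r : seq I) (Q : pred I) (Y : I -> Omega -> R) :
  (forall i, Q i -> sqint (Y i)) -> sqint (fun w => \sum_(i <- r | Q i) Y i w).
Proof.
move=> iY; elim: r => [|i r IH].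
  by under [X in sqint X]eq_fun do rewrite big_nil; exact: sqint_cst.
case Qi: (Q i); under [X in sqint X]eq_fun do rewrite big_cons Qi; last by [].
by apply: sqintD => //; exact: iY.
Qed.

Lemma sqint_bnd (M : R) (c Y : Omega -> R) : measurable_fun setT c -> (forall w, `|c w| <= M) ->
  sqint Y -> sqint (fun w => c w * Y w).
Proof.
move=> mc cM sY; split; first by apply: measurable_funM => //; exact: sY.1.
apply: (@int1_le _ (fun w => M ^+ 2 * Y w ^+ 2)).
- by apply: measurable_funX; apply: measurable_funM => //; exact: sY.1.
- move=> w; rewrite ger0_norm ?sqr_ge0// exprMn ler_wpM2r ?sqr_ge0//.
  by rewrite -real_normK ?num_real// lerXn2r ?nnegrE// (le_trans _ (cM w)).
- by apply: int1Z; exact: sY.2.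
Qed.

Lemma Ex_sqrD Y Z : sqint Y -> sqint Z -> Ex (fun w => (Y w + Z w) ^+ 2) =
  Ex (fun w => Y w ^+ 2) + 2 * Ex (fun w => Y w * Z w) + Ex (fun w => Z w ^+ 2).
Proof.
move=> sY sZ; have iYZ := sqint_mul sY sZ.
under [X in Ex X]eq_fun do rewrite sqrrD -mulr_natl.
rewrite ExD; [|apply: int1D; [exact: sY.2|exact: int1Z]|exact: sZ.2].
by rewrite ExD ?ExZ//; [exact: sY.2|exact: int1Z].
Qed.

End expectation.

(** * Independent random variables *)
Section independence.
Context {R : realType} d {Omega : measurableType d} (P : probability Omega R).

Definition indep_rv (Y Z : Omega -> R) := forall A B : set R, measurable A ->
  measurable B -> P (Y @^-1` A `&` Z @^-1` B) = (P (Y @^-1` A) * P (Z @^-1` B))%E.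

(** Independence says that the joint law is the product of the two laws
    (uniqueness of the product measure), so this is Fubini's theorem. *)
Lemma indep_Ex_mul (Y Z : Omega -> R) : indep_rv Y Z -> int1 P Y -> int1 P Z ->
  int1 P (fun w => Y w * Z w) /\ Ex P (fun w => Y w * Z w) = Ex P Y * Ex P Z.
Proof.
move=> YZ iY iZ.
have mY := int1_meas iY; have mZ := int1_meas iZ.
have [Y' EY] : exists Y' : {mfun Omega >-> R}, Y = Y' :> (_ -> _).
  by exists (mfun_Sub (mem_set mY)).
have [Z' EZ] : exists Z' : {mfun Omega >-> R}, Z = Z' :> (_ -> _).
  by exists (mfun_Sub (mem_set mZ)).
pose m1 := distribution P Y'; pose m2 := distribution P Z'.
have mYZ : measurable_fun setT (fun w => (Y w, Z w)) by exact: measurable_fun_pair.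
have [U EU] : exists U : {mfun Omega >-> (R * R)%type}, (fun w => (Y w, Z w)) = U :> (_ -> _).
  by exists (mfun_Sub (mem_set mYZ)).
pose m := distribution P U.
have mE : forall X, measurable X -> (m1 \x m2)%E X = m X.
  apply: product_measure_unique => A B mA mB.
  transitivity (P ((fun w => (Y w, Z w)) @^-1` (A `*` B))); first by rewrite EU.
  by rewrite [LHS]YZ// EY EZ.
have fY : (\int[m1]_x `|x%:E| < +oo)%E.
  rewrite /m1 ge0_integral_distribution//; last first.
    by apply: measurableT_comp.
  by rewrite -EY; move/integrableP: iY => [].
have fZ : (\int[m2]_x `|x%:E| < +oo)%E.
  rewrite /m2 ge0_integral_distribution//; last first.
    by apply: measurableT_comp.
  by rewrite -EZ; move/integrableP: iZ => [].
have i1 : m1.-integrable setT (EFin : R -> \bar R) by apply/integrableP; split.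
have i2 : m2.-integrable setT (EFin : R -> \bar R) by apply/integrableP; split.
have iprod : (m1 \x m2)%E.-integrable setT (fun z => (z.1 * z.2)%:E).
  have mm : measurable_fun setT (fun z : R * R => (z.1 * z.2)%:E).
    by apply/measurable_EFinP; exact: measurable_funM.
  apply/integrable12ltyP => //.
  rewrite (_ : (fun x => _) = (fun x => `|x%:E| * \int[m2]_y `|y%:E|)%E); last first.
    apply/funext => x; rewrite -ge0_integralZl//; last first.
      by apply: measurableT_comp.
    by apply: eq_integral => y _ /=; rewrite normrM EFinM.
  rewrite ge0_integralZr//; last 2 first.
    by apply: measurableT_comp.
    exact: integral_ge0.
  by rewrite lte_mul_pinfty// ?integral_ge0// ge0_fin_numE ?integral_ge0.
have mm : measurable_fun setT (fun z : R * R => (z.1 * z.2)%:E).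
  by apply/measurable_EFinP; exact: measurable_funM.
have iYZ : int1 P (fun w => Y w * Z w).
  apply/integrableP; split; first by apply/measurable_EFinP; exact: measurable_funM.
  have <- : (\int[m]_z `|(z.1 * z.2)%:E| = \int[P]_w `|(Y w * Z w)%:E|)%E.
    rewrite /m ge0_integral_distribution//; first by rewrite -EU.
    by apply: measurableT_comp => //.
  rewrite (eq_measure_integral (m1 \x m2)%E); last by move=> A mA _; exact/esym/mE.
  by move/integrableP : iprod => [].
split => //.
apply: EFin_inj; rewrite -Ex_EFin// EFinM.
have -> : (\int[P]_w (Y w * Z w)%:E = \int[m]_z (z.1 * z.2)%:E)%E.
  rewrite /m integral_distribution//; first by rewrite -EU.
  by rewrite -EU.
rewrite (eq_measure_integral (m1 \x m2)%E); last by move=> A mA _; exact/esym/mE.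
rewrite -integral12_prod_meas1//.
have eZ : (\int[m2]_y y%:E = (Ex P Z)%:E)%E.
  by rewrite /m2 integral_distribution -?EZ// Ex_EFin.
transitivity (\int[m1]_x ((Ex P Z)%:E * x%:E))%E.
  apply: eq_integral => x _; rewrite /fubini_F /=.
  under eq_integral do rewrite EFinM.
  by rewrite integralZl// eZ muleC.
rewrite integralZl//.
by rewrite /m1 integral_distribution -?EY// muleC Ex_EFin.
Qed.
End independence.

(** * Random variables with a normal law *)
Section normal_law.
Context {R : realType}.
Local Notation mu := (@lebesgue_measure R).

Import HBNNSimple.

(** The measure [normal_prob] is given by its density only on sets; the formula
    extends to functions through simple functions and monotone convergence. *)
Lemma ge0_integral_normal_prob (m s : R) (f : R -> \bar R) :
  measurable_fun setT f -> (forall x, 0 <= f x)%E ->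
  (\int[normal_prob m s]_x f x = \int[mu]_x (f x * (normal_pdf m s x)%:E))%E.
Proof.
move=> mf f0.
have mp : measurable_fun setT (EFin \o normal_pdf m s).
  by apply/measurable_EFinP; exact: measurable_normal_pdf.
have p0 x : (0 <= (normal_pdf m s x)%:E)%E by rewrite lee_fin normal_pdf_ge0.
have nns (h : {nnsfun R >-> R}) : (\int[normal_prob m s]_x (h x)%:E =
    \int[mu]_x ((h x)%:E * (normal_pdf m s x)%:E))%E.
  have mS r : measurable (h @^-1` [set r]).
    rewrite -[X in measurable X]setTI; exact: measurable_funP.
  have mI r : measurable_fun setT (\1_(h @^-1` [set r]) : R -> R).
    exact: measurable_indic.
  have mE r : measurable_fun setT (EFin \o (\1_(h @^-1` [set r]) : R -> R)).
    exact/measurable_EFinP.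
  under [LHS]eq_integral do rewrite fimfunE -fsumEFin//.
  rewrite [LHS]ge0_integral_fsum//; last 2 first.
    - by move=> r; apply/measurable_EFinP/measurable_funM => //; exact: mI.
    - by move=> n x _; rewrite EFinM nnfun_muleindic_ge0.
  under [RHS]eq_integral.
    move=> x xD; rewrite fimfunE -fsumEFin// ge0_mule_fsuml; last first.
      by move=> r; rewrite EFinM nnfun_muleindic_ge0.
    over.
  rewrite [RHS]ge0_integral_fsum//; last 2 first.
    - move=> r; apply: emeasurable_funM => //.
      by apply/measurable_EFinP/measurable_funM => //; exact: mI.
    - by move=> n x _; rewrite mule_ge0// EFinM nnfun_muleindic_ge0.
  apply: eq_fsbigr => r _.
  have [r0|r0] := leP 0 r; last first.
    rewrite !integral0_eq// => x _; first by rewrite preimage_nnfun0// indic0 mulr0 mul0e.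
    by rewrite preimage_nnfun0// indic0 mulr0.
  under eq_integral do rewrite EFinM.
  rewrite ge0_integralZl//; last exact: (mE r).
  rewrite integral_indic//=; last exact: (mS r).
  rewrite setIT.
  under [RHS]eq_integral do rewrite EFinM -muleA.
  rewrite ge0_integralZl//; last 2 first.
    - by apply: emeasurable_funM => //; apply/measurable_EFinP; exact: mI.
    - by move=> x _; rewrite mule_ge0// lee_fin.
  congr (_ * _)%E; rewrite /normal_prob [LHS]integral_mkcond; apply: eq_integral => x _.
  by rewrite patchE indicE; case: ifPn => _; rewrite ?mul1e ?mul0e.
pose f_ := nnsfun_approx measurableT mf.
have mf_ n : measurable_fun setT (EFin \o (f_ n : R -> R)) by exact/measurable_EFinP.
have nd x a b : (a <= b)%N -> f_ a x <= f_ b x.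
  by move=> ab; have /lefP := nd_nnsfun_approx measurableT mf ab; exact.
transitivity (lim (\int[normal_prob m s]_x (f_ n x)%:E @[n --> \oo])%E).
  rewrite -monotone_convergence//=.
  - apply: eq_integral => x _; apply/esym/cvg_lim => //=.
    exact: cvg_nnsfun_approx.
  - by move=> n x _; rewrite lee_fin.
  - by move=> x _ ? ? mn; rewrite lee_fin; exact: nd.
rewrite [RHS](_ : _ = lim
    (\int[mu]_x ((f_ n x)%:E * (normal_pdf m s x)%:E) @[n --> \oo])%E).
  by apply: congr_lim; apply/funext => n /=; exact: nns.
rewrite -monotone_convergence//=.
- apply: eq_integral => x _; apply/esym/cvg_lim => //.
  apply: cvgeMr => //; exact: cvg_nnsfun_approx.
- by move=> n; apply: emeasurable_funM => //; exact: (mf_ n).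
- by move=> n x _; rewrite mule_ge0// lee_fin.
- by move=> x _ a b ab; rewrite lee_wpmul2r// lee_fin; exact: nd.
Qed.

Context d {Omega : measurableType d} (P : probability Omega R).

Lemma ge0_integral_normal_law (Z : Omega -> R) (s : R) (f : R -> R) :
  measurable_fun setT Z ->
  (forall B, measurable B -> P (Z @^-1` B) = normal_prob 0 s B) ->
  measurable_fun setT f -> (forall x, 0 <= f x) ->
  (\int[P]_w (f (Z w))%:E = \int[mu]_x (f x * normal_pdf 0 s x)%:E)%E.
Proof.
move=> mZ law mf f0.
have mEf : measurable_fun setT (EFin \o (f : measurableTypeR R -> R)) by exact/measurable_EFinP.
have f0E x : (0 <= (f x)%:E)%E by rewrite lee_fin.
have f0i : {in [set: measurableTypeR R], forall x, (0 <= (EFin \o f) x)%E}.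
  by move=> x _; exact: f0E.
have := @ge0_integral_pushforward _ _ Omega (measurableTypeR R) R Z mZ P setT _ measurableT mEf f0i.
rewrite preimage_setT => <-.
transitivity (\int[normal_prob 0 s]_x (f x)%:E)%E.
  by apply: eq_measure_integral => A mA _; exact: (law A mA).
by rewrite ge0_integral_normal_prob.
Qed.

Lemma normal_law_sqint (Z : Omega -> R) (s : R) : 0 < s ->
  measurable_fun setT Z ->
  (forall B, measurable B -> P (Z @^-1` B) = normal_prob 0 s B) ->
  sqint P Z /\ Ex P (fun w => Z w ^+ 2) = s ^+ 2.
Proof.
move=> s0 mZ law.
have E : (\int[P]_w (Z w ^+ 2)%:E = (s ^+ 2)%:E)%E.
  have mf : measurable_fun setT (fun x : R => x ^+ 2) by exact: measurable_funX.
  rewrite (ge0_integral_normal_law mZ law mf); last by move=> x; rewrite sqr_ge0.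
  exact: normal_pdf_moment2.
have i2 : int1 P (fun w => Z w ^+ 2).
  apply: int1_ge0P; [exact: measurable_funX|by move=> w; rewrite sqr_ge0|].
  by rewrite E ltry.
by split => //; apply: EFin_inj; rewrite -Ex_EFin.
Qed.

(** By symmetry of the density, the positive and the negative part of [Z] have
    the same integral. *)
Lemma normal_law_mean (Z : Omega -> R) (s : R) : 0 < s ->
  measurable_fun setT Z ->
  (forall B, measurable B -> P (Z @^-1` B) = normal_prob 0 s B) ->
  Ex P Z = 0.
Proof.
move=> s0 mZ law.
have [sZ _] := normal_law_sqint s0 mZ law.
pose f (x : R) := Num.max x 0; pose g (x : R) := Num.max (- x) 0.
have mf : measurable_fun setT f by exact: measurable_maxr.
have mg : measurable_fun setT g by apply: measurable_maxr.
have f0 x : 0 <= f x by rewrite /f le_max lexx orbT.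
have g0 x : 0 <= g x by rewrite /g le_max lexx orbT.
have fg x : x = f x - g x.
  rewrite /f /g; case: (leP x 0) => x0; case: (leP (-x) 0) => x1; lra.
have bf : forall x, `|f x| <= `|x|.
  by move=> x; rewrite ger0_norm// /f ge_max normr_ge0 ler_norm.
have bg : forall x, `|g x| <= `|x|.
  by move=> x; rewrite ger0_norm// /g ge_max normr_ge0 -normrN ler_norm.
have iZ := sqint_int1 sZ.
have iZn : int1 P (fun w => `|Z w|) by apply: integrable_norm.
have iF : int1 P (fun w => f (Z w)) by apply: int1_le iZn => //; apply: measurableT_comp.
have iG : int1 P (fun w => g (Z w)) by apply: int1_le iZn => //; apply: measurableT_comp.
rewrite (_ : Z = fun w => f (Z w) - g (Z w)); last by apply/funext.
rewrite ExB//; apply/eqP; rewrite subr_eq0; apply/eqP; apply: EFin_inj.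
rewrite -!Ex_EFin// !(ge0_integral_normal_law mZ law)//.
pose h x := (f x * normal_pdf 0 s x)%:E.
have mh : measurable_fun setT h.
  by apply/measurable_EFinP; apply: measurable_funM => //; exact: measurable_normal_pdf.
rewrite -/h.
have mN : measurable_fun setT (-%R : R -> measurableTypeR R) by [].
have h0 : {in [set: measurableTypeR R], forall x, (0 <= h x)%E}.
  by move=> x _; rewrite lee_fin mulr_ge0// normal_pdf_ge0.
have := @ge0_integral_pushforward _ _ (measurableTypeR R) (measurableTypeR R) R _ mN mu setT _ measurableT mh h0.
rewrite preimage_setT => E.
transitivity (\int[mu]_x (h \o -%R) x)%E; last first.
  apply: eq_integral => x _; rewrite /h /= /f /g; congr (_ * _)%:E.
  by rewrite !normal_pdfE ?gt_eqF// /normal_fun !subr0 sqrrN.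
rewrite -E; apply: eq_measure_integral => A mA _; exact/esym/lebesgue_measureN.
Qed.

End normal_law.

(** * Measurability with respect to a sub-sigma-algebra *)
Section measurable_for_lemmas.
Context {R : realType} d {Omega : measurableType d} (G : set (set Omega)).
Hypothesis sG : sigma_algebra setT G.
Implicit Types Y Z : Omega -> R.

(** Turns the closure properties below into those of measurable functions on the
    type that carries [G] as its sigma-algebra. *)
Lemma measurable_forE Z : measurable_for G Z <->
  measurable_fun setT (Z : g_sigma_algebraType G -> R).
Proof.
split => [h _ B mB|h B mB].
  by rewrite setTI; apply: sub_sigma_algebra; exact: h.
by have := h measurableT B mB; rewrite setTI /measurable /= sigma_algebra_id.
Qed.

Lemma mfor_cst c : measurable_for G (fun=> c : R).
Proof. by apply/measurable_forE; exact: measurable_cst. Qed.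

Lemma mforD Y Z : measurable_for G Y -> measurable_for G Z ->
  measurable_for G (fun w => Y w + Z w).
Proof. by rewrite !measurable_forE; exact: measurable_funD. Qed.

Lemma mforM Y Z : measurable_for G Y -> measurable_for G Z ->
  measurable_for G (fun w => Y w * Z w).
Proof. by rewrite !measurable_forE; exact: measurable_funM. Qed.

Lemma mforB Y Z : measurable_for G Y -> measurable_for G Z ->
  measurable_for G (fun w => Y w - Z w).
Proof. by rewrite !measurable_forE; exact: measurable_funB. Qed.

Lemma mforX Y n : measurable_for G Y -> measurable_for G (fun w => Y w ^+ n).
Proof. by rewrite !measurable_forE; exact: measurable_funX. Qed.

Lemma mfor_sum (I : Type) (r : seq I) (Y : I -> Omega -> R) :
  (forall i, measurable_for G (Y i)) ->
  measurable_for G (fun w => \sum_(i <- r) Y i w).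
Proof.
move=> mY; elim: r => [|i r IH].
  by under [X in measurable_for _ X]eq_fun do rewrite big_nil; exact: mfor_cst.
by under [X in measurable_for _ X]eq_fun do rewrite big_cons; exact: mforD.
Qed.

Lemma mfor_le Y (c : R) : measurable_for G Y ->
  measurable_for G (fun w => (Y w <= c)%R%:R : R).
Proof.
move=> mY B mB.
rewrite (_ : _ @^-1` B = Y @^-1` [set x : R | B ((x <= c)%R%:R : R)])//.
apply: mY; rewrite -[X in measurable X]setTI.
have : measurable_fun setT (fun x : R => (x <= c)%R%:R : R).
  rewrite (_ : (fun x => _) = \1_`]-oo, c]); first exact: measurable_indic.
  by apply/funext => x; rewrite indicE mem_setE in_itv.
by move=> /(_ measurableT B mB).
Qed.

End measurable_for_lemmas.

(** * Increments of one Brownian motion *)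
Section brownian_increments.
Context {R : realType} d {Omega : measurableType d} (P : probability Omega R).
Variables (T : R) (F : R -> set (set Omega)).
Hypothesis filtF : filtration T F.
Implicit Types (C Y : Omega -> R) (W : R -> Omega -> R) (a b : R).

Lemma mfor_meas a Y : 0 <= a <= T -> measurable_for (F a) Y ->
  measurable_fun setT Y.
Proof.
move=> aT mY _ B mB; rewrite setTI.
by case: filtF => _ FM _; exact: FM aT _ (mY B mB).
Qed.

Lemma mfor_mono a b Y : 0 <= a -> a <= b -> b <= T -> measurable_for (F a) Y ->
  measurable_for (F b) Y.
Proof.
move=> a0 ab bT mY B mB; case: filtF => _ _ FS.
exact: FS a0 ab bT _ (mY B mB).
Qed.

Lemma F_sigma a : 0 <= a <= T -> sigma_algebra setT (F a).
Proof. by case: filtF => + _ _; exact. Qed.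

Section one_motion.
Variable W : R -> Omega -> R.
Hypothesis bmW : brownian_motion P T F W.

Lemma bm_meas a : 0 <= a <= T -> measurable_fun setT (W a).
Proof. by move=> aT; apply: (mfor_meas aT); exact: bm_adapted bmW a aT. Qed.

Lemma bm_dmfor a b c : 0 <= a -> a <= c -> 0 <= b -> b <= c -> c <= T ->
  measurable_for (F c) (fun w => W b w - W a w).
Proof.
move=> a0 ac b0 bc cT.
have cT' : 0 <= c <= T by rewrite (le_trans a0 ac).
apply: mforB; first exact: F_sigma.
  by apply: (mfor_mono b0) => //; apply: bm_adapted bmW _ _; rewrite b0 (le_trans bc).
by apply: (mfor_mono a0) => //; apply: bm_adapted bmW _ _; rewrite a0 (le_trans ac).
Qed.

Lemma bm_dmeas a b : 0 <= a <= T -> 0 <= b <= T ->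
  measurable_fun setT (fun w => W b w - W a w).
Proof. by move=> aT bT; apply: measurable_funB; exact: bm_meas. Qed.

Lemma bm_dlaw a b : 0 <= a -> a <= b -> b <= T ->
  [/\ sqint P (fun w => W b w - W a w), Ex P (fun w => W b w - W a w) = 0 &
      Ex P (fun w => (W b w - W a w) ^+ 2) = b - a].
Proof.
move=> a0; rewrite le_eqVlt => /orP[/eqP <- bT|ab bT].
  have -> : (fun w => W a w - W a w) = (fun=> 0) by apply/funext => w; rewrite subrr.
  have -> : (fun w => (W a w - W a w) ^+ 2) = (fun=> 0).
    by apply/funext => w; rewrite subrr expr0n.
  by rewrite !Ex_cst subrr; split => //; exact: sqint_cst.
have mD : measurable_fun setT (fun w => W b w - W a w).
  by apply: bm_dmeas; rewrite ?a0 ?bT ?andbT/= ?(le_trans _ bT) ?(le_trans a0) ?ltW.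
have s0 : 0 < Num.sqrt (b - a) by rewrite sqrtr_gt0 subr_gt0.
have law := bm_normal bmW a0 ab bT.
have [sq E] := normal_law_sqint s0 mD law.
split => //; first exact: (normal_law_mean s0 mD law).
by rewrite E sqr_sqrtr// subr_ge0 ltW.
Qed.

Lemma bm_indep a b C : 0 <= a -> a < b -> b <= T -> measurable_for (F a) C ->
  indep_rv P C (fun w => W b w - W a w).
Proof.
move=> a0 ab bT mC A B mA mB.
exact: (bm_independent bmW a0 ab bT (mC A mA) mB).
Qed.

(** The martingale property, tested against square integrable variables. *)
Lemma bm_mean0 a b C : 0 <= a -> a <= b -> b <= T -> measurable_for (F a) C ->
  sqint P C -> Ex P (fun w => C w * (W b w - W a w)) = 0.
Proof.
move=> a0; rewrite le_eqVlt => /orP[/eqP <- bT|ab bT] mC sC.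
  have -> : (fun w => C w * (W a w - W a w)) = (fun=> 0).
    by apply/funext => w; rewrite subrr mulr0.
  exact: Ex_cst.
have [sW E _] := bm_dlaw a0 (ltW ab) bT.
have [_ ->] := indep_Ex_mul (bm_indep a0 ab bT mC) (sqint_int1 sC) (sqint_int1 sW).
by rewrite E mulr0.
Qed.

Lemma bm_sqr a b C : 0 <= a -> a <= b -> b <= T -> measurable_for (F a) C ->
  sqint P C -> sqint P (fun w => C w * (W b w - W a w)) /\
  Ex P (fun w => (C w * (W b w - W a w)) ^+ 2) =
    Ex P (fun w => C w ^+ 2) * (b - a).
Proof.
move=> a0; rewrite le_eqVlt => /orP[/eqP <- bT|ab bT] mC sC.
  have -> : (fun w => C w * (W a w - W a w)) = (fun=> 0).
    by apply/funext => w; rewrite subrr mulr0.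
  have -> : (fun w => (C w * (W a w - W a w)) ^+ 2) = (fun=> 0).
    by apply/funext => w; rewrite subrr mulr0 expr0n.
  by rewrite Ex_cst subrr mulr0; split => //; exact: sqint_cst.
have [sW _ E] := bm_dlaw a0 (ltW ab) bT.
have ind : indep_rv P (fun w => C w ^+ 2) (fun w => (W b w - W a w) ^+ 2).
  have mX (B : set R) : measurable B -> measurable [set x : R | B (x ^+ 2)].
    move=> mB; rewrite -[X in measurable X]setTI.
    by apply: (measurable_funX 2 (@measurable_id _ R setT)).
  move=> A B mA mB; exact: (bm_indep a0 ab bT mC (mX A mA) (mX B mB)).
have [i2 E2] := indep_Ex_mul ind sC.2 sW.2.
have EX : (fun w => (C w * (W b w - W a w)) ^+ 2) =
   (fun w => C w ^+ 2 * (W b w - W a w) ^+ 2).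
  by apply/funext => w; rewrite exprMn.
split; last by rewrite EX E2 E.
by split; [apply: measurable_funM; [exact: sC.1|exact: sW.1]|rewrite EX].
Qed.

End one_motion.
End brownian_increments.

(** * Two independent Brownian motions of a filtration *)
Section covariation.
Context {R : realType} d {Omega : measurableType d} (P : probability Omega R).
Variables (T : R) (F : R -> set (set Omega)) (W : nat -> R -> Omega -> R).
Hypothesis filtF : filtration T F.
Hypothesis bmW : forall n, brownian_motion P T F (W n).
Hypothesis indW : independent_processes P T W.
Implicit Types (C Y Z : Omega -> R) (a b : R) (p q : nat).

Lemma process_indep p q Y Z : p != q ->
  measurable_for (sigma_process T (W p)) Y ->
  measurable_for (sigma_process T (W q)) Z -> indep_rv P Y Z.
Proof.
move=> pq mY mZ A B mA mB.
pose E n := if n == p then Y @^-1` A else Z @^-1` B.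
have := @indW [:: p; q] E.
rewrite /= inE pq => /(_ isT).
have -> : \bigcap_(n in [set` [:: p; q]]) E n = Y @^-1` A `&` Z @^-1` B.
  apply/seteqP; split => [w h|w [h1 h2] n].
    split; first by have := h p; rewrite /E eqxx; apply; rewrite /= !inE eqxx.
    by have := h q; rewrite /E eq_sym (negbTE pq); apply; rewrite /= !inE eqxx orbT.
  by rewrite /= !inE /E; case: eqVneq.
rewrite !big_cons big_nil mule1 /E eqxx (eq_sym q) (negbTE pq); apply => n.
rewrite !inE; case: eqVneq => [-> _|_ /= /eqP->]; [exact: mY|exact: mZ].
Qed.

Lemma process_mfor p a b : 0 <= a <= T -> 0 <= b <= T ->
  measurable_for (sigma_process T (W p)) (fun w => W p b w - W p a w).
Proof.
move=> aT bT.
have m c : 0 <= c <= T -> measurable_for (sigma_process T (W p)) (W p c).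
  by move=> cT B mB; apply: sub_sigma_algebra; exists c, B.
by apply: mforB; [exact: smallest_sigma_algebra|exact: m|exact: m].
Qed.

(** Each motion has increments independent of the past, and the two motions are
    independent of each other, but joint independence of the past [C] from both
    increments is not among the data. It is replaced by a covariation argument.
    Over a partition of [[a, b]] into [m] equal steps, all terms of the product of
    the increments with distinct indices are killed by the martingale property of
    the motion with the later step, so that the expectation [e] is [E (C S)] with
    [S] the sum of the products over a common step. By independence of the two
    motions [E S^2 = (b - a)^2 / m]. Taking [m = n^2] and Young's inequality gives
    [n |e| <= M^2 + (b - a)^2] for every [n], hence [e = 0]. *)
Lemma bm_cross_increment p q a b C (M : R) : p != q -> 0 <= a -> a <= b -> b <= T ->
  measurable_for (F a) C -> (forall w, `|C w| <= M) ->
  Ex P (fun w => C w * (W p b w - W p a w) * (W q b w - W q a w)) = 0.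
Proof.
move=> pq a0 ab bT mC CM.
have aT : 0 <= a <= T by rewrite a0 (le_trans ab).
have M0 : 0 <= M by apply: le_trans (CM point).
have mmC := mfor_meas filtF aT mC.
set e := Ex P _.
have key n : (0 < n)%N -> `|e| * n%:R <= M ^+ 2 + (b - a) ^+ 2.
  move=> n0; pose m := (n * n)%N.
  have m0 : (0 : R) < m%:R by rewrite ltr0n muln_gt0 n0.
  pose h := (b - a) / m%:R.
  have h0 : 0 <= h by rewrite divr_ge0 ?(ltW m0)// subr_ge0.
  pose t i := a + i%:R * h.
  have tm : t m = b by rewrite /t /h; field; rewrite gt_eqF.
  have t0 : t 0%N = a by rewrite /t mul0r addr0.
  have tD i j : (i <= j)%N -> t i <= t j.
    by move=> ij; rewrite lerD2l ler_wpM2r// ler_nat.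
  have ta i : a <= t i by rewrite -{1}t0 tD.
  have tb i : (i <= m)%N -> t i <= b by rewrite -tm; exact: tD.
  have tT i : (i <= m)%N -> 0 <= t i <= T.
    by move=> im; rewrite (le_trans a0)//= (le_trans (tb i im)).
  pose D r (i : 'I_m) w := W r (t i.+1) w - W r (t i) w.
  have DE r w : W r b w - W r a w = \sum_(i < m) D r i w.
    rewrite -tm -t0 -(telescope_sumr (fun i => W r (t i) w)) ?big_mkord//.
  have im (i : 'I_m) : (i <= m)%N by rewrite ltnW.
  have tge0 i : 0 <= t i by rewrite (le_trans a0).
  have law r i := bm_dlaw filtF (bmW r) (tge0 i) (tD _ _ (leqnSn i)).
  have sD r (i : 'I_m) : sqint P (D r i).
    by have [|? _ _] := law r i; [rewrite (le_trans (tb _ _))|].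
  have lawE r (i : 'I_m) : Ex P (fun w => D r i w ^+ 2) = h.
    have [|_ _ ->] := law r i; first by rewrite (le_trans (tb _ _)).
    by rewrite /t -natr1; ring.
  have mD r (i : 'I_m) c : t i.+1 <= c -> c <= T -> measurable_for (F c) (D r i).
    move=> ic cT; apply: (bm_dmfor filtF (bmW r)) => //.
    exact: le_trans (tD _ _ (leqnSn i)) ic.
  have off r r' C' (N : R) (i j : 'I_m) : (i < j)%N -> measurable_for (F a) C' ->
      (forall w, `|C' w| <= N) -> Ex P (fun w => C' w * D r i w * D r' j w) = 0.
    move=> ij mC' C'N; have tj : t j.+1 <= T by rewrite (le_trans (tb _ _)).
    apply: (bm_mean0 filtF (bmW r') (tge0 j) (tD _ _ (leqnSn j))) => //.
      have tjT : t j <= T by rewrite (le_trans (tb _ (im j))).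
      have tj' : 0 <= t j <= T by rewrite tge0.
      apply: (mforM (F_sigma filtF tj')).
        exact: (mfor_mono filtF a0 (ta _) tjT mC').
      by apply: mD => //; exact: tD.
    exact: (sqint_bnd (mfor_meas filtF aT mC') C'N).
  have iCDD r r' (i j : 'I_m) : int1 P (fun w => C w * D r i w * D r' j w).
    by apply: sqint_mul => //; exact: (sqint_bnd mmC CM).
  pose S w := \sum_(i < m) D p i w * D q i w.
  have ind (i j : 'I_m) : indep_rv P (fun w => D p i w * D p j w)
      (fun w => D q i w * D q j w).
    by apply: (process_indep pq); apply: mforM; (try exact: smallest_sigma_algebra);
       apply: process_mfor; apply: tT.
  have iDD r (i j : 'I_m) : int1 P (fun w => D r i w * D r j w) by exact: sqint_mul.
  have EDD r (i j : 'I_m) : Ex P (fun w => D r i w * D r j w) = if i == j then h else 0.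
    case: eqVneq => [->|ij].
      by rewrite -(lawE r j); congr Ex; apply/funext => w; rewrite expr2.
    have [lt|lt|/val_inj eq] := ltngtP i j; last by rewrite eq eqxx in ij.
      have := off r r (fun=> 1) 1 i j lt (mfor_cst (F_sigma filtF aT) 1).
      move=> <-; last by move=> w; rewrite normr1.
      by congr Ex; apply/funext => w; rewrite mul1r.
    have := off r r (fun=> 1) 1 j i lt (mfor_cst (F_sigma filtF aT) 1).
    move=> <-; last by move=> w; rewrite normr1.
    by congr Ex; apply/funext => w; rewrite mul1r mulrC.
  have SE : (fun w => S w ^+ 2) = (fun w => \sum_(i < m) \sum_(j < m)
      (D p i w * D p j w) * (D q i w * D q j w)).
    apply/funext => w; rewrite expr2 /S mulr_suml; apply: eq_bigr => i _.
    by rewrite mulr_sumr; apply: eq_bigr => j _; ring.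
  have i4 (i j : 'I_m) := (indep_Ex_mul (ind i j) (iDD p i j) (iDD q i j)).1.
  have E4 (i j : 'I_m) := (indep_Ex_mul (ind i j) (iDD p i j) (iDD q i j)).2.
  have sS : sqint P S.
    split; last by rewrite SE; apply: int1_sum => i _; apply: int1_sum.
    by apply: measurable_sum => i; apply: measurable_funM; exact: (sD _ _).1.
  have ES2 : Ex P (fun w => S w ^+ 2) = (b - a) ^+ 2 / m%:R.
    rewrite SE Ex_sum; last by move=> i _; apply: int1_sum.
    rewrite (eq_bigr (fun=> h ^+ 2)).
      by rewrite sumr_const card_ord /h -mulr_natr; field; rewrite gt_eqF.
    move=> i _; rewrite Ex_sum// (bigD1 i)//= big1 ?addr0.
      by rewrite E4 !EDD eqxx expr2.
    by move=> j ji; rewrite E4 !EDD eq_sym (negbTE ji) mul0r.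
  have iCS : int1 P (fun w => C w * S w).
    by apply: sqint_mul => //; split => //; apply: int1_le (int1_cst P (M ^+ 2));
      [exact: measurable_funX|move=> w; rewrite ger0_norm ?sqr_ge0//
       -real_normK ?num_real// lerXn2r ?nnegrE].
  have eE : e = Ex P (fun w => C w * S w).
    rewrite /e (_ : (fun w => _) = (fun w => \sum_(i < m) \sum_(j < m)
      C w * D p i w * D q j w)); last first.
      apply/funext => w; rewrite !DE [C w * _]mulr_sumr mulr_suml; apply: eq_bigr => i _.
      by rewrite mulr_sumr.
    rewrite Ex_sum; last by move=> i _; apply: int1_sum.
    rewrite (_ : (fun w => C w * S w) = (fun w => \sum_(i < m) C w * D p i w * D q i w));
      last by apply/funext => w; rewrite mulr_sumr; apply: eq_bigr => i _; rewrite mulrA.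
    rewrite Ex_sum//; apply: eq_bigr => i _; rewrite Ex_sum// (bigD1 i)//= big1 ?addr0//.
    move=> j ji; have [lt|lt|/val_inj eq] := ltngtP i j; last by rewrite eq eqxx in ji.
      exact: off lt mC CM.
    by rewrite -(off q p C M j i lt mC CM); congr Ex; apply/funext => w; rewrite mulrAC.
  have b1 (x : R) : `|x| <= 1 -> x * e * n%:R <= M ^+ 2 + (b - a) ^+ 2.
    move=> x1.
    rewrite [leRHS](_ : _ = Ex P (fun w => M ^+ 2 + n%:R ^+ 2 * S w ^+ 2)); last first.
      rewrite ExD; [|exact: int1_cst|apply: int1Z; exact: sS.2].
      rewrite Ex_cst ExZ ?ES2; last exact: sS.2.
      rewrite /m natrM; field; rewrite pnatr_eq0; lia.
    rewrite mulrAC eE -ExZ//; apply: Ex_le.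
    - exact: int1Z.
    - by apply: int1D; [exact: int1_cst|apply: int1Z; exact: sS.2].
    move=> w; have H : C w ^+ 2 <= M ^+ 2.
      by rewrite -real_normK ?num_real// lerXn2r ?nnegrE.
    have x2 : x ^+ 2 <= 1.
      by rewrite -real_normK ?num_real// exprn_ile1.
    have := sqr_ge0 (x * C w - n%:R * S w).
    have : (x * C w) ^+ 2 <= C w ^+ 2 by rewrite exprMn ler_piMl ?sqr_ge0.
    have := sqr_ge0 (n%:R * S w); have := sqr_ge0 (x * C w).
    by nra.
  have [e0|e0] := leP 0 e.
    by have := b1 1; rewrite normr1 mul1r ger0_norm// => /(_ (lexx _)).
  by have := b1 (-1); rewrite normrN1 mulN1r ltr0_norm// => /(_ (lexx _)).
apply/eqP; rewrite -normr_eq0 eq_le normr_ge0 andbT leNgt; apply/negP => e0.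
pose K := M ^+ 2 + (b - a) ^+ 2.
have K0 : 0 <= K by rewrite addr_ge0 ?sqr_ge0.
have := key (Num.truncn (K / `|e|)).+1 isT; rewrite -/K leNgt => /negP; apply.
rewrite mulrC -ltr_pdivrMr//; exact: truncnS_gt.
Qed.
End covariation.

(** * Elementary stochastic integrals *)
Section elementary_integrals.
Context {R : realType} d {Omega : measurableType d} (P : probability Omega R).
Variables (T : R) (F : R -> set (set Omega)) (W : nat -> R -> Omega -> R).
Hypothesis filtF : filtration T F.
Hypothesis bmW : forall n, brownian_motion P T F (W n).
Hypothesis indW : independent_processes P T W.
Implicit Types (C Y Z : Omega -> R) (a b : R) (p q : nat).

Definition bounded_for (G : set (set Omega)) C :=
  measurable_for G C /\ exists M : R, forall w, `|C w| <= M.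

Lemma bounded_for_mono a b C : 0 <= a -> a <= b -> b <= T -> bounded_for (F a) C -> bounded_for (F b) C.
Proof. by move=> a0 ab bT [mC bC]; split => //; exact: (mfor_mono filtF a0 ab bT mC). Qed.

Lemma bounded_forM a C Y : 0 <= a <= T -> bounded_for (F a) C -> bounded_for (F a) Y ->
  bounded_for (F a) (fun w => C w * Y w).
Proof.
move=> aT [mC [M CM]] [mY [N YN]]; split; first exact: (mforM (F_sigma filtF aT)).
by exists (M * N) => w; rewrite normrM ler_pM.
Qed.

Lemma bounded_for_sqint a C Y : 0 <= a <= T -> bounded_for (F a) C -> sqint P Y ->
  sqint P (fun w => C w * Y w).
Proof. by move=> aT [mC [M CM]]; apply: (sqint_bnd (mfor_meas filtF aT mC) CM). Qed.

Let itvT a b : 0 <= a -> a <= b -> b <= T -> (0 <= a <= T) && (0 <= b <= T).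
Proof. by move=> a0 ab bT; rewrite a0 bT (le_trans ab bT) (le_trans a0 ab). Qed.

Lemma sqint_elem p a b C : 0 <= a -> a <= b -> b <= T -> bounded_for (F a) C ->
  sqint P (fun w => C w * (W p b w - W p a w)).
Proof.
move=> a0 ab bT bC; have /andP[aT _] := itvT a0 ab bT.
by apply: (bounded_for_sqint aT bC); have [] := bm_dlaw filtF (bmW p) a0 ab bT.
Qed.

Lemma mfor_elem p a b c C : 0 <= a -> a <= b -> b <= c -> c <= T -> bounded_for (F a) C ->
  measurable_for (F c) (fun w => C w * (W p b w - W p a w)).
Proof.
move=> a0 ab bc cT [mC _]; have /andP[aT cT'] := itvT a0 (le_trans ab bc) cT.
apply: (mforM (F_sigma filtF cT')).
  exact: (mfor_mono filtF a0 (le_trans ab bc) cT mC).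
by apply: (bm_dmfor filtF (bmW p)) => //; rewrite ?(le_trans a0) ?(le_trans ab).
Qed.

(** Two overlapping intervals: the first increment is split at [a'] and at the
    end [c] of the overlap. Its early part is in the past of the second increment;
    the overlap is treated by cutting the second increment at the same time [c]
    and applying [bm_cross_increment] to the common interval. *)
Let bm_cross_le p q a b a' b' C C' : p != q -> 0 <= a -> a <= b -> b <= T ->
  a <= a' -> a' <= b' -> b' <= T -> bounded_for (F a) C -> bounded_for (F a') C' ->
  Ex P (fun w => C w * (W p b w - W p a w) * (C' w * (W q b' w - W q a' w))) = 0.
Proof.
move=> pq a0 ab bT aa' a'b' b'T bC bC'.
have a'0 := le_trans a0 aa'.
have /andP[aT bT'] := itvT a0 ab bT.
have /andP[a'T b'T'] := itvT a'0 a'b' b'T.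
(* the two increments have become orthogonal as soon as the first one is over *)
have early c : a <= c -> c <= a' ->
    Ex P (fun w => C w * (W p c w - W p a w) * (C' w * (W q b' w - W q a' w))) = 0.
  move=> ac ca'.
  have cT : c <= T by rewrite (le_trans ca')// (le_trans a'b').
  have sE := sqint_elem p a0 ac cT bC.
  rewrite (_ : (fun w => _) = (fun w => C' w * (C w * (W p c w - W p a w)) *
     (W q b' w - W q a' w))); last by apply/funext => w; ring.
  apply: (bm_mean0 filtF (bmW q) a'0 a'b' b'T).
    apply: (mforM (F_sigma filtF a'T) bC'.1).
    apply: mfor_elem => //; by case/andP: a'T.
  exact: (bounded_for_sqint a'T bC' sE).
have [ba'|a'b] := leP b a'; first exact: early.
have bCC' : bounded_for (F a') (fun w => C w * C' w).
  by apply: bounded_forM => //; apply: (bounded_for_mono a0 aa') => //; case/andP: a'T.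
have Tb : Num.min b b' <= T by rewrite ge_min bT.
have a'm : a' <= Num.min b b' by rewrite le_min a'b' ltW.
have m0 : 0 <= Num.min b b' by rewrite (le_trans a'0).
pose c := Num.min b b'.
have sp c' : a' <= c' -> c' <= T -> sqint P (fun w => W p c' w - W p a' w).
  by move=> ac' c'T; have [] := bm_dlaw filtF (bmW p) a'0 ac' c'T.
have decomp : (fun w => C w * (W p b w - W p a w) * (C' w * (W q b' w - W q a' w))) =
  (fun w => C w * (W p a' w - W p a w) * (C' w * (W q b' w - W q a' w)) +
   ((C w * C' w) * (W p c w - W p a' w) * (W q c w - W q a' w) +
    ((C w * C' w) * (W p c w - W p a' w) * (W q b' w - W q c w) +
     (C w * C' w) * (W q b' w - W q a' w) * (W p b w - W p c w)))).
  apply/funext => w; rewrite /c; case: (leP b b') => _; ring.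
have cb : c <= b by rewrite /c ge_min lexx.
have cb' : c <= b' by rewrite /c ge_min lexx orbT.
have sCp := sqint_elem p a'0 a'm Tb bCC'.
have sCq := sqint_elem q a'0 a'b' b'T bCC'.
have [sq1 _ _] := bm_dlaw filtF (bmW q) a'0 a'm Tb.
have [sq2 _ _] := bm_dlaw filtF (bmW q) m0 cb' b'T.
have [sp2 _ _] := bm_dlaw filtF (bmW p) m0 cb bT.
rewrite decomp ExD; last 2 first.
  - apply: sqint_mul; last exact: sqint_elem.
    apply: sqint_elem => //; by case/andP: a'T.
  - by apply: int1D; [|apply: int1D]; exact: sqint_mul.
rewrite early// ExD; [|exact: sqint_mul|by apply: int1D; exact: sqint_mul].
have [M CM] := bCC'.2.
rewrite (bm_cross_increment filtF bmW indW pq a'0 a'm Tb bCC'.1 CM).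
rewrite ExD; [|exact: sqint_mul|exact: sqint_mul].
rewrite (bm_mean0 filtF (bmW q) m0 cb' b'T); [|exact: mfor_elem|exact: sCp].
have [bb'|b'b] := leP b b'.
  rewrite !add0r.
  rewrite (_ : (fun w => _) = (fun=> 0)) ?Ex_cst//.
  by apply/funext => w; rewrite /c (min_idPl bb') subrr mulr0.
have cE : c = b' by rewrite /c (min_idPr (ltW b'b)).
rewrite (bm_mean0 filtF (bmW p) m0 cb bT) ?addr0//.
rewrite -/c cE; exact: mfor_elem.
Qed.

Lemma bm_cross p q a b a' b' C C' : p != q -> 0 <= a -> a <= b -> b <= T ->
  0 <= a' -> a' <= b' -> b' <= T -> bounded_for (F a) C -> bounded_for (F a') C' ->
  Ex P (fun w => C w * (W p b w - W p a w) * (C' w * (W q b' w - W q a' w))) = 0.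
Proof.
move=> pq a0 ab bT a'0 a'b' b'T bC bC'.
have [aa'|/ltW aa'] := leP a a'; first exact: bm_cross_le.
rewrite -(@bm_cross_le q p a' b' a b C' C)// 1?eq_sym//.
by congr Ex; apply/funext => w; rewrite mulrC.
Qed.

Definition stint (W : R -> Omega -> R) (tau : nat -> R) (c : nat -> Omega -> R) n w :=
  \sum_(i < n) c i w * (W (tau i.+1) w - W (tau i) w).

(** The quadratic variation of [stint], that is, the integral of the square of
    the step process with values [c i]. *)
Definition qvar (tau : nat -> R) (c : nat -> Omega -> R) n (w : Omega) :=
  \sum_(i < n) c i w ^+ 2 * (tau i.+1 - tau i).

(** The coefficient [c i] belongs to the step from [tau i] to [tau i.+1] and is
    known at its beginning. *)
Definition discrete n (tau : nat -> R) (c : nat -> Omega -> R) :=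
  [/\ forall i, (i <= n)%N -> 0 <= tau i <= T,
      forall i, (i < n)%N -> tau i <= tau i.+1 &
      forall i, (i < n)%N -> bounded_for (F (tau i)) (c i)].

Lemma discrete_mono n tau c : discrete n tau c ->
  forall i j, (i <= j <= n)%N -> tau i <= tau j.
Proof.
case=> _ h _ i; elim=> [|j IH]; first by rewrite leqn0 => /andP[/eqP->].
rewrite leq_eqVlt => /andP[/orP[/eqP -> //|ij] jn].
by rewrite (le_trans (IH _) (h _ jn))// -ltnS ij ltnW.
Qed.

Section one_discrete.
Variables (n : nat) (tau : nat -> R) (c : nat -> Omega -> R).
Hypothesis D : discrete n tau c.

Let t0 i : (i <= n)%N -> 0 <= tau i.
Proof. by case: D => h _ _ /h/andP[]. Qed.
Let tT i : (i <= n)%N -> tau i <= T.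
Proof. by case: D => h _ _ /h/andP[]. Qed.

Lemma sqint_term p (i : 'I_n) : sqint P (fun w => c i w * (W p (tau i.+1) w - W p (tau i) w)).
Proof.
case: D => _ h2 h3.
by apply: sqint_elem; [exact/t0/ltnW|exact: h2|exact: tT|exact: h3].
Qed.

Lemma sqint_stint p : sqint P (stint (W p) tau c n).
Proof. by apply: sqint_sum => i _; exact: sqint_term. Qed.

(** The integral is orthogonal to the past of its first time. *)
Lemma stint_mean0 p s Y : 0 <= s -> (forall i, (i < n)%N -> s <= tau i) ->
  measurable_for (F s) Y -> sqint P Y -> Ex P (fun w => Y w * stint (W p) tau c n w) = 0.
Proof.
move=> s0 st mY sY; case: (D) => h1 h2 h3.
under [X in Ex _ X]eq_fun do rewrite mulr_sumr.
rewrite Ex_sum; last by move=> i _; apply: sqint_mul => //; exact: sqint_term.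
rewrite big1// => i _; have iT := h1 _ (ltnW (ltn_ord i)).
rewrite (_ : (fun w => _) = (fun w => (c i w * Y w) * (W p (tau i.+1) w - W p (tau i) w)));
  last by apply/funext => w; ring.
have /andP[i0 iT'] := iT.
apply: (bm_mean0 filtF (bmW p)); [by []|exact: h2|exact: tT| |].
  apply: (mforM (F_sigma filtF iT) (h3 _ _).1) => //.
  by apply: (mfor_mono filtF s0 _ iT' mY); exact: st.
by apply: (bounded_for_sqint iT) => //; exact: h3.
Qed.

Lemma stint_isometry p : Ex P (fun w => stint (W p) tau c n w ^+ 2) = Ex P (qvar tau c n).
Proof.
case: (D) => h1 h2 h3.
pose e i w := c i w * (W p (tau i.+1) w - W p (tau i) w).
rewrite (_ : (fun w => _) = (fun w => \sum_(i < n) \sum_(j < n) e i w * e j w)); last first.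
  apply/funext => w; rewrite expr2 /stint mulr_suml; apply: eq_bigr => i _.
  by rewrite mulr_sumr.
have iee (i j : 'I_n) : int1 P (fun w => e i w * e j w) by apply: sqint_mul; exact: sqint_term.
rewrite Ex_sum; last by move=> i _; apply: int1_sum.
have ic (i : 'I_n) : int1 P (fun w => c i w ^+ 2).
  have iT := h1 _ (ltnW (ltn_ord i)).
  have := (bounded_for_sqint iT (h3 _ (ltn_ord i)) (sqint_cst P 1)).2.
  by under [X in int1 _ X]eq_fun do rewrite mulr1.
rewrite /qvar Ex_sum; last first.
  by move=> i _; under [X in int1 _ X]eq_fun do rewrite mulrC; exact: int1Z.
have off (i j : 'I_n) : (i < j)%N -> Ex P (fun w => e i w * e j w) = 0.
  move=> ij; have jT := h1 _ (ltnW (ltn_ord j)); have /andP[j0 jT'] := jT.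
  rewrite (_ : (fun w => _) = (fun w => (c j w * e i w) * (W p (tau j.+1) w - W p (tau j) w)));
    last by apply/funext => w; rewrite /e; ring.
  apply: (bm_mean0 filtF (bmW p)); [by []|exact: h2|exact: tT| |].
    apply: (mforM (F_sigma filtF jT) (h3 _ _).1) => //.
    apply: mfor_elem => //; [exact/t0/ltnW|exact: h2| |exact: h3].
    by apply: (discrete_mono D); rewrite ij ltnW.
  by apply: (bounded_for_sqint jT); [exact: h3|exact: sqint_term].
apply: eq_bigr => i _; rewrite Ex_sum// (bigD1 i)//= big1 ?addr0.
  under [X in Ex _ X]eq_fun do rewrite -expr2.
  have iT := h1 _ (ltnW (ltn_ord i)); have /andP[i0 iT'] := iT.
  have sc : sqint P (c i).
    by split; [exact: mfor_meas filtF _ _ iT (h3 _ (ltn_ord i)).1|exact: ic].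
  rewrite (bm_sqr filtF (bmW p) _ _ _ (h3 _ _).1 sc).2//; [|exact: h2|exact: tT].
  by rewrite mulrC -ExZ//; congr Ex; apply/funext => w; rewrite mulrC.
move=> j ji; have [lt|lt|/val_inj eq] := ltngtP i j; last by rewrite eq eqxx in ji.
  exact: off.
by rewrite -(off j i lt); congr Ex; apply/funext => w; rewrite mulrC.
Qed.

End one_discrete.

Lemma stint_cross p q n tau c n' tau' c' : p != q -> discrete n tau c ->
  discrete n' tau' c' ->
  Ex P (fun w => stint (W p) tau c n w * stint (W q) tau' c' n' w) = 0.
Proof.
move=> pq D D'; have [h1 h2 h3] := D; have [h1' h2' h3'] := D'.
under [X in Ex _ X]eq_fun do rewrite mulr_suml.
rewrite Ex_sum; last first.
  by move=> i _; apply: sqint_mul; [exact: sqint_term D _ _|exact: sqint_stint D' _].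
rewrite big1// => i _.
under [X in Ex _ X]eq_fun do rewrite mulr_sumr.
rewrite Ex_sum; last first.
  by move=> j _; apply: sqint_mul; [exact: sqint_term D _ _|exact: sqint_term D' _ _].
rewrite big1// => j _.
have /andP[? _] := h1 _ (ltnW (ltn_ord i)); have /andP[_ ?] := h1 _ (ltn_ord i).
have /andP[? _] := h1' _ (ltnW (ltn_ord j)); have /andP[_ ?] := h1' _ (ltn_ord j).
by apply: bm_cross => //; [exact: h2|exact: h2'|exact: h3|exact: h3'].
Qed.

End elementary_integrals.

(** * Stopping an elementary integral *)
Section stopping.
Context {R : realType} d {Omega : measurableType d}.
Variables (T : R) (F : R -> set (set Omega)).
Hypothesis filtF : filtration T F.
Implicit Types (tau : nat -> R) (c : nat -> Omega -> R) (n : nat) (K : R).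

(** The coefficient [c i] is switched off as soon as the quadratic variation
    accumulated up to the end of step [i] exceeds [K]. This amount is known at the
    beginning of the step, so that the stopped process is still adapted. *)
Definition stopped tau c K i w : R := c i w * (qvar tau c i.+1 w <= K)%R%:R.

Lemma qvarS tau c n (w : Omega) :
  qvar tau c n.+1 w = qvar tau c n w + c n w ^+ 2 * (tau n.+1 - tau n).
Proof. by rewrite /qvar big_ord_recr. Qed.

Lemma natr_bool_sqr (b : bool) : (b%:R : R) ^+ 2 = b%:R.
Proof. by case: b; rewrite ?expr1n ?expr0n. Qed.

Variables (n : nat) (tau : nat -> R) (c : nat -> Omega -> R).
Hypothesis D : discrete T F n tau c.

Lemma qvar_mono i j (w : Omega) : (i <= j <= n)%N -> qvar tau c i w <= qvar tau c j w.
Proof.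
case: D => _ h _; elim: j => [|j IH]; first by rewrite leqn0 => /andP[/eqP->].
rewrite leq_eqVlt => /andP[/orP[/eqP -> //|ij] jn].
rewrite (le_trans (IH _)) 1?[(j <= n)%N]ltnW ?andbT// qvarS lerDl.
by rewrite mulr_ge0 ?sqr_ge0// subr_ge0 h.
Qed.

Lemma qvar_ge0 (w : Omega) : 0 <= qvar tau c n w.
Proof. by have := @qvar_mono 0%N n w; rewrite {1}/qvar big_ord0 leqnn; apply. Qed.

Lemma qvar_stopped K (w : Omega) : 0 <= K ->
  qvar tau (stopped tau c K) n w <= Num.min K (qvar tau c n w).
Proof.
move=> K0; have [_ h _] := D.
suff H i : (i <= n)%N -> qvar tau (stopped tau c K) i w <= K /\
    qvar tau (stopped tau c K) i w <= qvar tau c i w.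
  by rewrite le_min; apply/andP; apply: H.
elim: i => [_|i IH ilt]; first by rewrite /qvar !big_ord0.
have [IH1 IH2] := IH (ltnW ilt).
have le : qvar tau (stopped tau c K) i.+1 w <= qvar tau c i.+1 w.
  rewrite !qvarS lerD// ler_wpM2r ?subr_ge0 ?h// /stopped exprMn natr_bool_sqr.
  by rewrite ler_piMr ?sqr_ge0// lern1 leq_b1.
split => //; have [QK|KQ] := leP (qvar tau c i.+1 w) K; first exact: le_trans le QK.
by rewrite qvarS {2}/stopped (lt_geF KQ) mulr0 expr0n mul0r addr0.
Qed.

Lemma stint_stopped (W : R -> Omega -> R) K (w : Omega) : qvar tau c n w <= K ->
  stint W tau (stopped tau c K) n w = stint W tau c n w.
Proof.
move=> QK; apply: eq_bigr => i _; rewrite /stopped (le_trans _ QK) ?mulr1//.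
by apply: qvar_mono; rewrite ltn_ord leqnn.
Qed.

Lemma mfor_qvar i j : (i <= j.+1)%N -> (j < n)%N ->
  measurable_for (F (tau j)) (qvar tau c i).
Proof.
move=> ij jn; have [h1 h2 h3] := D; have jT := h1 _ (ltnW jn).
apply: (mfor_sum (F_sigma filtF jT)) => k.
have kn : (k < n)%N by rewrite (leq_trans (ltn_ord k))// (leq_trans ij).
apply: (mforM (F_sigma filtF jT)); last exact: (mfor_cst (F_sigma filtF jT)).
apply: (mforX (F_sigma filtF jT)).
have /andP[k0 _] := h1 _ (ltnW kn); have /andP[_ jT'] := jT.
apply: (mfor_mono filtF k0 _ jT' (h3 _ kn).1).
apply: (discrete_mono D); rewrite (ltnW jn) andbT.
exact: leq_trans (ltn_ord k) ij.
Qed.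

Lemma discrete_stopped K : discrete T F n tau (stopped tau c K).
Proof.
have [h1 h2 h3] := D; split => // i ilt; have iT := h1 _ (ltnW ilt).
apply: (bounded_forM filtF iT); first exact: h3.
split; last by exists 1 => w; rewrite ger0_norm ?ler0n// lern1 leq_b1.
by apply: mfor_le; exact: mfor_qvar.
Qed.

Lemma meas_qvar : measurable_fun setT (qvar tau c n).
Proof.
have [h1 h2 h3] := D; apply: measurable_sum => i; apply: measurable_funM => //.
apply: measurable_funX; exact: (mfor_meas filtF (h1 _ (ltnW (ltn_ord i))) (h3 _ (ltn_ord i)).1).
Qed.

End stopping.

(** Splits nested minima and maxima into linear cases, innermost test first. *)
Ltac case_ifs := repeat match goal with
  |- context [if (?a < ?b)%R then _ else _] =>
    lazymatch a with
    | context [if _ then _ else _] => fail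
    | _ => lazymatch b with
           | context [if _ then _ else _] => fail
           | _ => case: (ltP a b) => ?
           end
    end
  end.

(** * Restricting a simple process to a time interval *)
Section clamping.
Context {R : realType} d {Omega : measurableType d}.
Variables (T : R) (F : R -> set (set Omega)).
Hypothesis filtF : filtration T F.
Variables (s t : R).
Hypotheses (s0 : 0 <= s) (st : s <= t) (tT : t <= T).
Variable h : @simple_process R d Omega.
Hypothesis hF : simple_adapted T F h.

Definition clamp (x : R) : R := Num.max s (Num.min t x).
Definition ctime i := clamp (sp_time h i).
Definition ccoef i (w : Omega) := sp_coef h i w * (sp_time h i < t)%R%:R.

Lemma clamp_ge x : s <= clamp x. Proof. by rewrite le_max lexx. Qed.
Lemma clamp_le x : clamp x <= t. Proof. by rewrite ge_max st ge_min lexx. Qed.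

Lemma clampB (x y : R) : x <= y -> (x < t)%R%:R * (clamp y - clamp x) =
  if Num.max x s < Num.min y t then Num.min y t - Num.max x s else 0.
Proof.
move=> xy; rewrite /clamp /Num.max /Num.min; case: (ltP x t) => xt; rewrite ?mul1r ?mul0r; case_ifs; lra.
Qed.

Lemma discrete_clamp : discrete T F (sp_size h) ctime ccoef.
Proof.
have [h1 h2 h3 h4] := hF; split => [i ih|i ih|i ih].
- by rewrite (le_trans s0) ?clamp_ge// (le_trans (clamp_le _)).
- have := h2 i ih; rewrite /ctime /clamp /Num.max /Num.min; case_ifs; lra.
- have cT : 0 <= ctime i <= T by rewrite (le_trans s0) ?clamp_ge// (le_trans (clamp_le _)).
  have /andP[i0 _] := h1 i (ltnW ih); have /andP[_ c1] := cT.
  rewrite /ccoef; have [lt|ge] := ltP (sp_time h i) t; last first.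
    split; last by exists 0 => w; rewrite mulr0 normr0.
    by under [X in measurable_for _ X]eq_fun do rewrite mulr0; exact: (mfor_cst (F_sigma filtF cT)).
  have [M hM] := h4 i ih.
  split; last by exists M => w; rewrite mulr1.
  under [X in measurable_for _ X]eq_fun do rewrite mulr1.
  apply: (mfor_mono filtF i0 _ c1 (h3 i ih)).
  by rewrite /ctime /clamp (min_idPr (ltW lt)) le_max lexx orbT.
Qed.

Lemma stint_clamp (W : R -> Omega -> R) (w : Omega) :
  simple_integral W h t w - simple_integral W h s w = stint W ctime ccoef (sp_size h) w.
Proof.
have [h1 h2 h3 h4] := hF.
have E x : W (Num.min x t) w - W (Num.min x s) w = W (clamp x) w - W s w.
  rewrite /clamp minC; have [xt|xt] := leP t x.
    by rewrite (min_idPr (le_trans st xt)) (max_idPr st).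
  by have [xs|xs] := leP x s; rewrite ?subrr.
rewrite /simple_integral /stint -sumrB; apply: eq_bigr => i _.
rewrite -mulrBr /ccoef -mulrA; congr (_ * _).
transitivity (W (ctime i.+1) w - W (ctime i) w).
  have := E (sp_time h i); have := E (sp_time h i.+1); rewrite /ctime; lra.
have [lt|ge] := ltP (sp_time h i) t; first by rewrite mul1r.
rewrite mul0r /ctime /clamp (min_idPl ge) (min_idPl (le_trans ge _)) ?subrr//.
exact: h2.
Qed.

Lemma qvar_clamp (w : Omega) :
  (\int[lebesgue_measure]_(r in `]s, t]) ((simple_eval h r w) ^+ 2)%:E =
   (qvar ctime ccoef (sp_size h) w)%:E)%E.
Proof.
have [h1 h2 h3 h4] := hF.
pose J i := `]sp_time h i, sp_time h i.+1]%classic.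
have tm i j : (i <= j <= sp_size h)%N -> sp_time h i <= sp_time h j.
  elim: j => [|j IH]; first by rewrite leqn0 => /andP[/eqP->].
  rewrite leq_eqVlt => /andP[/orP[/eqP -> //|ij] jn].
  by rewrite (le_trans (IH _) (h2 _ jn))// -ltnS ij ltnW.
have disj (i j : 'I_(sp_size h)) r : i != j -> (\1_(J i) r : R) * \1_(J j) r = 0.
  suff H (i' j' : 'I_(sp_size h)) : (i' < j')%N -> (\1_(J i') r : R) * \1_(J j') r = 0.
    move=> ij; have [lt|lt|/val_inj eq] := ltngtP i j; first exact: H.
      by rewrite mulrC; exact: H.
    by rewrite eq eqxx in ij.
  move=> ij; rewrite !indicE !mem_setE !in_itv /=.
  have := tm i'.+1 j'; rewrite ij ltnW// => /(_ isT) le.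
  case: (ltP (sp_time h j') r) => [a2|]; last by rewrite /= mulr0.
  by rewrite [r <= sp_time h i'.+1]leNgt (le_lt_trans le a2) andbF mul0r.
have sq u : simple_eval h u w ^+ 2 = \sum_(i < sp_size h) sp_coef h i w ^+ 2 * \1_(J i) u.
  rewrite expr2 /simple_eval mulr_suml; apply: eq_bigr => i _.
  rewrite mulr_sumr (bigD1 i)//= big1 ?addr0.
    by rewrite mulrACA -!expr2 indicE natr_bool_sqr.
  by move=> j ji; rewrite mulrACA disj ?mulr0// eq_sym.
under eq_integral do rewrite sq -sumEFin.
rewrite ge0_integral_sum//; last 2 first.
  - by move=> i; apply/measurable_EFinP; apply: measurable_funM => //;
     apply: measurable_indic; exact: measurable_itv.
  - by move=> i r _; rewrite lee_fin mulr_ge0 ?sqr_ge0// indicE; case: (_ \in _).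
rewrite /qvar -sumEFin; apply: eq_bigr => i _.
under eq_integral do rewrite EFinM.
rewrite ge0_integralZl//; last 2 first.
  - by apply/measurable_EFinP; apply: measurable_indic; exact: measurable_itv.
  - by rewrite lee_fin sqr_ge0.
rewrite integral_indic//; last exact: measurable_itv.
have lt := h2 _ (ltn_ord i).
have -> : J i `&` `]s, t] = `]Num.max (sp_time h i) s, Num.min (sp_time h i.+1) t]%classic.
  apply/seteqP; split => r; rewrite /J /= !in_itv /= gt_max le_min.
    by move=> [/andP[-> ->] /andP[-> ->]].
  by move=> /andP[/andP[-> ->] /andP[-> ->]].
rewrite /= lebesgue_measure_itv /= lte_fin -EFinB /ccoef exprMn natr_bool_sqr.
rewrite -mulrA clampB// EFinM; by case: ifPn.
Qed.
End clamping.

(** * Integrals over a strip of times *)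
Lemma section_meas {R : realType} d {Omega : measurableType d} d'
    {U : measurableType d'} (A : set R) (f : R * Omega -> U) (w : Omega) :
  measurable A -> measurable_fun (A `*` setT) f -> measurable_fun A (fun r => f (r, w)).
Proof.
move=> mA mf; apply: (measurable_comp _ _ mf).
- exact: measurableX.
- by move=> _ [r Ar <-].
- exact: measurable_funTS (pair2_measurable w).
Qed.

Section strips.
Context {R : realType} d {Omega : measurableType d} (P : probability Omega R).
Local Notation leb := (@lebesgue_measure R).
Variables (A : set R) (g : R * Omega -> \bar R).
Hypotheses (mA : measurable A) (mg : measurable_fun (A `*` setT) g)
  (g0 : forall z, (0 <= g z)%E).

Let gA := g \_ (A `*` setT).
Let mD : measurable (A `*` [set: Omega]).
Proof. exact: measurableX. Qed.
Let mgA : measurable_fun setT gA.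
Proof. exact/(measurable_restrictT g mD). Qed.
Let gA0 z : (0 <= gA z)%E.
Proof. by rewrite /gA /patch; case: ifP. Qed.
Let gAE (w : Omega) : (\int[leb]_r gA (r, w) = \int[leb]_(r in A) g (r, w))%E.
Proof.
rewrite [RHS]integral_mkcond; apply: eq_integral => r _.
by rewrite /gA !patchE in_setX in_setT andbT.
Qed.

Let gAE2 (r : R) : (\int[P]_w gA (r, w) = ((fun r => \int[P]_w g (r, w)) \_ A) r)%E.
Proof.
rewrite patchE; case: ifPn => rA.
  by apply: eq_integral => w _; rewrite /gA patchE in_setX in_setT rA.
by apply: integral0_eq => w _; rewrite /gA patchE in_setX (negbTE rA).
Qed.

Lemma strip_meas : measurable_fun setT (fun w => \int[leb]_(r in A) g (r, w))%E.
Proof.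
have := @measurable_fun_fubini_tonelli_G _ _ (measurableTypeR R) Omega R leb gA mgA gA0; rewrite /fubini_G.
by under eq_fun do rewrite gAE.
Qed.

Lemma strip_measF : measurable_fun A (fun r => \int[P]_w g (r, w))%E.
Proof.
apply/(measurable_restrictT _ mA).
have := @measurable_fun_fubini_tonelli_F _ _ (measurableTypeR R) Omega R P gA mgA gA0.
by rewrite /fubini_F; under eq_fun do rewrite gAE2.
Qed.

Lemma strip_tonelli : (\int[P]_w \int[leb]_(r in A) g (r, w) =
  \int[leb]_(r in A) \int[P]_w g (r, w))%E.
Proof.
under eq_integral do rewrite -gAE.
rewrite -(@fubini_tonelli _ _ (measurableTypeR R) Omega R leb P gA mgA gA0) [RHS]integral_mkcond.
by apply: eq_integral => r _; exact: gAE2.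
Qed.

Lemma strip_prod : (\int[leb \x P]_(z in A `*` setT) g z =
  \int[leb]_(r in A) \int[P]_w g (r, w))%E.
Proof.
rewrite integral_mkcond fubini_tonelli1// [RHS]integral_mkcond.
by apply: eq_integral => r _; exact: gAE2.
Qed.

End strips.

(** * Approximating an Ito integral by bounded elementary integrals *)
Section ito_approximation.
Context {R : realType} d {Omega : measurableType d} (P : probability Omega R).
Local Notation leb := (@lebesgue_measure R).
Variables (T : R) (F : R -> set (set Omega)) (W : R -> Omega -> R).
Hypothesis filtF : filtration T F.

Lemma cvg0_lt (u : nat -> \bar R) (e : R) : u @ \oo --> 0%E -> 0 < e ->
  \forall m \near \oo, (u m < e%:E)%E.
Proof.
move=> u0 e0; apply: (u0 [set x | (x < e%:E)%E]).
by apply: open_nbhs_nbhs; split; [exact: open_ereal_lt_ereal|rewrite /= lte_fin].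
Qed.

Lemma strip_sub (f : R * Omega -> R) s t : 0 <= s -> t <= T ->
  measurable_fun (@time_sample R d Omega T) f ->
  measurable_fun (`]s, t]%classic `*` [set: Omega]) f.
Proof.
move=> s0 tT; apply: measurable_funS; first by apply: measurableX.
move=> [r w] [/= + _]; rewrite /time_sample in_itv /= => /andP[sr rt].
by split => //=; rewrite in_itv /= (le_trans s0 (ltW sr)) (le_trans rt).
Qed.

(** Young's inequality in the form [x^2 <= (1 + e) y^2 + (1 + 1/e) (x - y)^2]:
    two nearby functions have nearly the same energy. *)
Lemma sqr_youngD (x y e : R) : 0 < e ->
  x ^+ 2 <= (1 + e) * y ^+ 2 + (1 + e^-1) * (x - y) ^+ 2.
Proof.
move=> e0; rewrite -subr_ge0.
have -> : (1 + e) * y ^+ 2 + (1 + e^-1) * (x - y) ^+ 2 - x ^+ 2 =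
  e * (y - (x - y) / e) ^+ 2 by field; rewrite gt_eqF.
by rewrite mulr_ge0 ?sqr_ge0// ltW.
Qed.

(** The definition of the Ito integral gives convergence in probability only, and
    says nothing about expectations. Stopping the approximating simple process at
    a large level [K] of its quadratic variation [Q] restores them: outside an
    event of small probability [Q] is at most [1 + e] times the energy of [H] plus
    an error, so [E min(K, Q)] is at most [(1 + e) A + e], and by Markov's
    inequality the level [K] is rarely reached. *)
Lemma ito_approx H I s t (A e : R) : is_ito_integral P T F W H I ->
  measurable_fun (@time_sample R d Omega T) (fun z => H z.1 z.2) ->
  0 <= s -> s <= t -> t <= T ->
  (\int[P]_w \int[leb]_(r in `]s, t]) (H r w ^+ 2)%:E <= A%:E)%E -> 0 < e ->
  exists n tau c, [/\ discrete T F n tau c, forall i, s <= tau i,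
    Ex P (qvar tau c n) <= (1 + e) * A + e &
    exists B, [/\ measurable B, (P B <= e%:E)%E &
      forall w, ~ B w -> `|stint W tau c n w - (I t w - I s w)| < e]].
Proof.
move=> [h [hF [mR cR] cS]] mH s0 st tT HA e0.
have mH2 : measurable_fun (`]s, t]%classic `*` [set: Omega])
    (fun z : R * Omega => ((H z.1 z.2) ^+ 2)%:E).
  by apply/measurable_EFinP; apply: measurable_funX; exact: strip_sub mH.
pose HI w := (\int[leb]_(r in `]s, t]) (H r w ^+ 2)%:E)%E.
have HI0 w : (0 <= HI w)%E by apply: integral_ge0 => r _; rewrite lee_fin sqr_ge0.
have mHI : measurable_fun setT HI.
  by apply: (strip_meas _ mH2) => // z; rewrite lee_fin sqr_ge0.
have A0 : 0 <= A by rewrite -lee_fin; apply: le_trans HA; apply: integral_ge0 => w _; exact: HI0.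
pose V := (1 + e) * A + e.
have V0 : 0 < V by rewrite /V ltr_wpDl// mulr_ge0// addr_ge0// ltW.
(* with this level, Markov's inequality gives probability at most e/4 to
   reach it *)
pose K := 4 * V / e.
have K0 : 0 < K by rewrite /K divr_gt0// mulr_gt0.
have e10 : 0 < 1 + e^-1 by rewrite addr_gt0// invr_gt0.
pose del := e / (2 * (1 + e^-1)).
have del0 : 0 < del by rewrite divr_gt0// mulr_gt0.
pose Rm m w := (\int[leb]_(r in `[0%R, T]) ((simple_eval (h m) r w - H r w) ^+ 2)%:E)%E.
have e2 : 0 < e / 2 by rewrite divr_gt0.
have e4 : 0 < e / 4 by rewrite divr_gt0.
have sT : 0 <= s <= T by rewrite s0 (le_trans st).
have tT' : 0 <= t <= T by rewrite (le_trans s0 st).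
have [mSt cSt] := cS t tT'; have [mSs cSs] := cS s sT.
have eK : 0 < e / (2 * K) by rewrite divr_gt0// mulr_gt0.
have [m [Pm Pt Ps]] : exists m, [/\ (P [set w | (del%:E <= Rm m w)%E] < (e / (2 * K))%:E)%E,
    (P [set w | ((e / 2)%:E <= (`|simple_integral W (h m) t w - I t w|)%:E)%E] < (e / 4)%:E)%E &
    (P [set w | ((e / 2)%:E <= (`|simple_integral W (h m) s w - I s w|)%:E)%E] < (e / 4)%:E)%E].
  near \oo => m; exists m; split; near: m.
  - exact: cvg0_lt (cR _ del0) eK.
  - exact: cvg0_lt (cSt _ e2) e4.
  - exact: cvg0_lt (cSs _ e2) e4.
pose tau := ctime s t (h m); pose c := ccoef t (h m); pose n := sp_size (h m).
have D : discrete T F n tau c := discrete_clamp filtF s0 st tT (hF m).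
pose Q := qvar tau c n.
have mQ : measurable_fun setT Q := meas_qvar filtF D.
have Q0 w : 0 <= Q w := qvar_ge0 D w.
pose BR := [set w | (del%:E <= Rm m w)%E].
have mBR : measurable BR.
  rewrite -[BR]setTI; exact: (emeasurable_fun_c_infty measurableT (mR m)).
pose QK w := Num.min K (Q w).
have mQK : measurable_fun setT QK by apply: measurable_minr.
have QK0 w : 0 <= QK w by rewrite le_min (ltW K0) Q0.
have iQK : int1 P QK.
  apply: int1_le (int1_cst P K) => // w.
  by rewrite ger0_norm// ge_min lexx.
have iBR : int1 P (\1_BR) by apply: integrable_indic.
(* on the complement of BR the simple integrand is close to H in L^2(s, t) *)
have near_H w : ((QK w)%:E <= (1 + e)%:E * HI w + ((1 + e^-1) * del)%:E + (K * \1_BR w)%:E)%E.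
  rewrite indicE; have [_|wBR] := boolP (w \in BR); rewrite /=.
    rewrite mulr1 -leeBlDr// (@le_trans _ _ 0%E)//.
      by rewrite -EFinB lee_fin subr_le0 ge_min lexx.
    apply: adde_ge0; last by rewrite lee_fin mulr_ge0// ltW.
    by apply: mule_ge0 => //; rewrite lee_fin addr_ge0// ltW.
  rewrite mulr0 adde0; apply: (@le_trans _ _ (Q w)%:E).
    by rewrite lee_fin ge_min lexx orbT.
  have Rw : (Rm m w <= del%:E)%E.
    by rewrite leNgt; apply/negP => /ltW; move: wBR; rewrite notin_setE.
  rewrite /Q -(qvar_clamp s t (hF m)).
  have mHw : measurable_fun `]s, t] (fun r => H r w).
    apply: (@section_meas _ _ _ _ _ _ (fun z => H z.1 z.2)) => //.
    exact: strip_sub mH.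
  have mhw : measurable_fun `]s, t] (fun r => simple_eval (h m) r w).
    apply: measurable_sum => i; apply: measurable_funM => //.
  have md : measurable_fun `]s, t] (fun r => ((simple_eval (h m) r w - H r w) ^+ 2)%:E).
    by apply/measurable_EFinP; apply: measurable_funX; apply: measurable_funB.
  have mH' : measurable_fun `]s, t] (fun r => (H r w ^+ 2)%:E).
    by apply/measurable_EFinP; apply: measurable_funX.
  have mh' : measurable_fun `]s, t] (fun r => (simple_eval (h m) r w ^+ 2)%:E).
    by apply/measurable_EFinP; apply: measurable_funX.
  apply: (@le_trans _ _ (\int[leb]_(r in `]s, t]) ((1 + e)%:E * (H r w ^+ 2)%:E +
      (1 + e^-1)%:E * ((simple_eval (h m) r w - H r w) ^+ 2)%:E))%E).
    apply: ge0_le_integral => //.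
    - by move=> r _; rewrite lee_fin sqr_ge0.
    - by apply: emeasurable_funD; apply: measurable_funeM.
    - by move=> r _; rewrite -!EFinM -EFinD lee_fin; exact: sqr_youngD.
  rewrite ge0_integralD//; last 4 first.
  - by move=> r _; rewrite -EFinM lee_fin mulr_ge0 ?sqr_ge0// addr_ge0// ltW.
  - exact: measurable_funeM.
  - by move=> r _; rewrite -EFinM lee_fin mulr_ge0 ?sqr_ge0// ltW.
  - exact: measurable_funeM.
  rewrite !ge0_integralZl//; last 4 first.
  - by move=> r _; rewrite lee_fin sqr_ge0.
  - by rewrite lee_fin ltW.
  - by move=> r _; rewrite lee_fin sqr_ge0.
  - by rewrite lee_fin addr_ge0// ltW.
  rewrite leeD2l// EFinM lee_pmul2l// ?fin_numE// ?lte_fin//.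
  apply: le_trans Rw; apply: ge0_subset_integral => //.
  - apply/measurable_EFinP; apply: measurable_funX; apply: measurable_funB.
      by apply: measurable_sum => i; exact: measurable_funM.
    by apply: (@section_meas _ _ _ _ _ _ (fun z => H z.1 z.2)).
  - by move=> r _; rewrite lee_fin sqr_ge0.
  - move=> r /=; rewrite !in_itv /= => /andP[sr rt].
    by rewrite (le_trans s0 (ltW sr)) (le_trans rt).
have mK : measurable_fun setT (fun w => (K * \1_BR w)%:E).
  by apply/measurable_EFinP; apply: measurable_funM => //; exact: measurable_indic.
have mcK : measurable_fun setT (fun w => ((1 + e^-1) * del)%:E + (K * \1_BR w)%:E)%E.
  by apply: emeasurable_funD => //; exact: measurable_cst.
have EQK : Ex P QK <= V.
  rewrite -lee_fin -Ex_EFin//.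
  apply: (@le_trans _ _ (\int[P]_w ((1 + e)%:E * HI w + (((1 + e^-1) * del)%:E + (K * \1_BR w)%:E)))%E).
    apply: ge0_le_integral => //.
    - by move=> w _; rewrite lee_fin.
    - exact/measurable_EFinP.
    - by apply: emeasurable_funD => //; exact: measurable_funeM.
    - by move=> w _; rewrite addeA; exact: near_H.
  have iK : P.-integrable setT (fun w => (K * \1_BR w)%:E) by exact: (int1Z K iBR).
  rewrite ge0_integralD//; last 3 first.
  - by move=> w _; apply: mule_ge0 => //; rewrite lee_fin addr_ge0// ltW.
  - exact: measurable_funeM.
  - move=> w _; rewrite -EFinD lee_fin; apply: addr_ge0; first by rewrite mulr_ge0 // ltW.
    by rewrite mulr_ge0 // ?indicE ?ler0n // ltW.
  have -> : (\int[P]_w (((1 + e^-1) * del)%:E + (K * \1_BR w)%:E) =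
      ((1 + e^-1) * del)%:E + K%:E * P BR)%E.
    rewrite ge0_integralD//; last 2 first.
    - by move=> w _; rewrite lee_fin mulr_ge0// ltW.
    - by move=> w _; rewrite lee_fin; apply: mulr_ge0; [exact: ltW | rewrite indicE ler0n].
    rewrite integral_cst//= probability_setT mule1; congr (_ + _)%E.
    under eq_integral do rewrite EFinM.
    rewrite ge0_integralZl ?integral_indic ?setIT ?lee_fin ?ltW//.
    exact/measurable_EFinP.
  rewrite ge0_integralZl//; last by rewrite lee_fin addr_ge0// ltW.
  have PBR : (K%:E * P BR <= (e / 2)%:E)%E.
    apply: (@le_trans _ _ (K%:E * (e / (2 * K))%:E)%E).
      by rewrite lee_pmul2l// ?lte_fin// ltW.
    by rewrite -EFinM lee_fin le_eqVlt; apply/orP; left; apply/eqP; field; rewrite gt_eqF.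
  have HA' : ((1 + e)%:E * \int[P]_w HI w <= ((1 + e) * A)%:E)%E.
    by rewrite EFinM lee_pmul2l// lte_fin addr_gt0.
  apply: le_trans (leeD HA' (leeD (lexx _) PBR)) _.
  rewrite -!EFinD lee_fin /V lerD2l /del le_eqVlt; apply/orP; left; apply/eqP.
  field; apply/andP; split; rewrite gt_eqF//; lra.
pose E1 := [set w | K < Q w].
pose Et := [set w | ((e / 2)%:E <= (`|simple_integral W (h m) t w - I t w|)%:E)%E].
pose Es := [set w | ((e / 2)%:E <= (`|simple_integral W (h m) s w - I s w|)%:E)%E].
have mE1 : measurable E1.
  have -> : E1 = setT `&` Q @^-1` `]K, +oo[.
    by apply/seteqP; split => w /=; rewrite in_itv /= andbT => // -[].
  exact: mQ.
have mEt : measurable Et by rewrite -[Et]setTI; exact: (emeasurable_fun_c_infty measurableT (mSt m)).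
have mEs : measurable Es by rewrite -[Es]setTI; exact: (emeasurable_fun_c_infty measurableT (mSs m)).
have PE1 : (P E1 <= (e / 4)%:E)%E.
  have iE1 : int1 P (fun w => K * \1_E1 w) by apply/int1Z/integrable_indic.
  have le : Ex P (fun w => K * \1_E1 w) <= V.
    apply: le_trans EQK; apply: Ex_le => // w.
    rewrite indicE; have [/set_mem|_] := boolP (w \in E1); last by rewrite mulr0.
    by rewrite /E1 /= /QK mulr1 => lt; rewrite le_min lexx ltW.
  have EE : Ex P (fun w => K * \1_E1 w) = K * fine (P E1).
    rewrite ExZ; last exact: integrable_indic.
    by rewrite /Ex /Rintegral integral_indic// setIT.
  rewrite -[P E1]fineK ?fin_num_measure// lee_fin.
  rewrite -(ler_pM2l K0) -EE (le_trans le)// /K le_eqVlt; apply/orP; left; apply/eqP.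
  by field; rewrite gt_eqF.
exists n, tau, (stopped tau c K); split.
- exact: discrete_stopped.
- by move=> i; exact: clamp_ge.
- apply: le_trans EQK; apply: Ex_le => //; last by move=> w; apply: (qvar_stopped D); exact: ltW.
  apply: int1_le iQK; first exact: (meas_qvar filtF (discrete_stopped filtF D K)).
  move=> w; rewrite ger0_norm; last exact: (qvar_ge0 (discrete_stopped filtF D K)).
  by apply: (qvar_stopped D); exact: ltW.
exists (E1 `|` (Et `|` Es)); split.
- by do 2 (apply: measurableU => //).
- apply: (le_trans (measureU2 _ _ _)) => //; first exact: measurableU.
  apply: (@le_trans _ _ ((e / 4)%:E + ((e / 4)%:E + (e / 4)%:E))%E); last first.
    by rewrite -!EFinD lee_fin; lra.
  apply: leeD => //; apply: (le_trans (measureU2 _ _ _)) => //.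
  by apply: leeD; exact: ltW.
- move=> w /not_orP[nE1 /not_orP[nEt nEs]].
  have QK' : Q w <= K by rewrite leNgt; apply/negP.
  have lt1 : `|simple_integral W (h m) t w - I t w| < e / 2.
    by rewrite ltNge; apply/negP; rewrite -lee_fin.
  have lt2 : `|simple_integral W (h m) s w - I s w| < e / 2.
    by rewrite ltNge; apply/negP; rewrite -lee_fin.
  rewrite (stint_stopped D)// -(stint_clamp st (hF m)).
  rewrite [X in `|X|](_ : _ = (simple_integral W (h m) t w - I t w) -
     (simple_integral W (h m) s w - I s w)); last by ring.
  by rewrite (le_lt_trans (ler_normB _ _))//; lra.
Unshelve. all: by end_near. Qed.
End ito_approximation.

(** * The increment of a difference of two Ito integrals *)
Section increments.
Context {R : realType} d {Omega : measurableType d} (P : probability Omega R).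
Local Notation leb := (@lebesgue_measure R).

Lemma le_small_error (x a C : R) : 0 <= C ->
  (forall e, 0 < e -> e <= 1 -> x <= a + e * C) -> x <= a.
Proof.
move=> C0 H; apply/ler_addgt0Pr => eps eps0.
have C1 : 0 < C + 1 by rewrite ltr_wpDl.
pose e := Num.min 1 (eps / (C + 1)).
have e0 : 0 < e by rewrite lt_min ltr01 divr_gt0.
have e1 : e <= 1 by rewrite ge_min lexx.
apply: (le_trans (H e e0 e1)); rewrite lerD2l.
apply: (@le_trans _ _ (e * (C + 1))); first by rewrite ler_wpM2l ?(ltW e0)// lerDl.
by rewrite -ler_pdivlMr// ge_min lexx orbT.
Qed.

(** Orthogonality and energy of the approximations [Z] pass to a limit [N] in
    probability, as an inequality. Truncating [(Y + N)^2] at a level [L] costs at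
    most [L e] on the exceptional event, which disappears with [e] before [L]
    tends to infinity by monotone convergence. *)
Lemma limit_in_probability (Y N : Omega -> R) (V : R) : sqint P Y ->
  measurable_fun setT N -> 0 <= V ->
  (forall e, 0 < e -> e <= 1 -> exists Z, [/\ sqint P Z,
     Ex P (fun w => Y w * Z w) = 0, Ex P (fun w => Z w ^+ 2) <= (1 + e) * V + e &
     exists B, [/\ measurable B, (P B <= e%:E)%E &
       forall w, ~ B w -> `|Z w - N w| < e]]) ->
  sqint P (fun w => Y w + N w) /\
  Ex P (fun w => (Y w + N w) ^+ 2) <= Ex P (fun w => Y w ^+ 2) + V.
Proof.
move=> sY mN V0 approx.
pose S w := Y w + N w; pose y := Ex P (fun w => Y w ^+ 2).
have y0 : 0 <= y by apply: Ex_ge0 => w; exact: sqr_ge0.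
have mS : measurable_fun setT S by apply: measurable_funD => //; exact: sY.1.
have mS2 : measurable_fun setT (fun w => S w ^+ 2) by exact: measurable_funX.
pose f L w := Num.min L (S w ^+ 2).
have mf L : measurable_fun setT (f L) by apply: measurable_minr.
have f0 L w : 0 <= L -> 0 <= f L w by move=> L0; rewrite le_min L0 sqr_ge0.
have iL L : 0 <= L -> int1 P (f L).
  move=> L0; apply: int1_le (int1_cst P L) => // w.
  by rewrite ger0_norm ?f0// ge_min lexx.
have bound L : 0 <= L -> Ex P (f L) <= y + V.
  move=> L0; apply: (@le_small_error _ _ (y + 3 * V + 4 + L)).
    by rewrite !addr_ge0// mulr_ge0.
  move=> e e0 e1; have [Z [sZ YZ ZV [B [mB PB BZ]]]] := approx e e0 e1.
  have iB : int1 P (\1_B) by apply: integrable_indic.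
  have sYZ := sqintD sY sZ.
  have pw w : f L w <= (1 + e) * (Y w + Z w) ^+ 2 + ((1 + e^-1) * e ^+ 2 + L * \1_B w).
    have q0 : 0 <= (1 + e) * (Y w + Z w) ^+ 2 by rewrite mulr_ge0 ?sqr_ge0// addr_ge0// ltW.
    have r0 : 0 <= (1 + e^-1) * e ^+ 2 by rewrite mulr_ge0 ?sqr_ge0// addr_ge0// invr_ge0 ltW.
    rewrite indicE; have [_|/negP wB] := boolP (w \in B).
      by rewrite mulr1 (@le_trans _ _ L) ?ge_min ?lexx// addrA lerDr addr_ge0.
    rewrite mulr0 addr0 (@le_trans _ _ (S w ^+ 2)) ?ge_min ?lexx ?orbT//.
    apply: le_trans (sqr_youngD (S w) (Y w + Z w) e0) _.
    rewrite lerD2l ler_wpM2l ?addr_ge0 ?invr_ge0 ?(ltW e0)//.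
    rewrite (_ : S w - (Y w + Z w) = - (Z w - N w)); last by rewrite /S; ring.
    rewrite sqrrN -real_normK ?num_real// lerXn2r ?nnegrE ?(ltW e0)//.
    by apply: ltW; apply: BZ => Bw; apply: wB; rewrite inE.
  have EL : Ex P (fun w => L * \1_B w) <= L * e.
    rewrite ExZ// ler_wpM2l// /Ex /Rintegral integral_indic// setIT.
    by rewrite -lee_fin fineK ?fin_num_measure.
  have EYZ : Ex P (fun w => (Y w + Z w) ^+ 2) <= y + ((1 + e) * V + e).
    by rewrite Ex_sqrD// YZ mulr0 addr0 lerD2l.
  apply: (@le_trans _ _ ((1 + e) * (y + ((1 + e) * V + e)) + ((1 + e^-1) * e ^+ 2 + L * e))).
    apply: le_trans (Ex_le (iL L L0) _ pw) _.
      by apply: int1D; [apply: int1Z; exact: sYZ.2|apply: int1D; [exact: int1_cst|exact: int1Z]].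
    rewrite ExD; [|by apply: int1Z; exact: sYZ.2|by apply: int1D; [exact: int1_cst|exact: int1Z]].
    rewrite ExZ; last exact: sYZ.2.
    rewrite ExD; [|exact: int1_cst|exact: int1Z].
    rewrite Ex_cst; apply: lerD; last by rewrite lerD2l.
    by rewrite ler_wpM2l// addr_ge0// ltW.
  have -> : (1 + e^-1) * e ^+ 2 = e ^+ 2 + e by field; rewrite gt_eqF.
  have ee : e ^+ 2 <= e by rewrite expr2 ler_piMr// ltW.
  have : e ^+ 2 * V <= e * V by rewrite ler_wpM2r.
  by nra.
have lim : (\int[P]_w (S w ^+ 2)%:E <= (y + V)%:E)%E.
  have cv : (\int[P]_w (f n%:R w)%:E)%E @[n --> \oo] --> (\int[P]_w (S w ^+ 2)%:E)%E.
    rewrite (_ : (\int[P]_w (S w ^+ 2)%:E = \int[P]_w (limn (fun n => (f n%:R w)%:E)))%E).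
      apply: cvg_monotone_convergence => //.
      - by move=> n; exact/measurable_EFinP.
      - by move=> n w _; rewrite lee_fin f0.
      - move=> w _ a b ab; rewrite lee_fin /f le_min !ge_min lexx orbT andbT.
        by rewrite ler_nat ab.
    apply: eq_integral => w _; apply/esym/cvg_lim => //.
    apply: cvg_near_cst; exists (Num.truncn (S w ^+ 2)).+1 => // n /= nS.
    rewrite /f; congr EFin; apply/min_idPr.
    by rewrite (le_trans (ltW (truncnS_gt _)))// ler_nat.
  rewrite -(cvg_lim _ cv)//; apply: lime_le; first by apply/cvg_ex; eexists; exact: cv.
  by near=> n; rewrite Ex_EFin ?iL// lee_fin bound.
have iS : int1 P (fun w => S w ^+ 2).
  by apply: int1_ge0P => //; [move=> w; exact: sqr_ge0|exact: le_lt_trans lim (ltry _)].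
by split => //; rewrite -lee_fin -Ex_EFin.
Unshelve. all: by end_near. Qed.

Variables (T : R) (F : R -> set (set Omega)) (W : nat -> R -> Omega -> R).
Hypothesis filtF : filtration T F.
Hypothesis bmW : forall n, brownian_motion P T F (W n).
Hypothesis indW : independent_processes P T W.

(** The upper half of the Ito isometry: a past variable [Y] is orthogonal to the
    increment, and the two integrals are orthogonal to each other because they are
    driven by distinct motions. [N] is any measurable version of the increment. *)
Lemma ito_increment p q (H G I J : R -> Omega -> R) s t (Y N : Omega -> R) (A A' : R) :
  p != q -> is_ito_integral P T F (W p) H I -> is_ito_integral P T F (W q) G J ->
  measurable_fun (@time_sample R d Omega T) (fun z => H z.1 z.2) ->
  measurable_fun (@time_sample R d Omega T) (fun z => G z.1 z.2) ->
  0 <= s -> s <= t -> t <= T ->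
  measurable_for (F s) Y -> sqint P Y -> measurable_fun setT N ->
  {ae P, forall w, N w = (I t w - I s w) - (J t w - J s w)} ->
  (\int[P]_w \int[leb]_(r in `]s, t]) (H r w ^+ 2)%:E <= A%:E)%E ->
  (\int[P]_w \int[leb]_(r in `]s, t]) (G r w ^+ 2)%:E <= A'%:E)%E ->
  sqint P (fun w => Y w + N w) /\
  Ex P (fun w => (Y w + N w) ^+ 2) <= Ex P (fun w => Y w ^+ 2) + (A + A').
Proof.
move=> pq iH iG mH mG s0 st tT mY sY mN NE HA GA'.
have pos (K : R -> Omega -> R) (a : R) :
    (\int[P]_w \int[leb]_(r in `]s, t]) (K r w ^+ 2)%:E <= a%:E)%E -> 0 <= a.
  move=> Ka; rewrite -lee_fin; apply: le_trans Ka; apply: integral_ge0 => w _.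
  by apply: integral_ge0 => r _; rewrite lee_fin sqr_ge0.
have A0 := pos _ _ HA; have A'0 := pos _ _ GA'.
apply: limit_in_probability => //; first exact: addr_ge0.
move=> e e0 _; have e2 : 0 < e / 2 by rewrite divr_gt0.
have [n [tau [c [D st1 Q1 [B [mB PB BZ]]]]]] := ito_approx filtF iH mH s0 st tT HA e2.
have [n' [tau' [c' [D' st2 Q2 [B' [mB' PB' BZ']]]]]] := ito_approx filtF iG mG s0 st tT GA' e2.
have s1 := sqint_stint filtF bmW D p; have s2 := sqint_stint filtF bmW D' q.
have [M [mM PM MN]] := NE.
exists (fun w => stint (W p) tau c n w - stint (W q) tau' c' n' w); split.
- exact: sqintB.
- under [X in Ex _ X]eq_fun do rewrite mulrBr.
  rewrite ExB; [|exact: sqint_mul|exact: sqint_mul].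
  rewrite (stint_mean0 filtF bmW D p s0 (fun i _ => st1 i) mY sY).
  by rewrite (stint_mean0 filtF bmW D' q s0 (fun i _ => st2 i) mY sY) subrr.
- have -> : (fun w => (stint (W p) tau c n w - stint (W q) tau' c' n' w) ^+ 2) =
     (fun w => (stint (W p) tau c n w + (-1) * stint (W q) tau' c' n' w) ^+ 2).
    by apply/funext => w; rewrite mulN1r.
  rewrite Ex_sqrD//; last exact: sqintZ.
  have -> : Ex P (fun w => stint (W p) tau c n w * (-1 * stint (W q) tau' c' n' w)) = 0.
    rewrite (_ : (fun w => _) = (fun w => (-1) * (stint (W p) tau c n w * stint (W q) tau' c' n' w)));
      last by apply/funext => w; ring.
    by rewrite ExZ ?(stint_cross filtF bmW indW pq D D') ?mulr0//; exact: sqint_mul.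
  under [X in _ + _ + Ex _ X]eq_fun do rewrite mulN1r sqrrN.
  rewrite (stint_isometry filtF bmW D) (stint_isometry filtF bmW D').
  by nra.
exists (B `|` (B' `|` M)); split.
- by do 2 (apply: measurableU => //).
- apply: (le_trans (measureU2 _ _ _)) => //; first exact: measurableU.
  rewrite [in leRHS](splitr e) EFinD; apply: leeD => //.
  by apply: (le_trans (measureU2 _ _ _)) => //; rewrite [X in (_ + X)%E]PM adde0.
- move=> w /not_orP[nB /not_orP[nB' nM]].
  have -> : N w = (I t w - I s w) - (J t w - J s w).
    by apply: contrapT => h; apply: nM; apply: MN.
  rewrite [X in `|X|](_ : _ = (stint (W p) tau c n w - (I t w - I s w)) -
    (stint (W q) tau' c' n' w - (J t w - J s w))); last by ring.
  rewrite (le_lt_trans (ler_normB _ _))// (splitr e) ltrD//; [exact: BZ|exact: BZ'].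
Qed.

End increments.

(** * Time integrals of continuous functions *)
Section time_integrals.
Context {R : realType}.
Local Notation leb := (@lebesgue_measure R).
Variables (T s t : R).
Hypotheses (s0 : 0 <= s) (st : s <= t) (tT : t <= T).
Implicit Types f g : R -> R.
Definition contT f := {within `[0, T], continuous f}.

Lemma contT_cst (a : R) : contT (fun=> a).
Proof. by move=> r; exact: cvg_cst. Qed.
Lemma contTD f g : contT f -> contT g -> contT (fun r => f r + g r).
Proof. by move=> cf cg r; apply: cvgD; [exact: cf|exact: cg]. Qed.
Lemma contTB f g : contT f -> contT g -> contT (fun r => f r - g r).
Proof. by move=> cf cg r; apply: cvgB; [exact: cf|exact: cg]. Qed.
Lemma contTM f g : contT f -> contT g -> contT (fun r => f r * g r).
Proof. by move=> cf cg r; apply: cvgM; [exact: cf|exact: cg]. Qed.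
Lemma contTX2 f : contT f -> contT (fun r => f r ^+ 2).
Proof. by move=> cf; under eq_fun do rewrite expr2; exact: contTM. Qed.

Lemma integrable_contT f : contT f -> leb.-integrable `[0, T] (EFin \o f).
Proof. by move=> cf; apply: continuous_compact_integrable => //; exact: segment_compact. Qed.

Lemma integrable_sub f : contT f -> leb.-integrable `]s, t] (EFin \o f).
Proof.
move=> /integrable_contT; apply: integrableS => // r /=; rewrite !in_itv /= => /andP[sr rt].
by rewrite (le_trans s0 (ltW sr)) (le_trans rt).
Qed.

Definition tint f : R := \int[leb]_(r in `]s, t]) f r.

Lemma tintD f g : contT f -> contT g -> tint (fun r => f r + g r) = tint f + tint g.
Proof. by move=> cf cg; rewrite /tint RintegralD//; exact: integrable_sub. Qed.
Lemma tintB f g : contT f -> contT g -> tint (fun r => f r - g r) = tint f - tint g.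
Proof. by move=> cf cg; rewrite /tint RintegralB//; exact: integrable_sub. Qed.
Lemma tintZ a f : contT f -> tint (fun r => a * f r) = a * tint f.
Proof. by move=> cf; rewrite /tint RintegralZl//; exact: integrable_sub. Qed.
Lemma tint_cst a : tint (fun=> a) = a * (t - s).
Proof.
rewrite /tint Rintegral_cst//= lebesgue_measure_itv /= lte_fin.
have [lt|ge] := ltP s t; first by rewrite -EFinB.
by have -> : t - s = 0 by apply/eqP; rewrite subr_eq0 eq_le ge st.
Qed.
Lemma tint_ge0 f : (forall r, 0 <= f r) -> 0 <= tint f.
Proof. by move=> f0; apply: Rintegral_ge0. Qed.

Lemma tint_EFin f : contT f -> (\int[leb]_(r in `]s, t]) (f r)%:E = (tint f)%:E)%E.
Proof.
move=> cf; rewrite /tint /Rintegral fineK//.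
exact: integrable_fin_num (integrable_sub cf).
Qed.

Lemma tint_sub a f : contT f ->
  \int[leb]_(r in `[0, t]) (a * f r) - \int[leb]_(r in `[0, s]) (a * f r) = a * tint f.
Proof.
move=> cf; have i0t : leb.-integrable `[0, t] (EFin \o (fun r => a * f r)).
  have := integrable_contT (contTM (@contT_cst a) cf).
  apply: integrableS => // r /=; rewrite !in_itv /=.
  by move=> /andP[-> rt]; rewrite (le_trans rt).
by rewrite Rintegral_itvB ?bnd_simp// -tintZ.
Qed.

(** Jensen's inequality: the variance of [f] about its mean is nonnegative. *)
Lemma tint_sqr f : contT f -> tint f ^+ 2 <= (t - s) * tint (fun r => f r ^+ 2).
Proof.
move=> cf; have cf2 := contTX2 cf.
have key a : 0 <= tint (fun r => f r ^+ 2) - 2 * a * tint f + a ^+ 2 * (t - s).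
  rewrite -tintZ// -tint_cst -tintB//; last exact: contTM (@contT_cst _) cf.
  rewrite -tintD; [|by apply: contTB => //; exact: contTM (@contT_cst _) cf|exact: contT_cst].
  apply: tint_ge0 => r.
  rewrite (_ : _ + _ = (f r - a) ^+ 2) ?sqr_ge0//; ring.
move: st; rewrite le_eqVlt => /orP[/eqP E|lt].
  have z : tint f = 0 by rewrite /tint E set_itv_ge ?Rintegral_set0// bnd_simp ltxx.
  by rewrite z E subrr mul0r expr0n.
have d0 : 0 < t - s by rewrite subr_gt0.
have := key (tint f / (t - s)).
have -> : tint (fun r => f r ^+ 2) - 2 * (tint f / (t - s)) * tint f +
    (tint f / (t - s)) ^+ 2 * (t - s) = tint (fun r => f r ^+ 2) - tint f ^+ 2 / (t - s).
  by field; rewrite gt_eqF.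
by rewrite subr_ge0 ler_pdivrMr// mulrC.
Qed.

(** Polarisation, [2 a f = a^2 + f^2 - (a - f)^2]: it makes the damping term of
    the energy balance visible, up to the oscillation [a - f]. *)
Lemma tint_polar a f : contT f -> 2 * a * tint f =
  (t - s) * a ^+ 2 + tint (fun r => f r ^+ 2) - tint (fun r => (a - f r) ^+ 2).
Proof.
move=> cf; have cf2 := contTX2 cf; have caf : contT (fun r => 2 * a * f r) by exact: contTM (@contT_cst _) cf.
rewrite -tintZ// [(t - s) * _]mulrC -tint_cst -tintD//; last exact: contT_cst.
rewrite -tintB; [|by apply: contTD => //; exact: contT_cst|by apply: contTX2; apply: contTB => //; exact: contT_cst].
by congr tint; apply/funext => r; ring.
Qed.

End time_integrals.

(** * Time integrals of random processes *)
Section random_time_integrals.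
Context {R : realType} d {Omega : measurableType d} (P : probability Omega R).
Local Notation leb := (@lebesgue_measure R).
Variables (T s t : R).
Hypotheses (s0 : 0 <= s) (st : s <= t) (tT : t <= T).
Variable K : R -> Omega -> R.
Hypothesis mK : measurable_fun (@time_sample R d Omega T) (fun z => K z.1 z.2).
Hypothesis cK : continuous_paths T K.

Let mKst : measurable_fun (`]s, t]%classic `*` [set: Omega])
  (fun z : R * Omega => K z.1 z.2).
Proof. exact: strip_sub mK. Qed.

Let g2 (z : R * Omega) := ((K z.1 z.2) ^+ 2)%:E.
Let mg2 : measurable_fun (`]s, t]%classic `*` [set: Omega]) g2.
Proof. by apply/measurable_EFinP; exact: measurable_funX. Qed.
Let g20 z : (0 <= g2 z)%E. Proof. by rewrite lee_fin sqr_ge0. Qed.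

Lemma meas_tint : measurable_fun setT (fun w => tint s t (fun r => K r w)).
Proof.
have mE : measurable_fun (`]s, t]%classic `*` [set: Omega])
   (EFin \o (fun z : R * Omega => K z.1 z.2)) by exact/measurable_EFinP.
have m1 := strip_meas (measurable_itv _) (measurable_funepos mE) (funepos_ge0 _).
have m2 := strip_meas (measurable_itv _) (measurable_funeneg mE) (funeneg_ge0 _).
rewrite (_ : (fun w => _) = fine \o (fun w =>
   (\int[leb]_(r in `]s, t]) ((EFin \o (fun z : R * Omega => K z.1 z.2))^\+ (r, w)) -
    \int[leb]_(r in `]s, t]) ((EFin \o (fun z : R * Omega => K z.1 z.2))^\- (r, w))))%E).
  apply: measurableT_comp; first exact: fine_measurable.
  exact: emeasurable_funB.
apply/funext => w; rewrite /tint /Rintegral integralE /=; congr (fine (_ - _)%E);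
  by apply: eq_integral => r _; rewrite unlock.
Qed.

Let T2 : (\int[P]_w \int[leb]_(r in `]s, t]) (K r w ^+ 2)%:E =
  \int[leb]_(r in `]s, t]) \int[P]_w (K r w ^+ 2)%:E)%E.
Proof. exact: (strip_tonelli P (measurable_itv _) mg2 g20). Qed.

Lemma E_tint_sqr : (\int[P]_w (tint s t (fun r => K r w ^+ 2))%:E =
  \int[leb]_(r in `]s, t]) \int[P]_w (K r w ^+ 2)%:E)%E.
Proof.
rewrite -T2.
by apply: eq_integral => w _; rewrite -(tint_EFin s0 tT)//; apply: contTX2; exact: cK.
Qed.

Let meas_tint_sqr : measurable_fun setT (fun w => tint s t (fun r => K r w ^+ 2)).
Proof.
have := strip_meas (measurable_itv _) mg2 g20.
under eq_fun => w.
  rewrite (tint_EFin s0 tT (f := fun r => K r w ^+ 2)); last by apply: contTX2; exact: cK.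
  over.
by move/measurable_EFinP.
Qed.

Lemma strip_tint : (\int[P]_w \int[leb]_(r in `]s, t]) (K r w ^+ 2)%:E =
  \int[P]_w (tint s t (fun r => K r w ^+ 2))%:E)%E.
Proof. by rewrite T2 E_tint_sqr. Qed.

Lemma int1_tint_sqr : (\int[P]_w \int[leb]_(r in `]s, t]) (K r w ^+ 2)%:E < +oo)%E ->
  int1 P (fun w => tint s t (fun r => K r w ^+ 2)).
Proof.
move=> fin; apply: int1_ge0P => //.
  by move=> w; apply: tint_ge0 => r; exact: sqr_ge0.
by move: fin; rewrite T2 E_tint_sqr.
Qed.

Lemma strip_le (b : R) : (forall r, s < r <= t -> sqint P (K r) /\ Ex P (fun w => K r w ^+ 2) <= b) ->
  (\int[P]_w \int[leb]_(r in `]s, t]) (K r w ^+ 2)%:E <= (b * (t - s))%:E)%E.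
Proof.
move=> Kb; rewrite T2.
apply: (@le_trans _ _ (\int[leb]_(r in `]s, t]) b%:E)%E).
  apply: ge0_le_integral => //.
  - by move=> r _; apply: integral_ge0 => w _; rewrite lee_fin sqr_ge0.
  - exact: (strip_measF P (measurable_itv _) mg2 g20).
  - move=> r /=; rewrite in_itv /= => /Kb[sK Eb].
    by rewrite Ex_EFin ?lee_fin//; exact: sK.2.
rewrite integral_cst//= lebesgue_measure_itv /= lte_fin.
have [lt|ge] := ltP s t; first by rewrite -EFinB.
have -> : t - s = 0 by apply/eqP; rewrite subr_eq0 eq_le ge st.
by rewrite mule0 mulr0.
Qed.

Lemma strip_ge (b : R) : 0 <= b -> (forall r, s < r <= t -> sqint P (K r) /\ b <= Ex P (fun w => K r w ^+ 2)) ->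
  ((b * (t - s))%:E <= \int[P]_w (tint s t (fun r => K r w ^+ 2))%:E)%E.
Proof.
move=> b0 Kb; rewrite E_tint_sqr.
apply: (@le_trans _ _ (\int[leb]_(r in `]s, t]) b%:E)%E); last first.
  apply: ge0_le_integral => //.
  - exact: (strip_measF P (measurable_itv _) mg2 g20).
  - move=> r /=; rewrite in_itv /= => /Kb[sK Eb].
    by rewrite Ex_EFin ?lee_fin//; exact: sK.2.
rewrite integral_cst//= lebesgue_measure_itv /= lte_fin.
have [lt|ge] := ltP s t; first by rewrite -EFinB.
have -> : t - s = 0 by apply/eqP; rewrite subr_eq0 eq_le ge st.
by rewrite mule0 mulr0.
Qed.

Lemma sqint_tint (a : R) : (\int[P]_w \int[leb]_(r in `]s, t]) (K r w ^+ 2)%:E <= a%:E)%E ->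
  sqint P (fun w => tint s t (fun r => K r w)) /\
  Ex P (fun w => tint s t (fun r => K r w) ^+ 2) <= (t - s) * a.
Proof.
move=> Ka; have i2 := int1_tint_sqr (le_lt_trans Ka (ltry _)).
have pw w := tint_sqr s0 st tT (@cK w).
have iD : int1 P (fun w => tint s t (fun r => K r w) ^+ 2).
  apply: int1_le (int1Z (t - s) i2); first by apply: measurable_funX; exact: meas_tint.
  by move=> w; rewrite ger0_norm ?sqr_ge0//; exact: pw.
split; first by split => //; exact: meas_tint.
apply: le_trans (Ex_le iD (int1Z (t - s) i2) pw) _.
rewrite ExZ// ler_wpM2l ?subr_ge0// -lee_fin -Ex_EFin//.
by move: Ka; rewrite T2 E_tint_sqr.
Qed.

End random_time_integrals.

(** * Second moment of one component *)
Section component.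
Context {R : realType} d {Omega : measurableType d} (P : probability Omega R).
Local Notation leb := (@lebesgue_measure R).
Variables (T : R) (F : R -> set (set Omega)) (W : nat -> R -> Omega -> R).
Hypothesis filtF : filtration T F.
Hypothesis bmW : forall n, brownian_motion P T F (W n).
Hypothesis indW : independent_processes P T W.
Variables (p q : nat) (H G x I J : R -> Omega -> R) (c : R).
Hypothesis pq : p != q.
Hypothesis c0 : 0 <= c.
Hypothesis iH : is_ito_integral P T F (W p) H I.
Hypothesis iG : is_ito_integral P T F (W q) G J.
Hypothesis mH : measurable_fun (@time_sample R d Omega T) (fun z => H z.1 z.2).
Hypothesis mG : measurable_fun (@time_sample R d Omega T) (fun z => G z.1 z.2).
Hypothesis mx : measurable_fun (@time_sample R d Omega T) (fun z => x z.1 z.2).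
Hypothesis ax : adapted T F x.
Hypothesis cx : continuous_paths T x.
Hypothesis eqx : forall t, 0 <= t <= T -> {ae P, forall w,
  x t w = x 0 w + I t w - J t w - \int[leb]_(r in `[0, t]) (c * x r w)}.

(** The martingale part of the increment. Written with the drift rather than with
    the Ito integrals, it is a measurable function of the path. *)
Let N s t w := x t w - x s w + c * tint s t (fun r => x r w).

Let xmeas t : 0 <= t <= T -> measurable_fun setT (x t).
Proof. by move=> tT; apply: (mfor_meas filtF tT); exact: ax. Qed.

Let N_meas s t : 0 <= s -> s <= t -> t <= T -> measurable_fun setT (N s t).
Proof.
move=> s0 st tT; apply: measurable_funD.
  by apply: measurable_funB; apply: xmeas; rewrite ?(le_trans s0)//= (le_trans st).
by apply: measurable_funM => //; exact: (meas_tint s0 tT mx).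
Qed.

Let N_eq s t : 0 <= s -> s <= t -> t <= T ->
  {ae P, forall w, N s t w = (I t w - I s w) - (J t w - J s w)}.
Proof.
move=> s0 st tT.
have tT' : 0 <= t <= T by rewrite (le_trans s0 st).
have sT' : 0 <= s <= T by rewrite s0 (le_trans st).
apply: filterS2 (eqx tT') (eqx sT') => w et es.
rewrite /N -(tint_sub s0 st tT c (@cx w)) et es; ring.
Qed.

Section one_interval.
Variables (s t A A' : R).
Hypotheses (s0 : 0 <= s) (st : s <= t) (tT : t <= T).
Hypothesis HA : (\int[P]_w \int[leb]_(r in `]s, t]) (H r w ^+ 2)%:E <= A%:E)%E.
Hypothesis GA : (\int[P]_w \int[leb]_(r in `]s, t]) (G r w ^+ 2)%:E <= A'%:E)%E.

Lemma increment_N : sqint P (N s t) /\ Ex P (fun w => N s t w ^+ 2) <= A + A'.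
Proof.
have sT' : 0 <= s <= T by rewrite s0 (le_trans st).
have := ito_increment filtF bmW indW pq iH iG mH mG s0 st tT
  (mfor_cst (F_sigma filtF sT') 0) (sqint_cst P 0) (N_meas s0 st tT) (N_eq s0 st tT) HA GA.
under [X in sqint _ X /\ _]eq_fun do rewrite add0r.
under [X in _ /\ Ex _ X <= _]eq_fun do rewrite add0r.
under [X in _ /\ _ <= Ex _ X + _]eq_fun do rewrite expr0n /=.
by rewrite Ex_cst add0r.
Qed.

Lemma increment_xN : sqint P (x s) ->
  sqint P (fun w => x t w + c * tint s t (fun r => x r w)) /\
  Ex P (fun w => (x t w + c * tint s t (fun r => x r w)) ^+ 2) <=
    Ex P (fun w => x s w ^+ 2) + (A + A').
Proof.
have sT' : 0 <= s <= T by rewrite s0 (le_trans st).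
move=> sx; have := ito_increment filtF bmW indW pq iH iG mH mG s0 st tT
  (ax sT') sx (N_meas s0 st tT) (N_eq s0 st tT) HA GA.
have E : (fun w => x s w + N s t w) = (fun w => x t w + c * tint s t (fun r => x r w)).
  by apply/funext => w; rewrite /N; ring.
rewrite E; suff -> : (fun w => (x s w + N s t w) ^+ 2) =
  (fun w => (x t w + c * tint s t (fun r => x r w)) ^+ 2) by [].
by apply/funext => w; have /(congr1 (fun f => f w)) /= -> := E.
Qed.

End one_interval.

Lemma Ex_sqr_sum2 (Y Z : Omega -> R) : sqint P Y -> sqint P Z ->
  Ex P (fun w => (Y w + Z w) ^+ 2) <=
  2 * Ex P (fun w => Y w ^+ 2) + 2 * Ex P (fun w => Z w ^+ 2).
Proof.
move=> sY sZ; rewrite -!ExZ; [|exact: sZ.2|exact: sY.2].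
rewrite -ExD; [|apply: int1Z; exact: sY.2|apply: int1Z; exact: sZ.2].
apply: Ex_le; [exact: (sqintD sY sZ).2| |].
  by apply: int1D; apply: int1Z; [exact: sY.2|exact: sZ.2].
by move=> w; have := sqr_ge0 (Y w - Z w); nra.
Qed.

(** The data only bound integrals over time; the value at a fixed time is
    recovered from the initial value, the martingale part and the drift. *)
Lemma component_bounded (A A' B : R) : sqint P (x 0) ->
  (\int[P]_w \int[leb]_(r in `]0%R, T]) (H r w ^+ 2)%:E <= A%:E)%E ->
  (\int[P]_w \int[leb]_(r in `]0%R, T]) (G r w ^+ 2)%:E <= A'%:E)%E ->
  (\int[P]_w \int[leb]_(r in `]0%R, T]) (x r w ^+ 2)%:E <= B%:E)%E ->
  exists M, forall t, 0 <= t <= T -> sqint P (x t) /\ Ex P (fun w => x t w ^+ 2) <= M.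
Proof.
move=> sx0 HA GA' xB.
have mono (K : R -> Omega -> R) a t : t <= T ->
    measurable_fun (@time_sample R d Omega T) (fun z => K z.1 z.2) ->
    (\int[P]_w \int[leb]_(r in `]0%R, T]) (K r w ^+ 2)%:E <= a%:E)%E ->
    (\int[P]_w \int[leb]_(r in `]0%R, t]) (K r w ^+ 2)%:E <= a%:E)%E.
  move=> tT mK; apply: le_trans.
  have mst u : u <= T -> measurable_fun (`]0, u]%classic `*` [set: Omega])
      (fun z : R * Omega => (K z.1 z.2 ^+ 2)%:E).
    by move=> uT; apply/measurable_EFinP; apply: measurable_funX; exact: strip_sub mK.
  apply: ge0_le_integral => //.
  - by move=> w _; apply: integral_ge0 => r _; rewrite lee_fin sqr_ge0.
  - by apply: strip_meas (mst _ tT) _ => // z; rewrite lee_fin sqr_ge0.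
  - by apply: strip_meas (mst _ (lexx _)) _ => // z; rewrite lee_fin sqr_ge0.
  - move=> w _; apply: ge0_subset_integral => //.
    + exact: (@section_meas _ _ _ _ _ _ (fun z => (K z.1 z.2 ^+ 2)%:E) w _ (mst _ (lexx _))).
    + by move=> r _; rewrite lee_fin sqr_ge0.
    + by move=> r /=; rewrite !in_itv /= => /andP[-> rt]; rewrite (le_trans rt).
pose v0 := Ex P (fun w => x 0 w ^+ 2).
exists (2 * (2 * v0 + 2 * (A + A')) + 2 * (c ^+ 2 * (T * B))) => t tT'.
have /andP[t0 tT] := tT'.
have [sN EN] := increment_N (lexx 0) t0 tT (mono _ _ _ tT mH HA) (mono _ _ _ tT mG GA').
have [sD ED] := sqint_tint (lexx 0) t0 tT mx cx (mono _ _ _ tT mx xB).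
have B0 : 0 <= B.
  rewrite -lee_fin; apply: le_trans xB; apply: integral_ge0 => w _.
  by apply: integral_ge0 => r _; rewrite lee_fin sqr_ge0.
have E : x t = (fun w => (x 0 w + N 0 t w) + (- c) * tint 0 t (fun r => x r w)).
  by apply/funext => w; rewrite /N; ring.
have s1 := sqintD sx0 sN; have s2 := sqintZ (- c) sD.
rewrite E; split; first exact: sqintD.
apply: le_trans (Ex_sqr_sum2 s1 s2) _; apply: lerD; rewrite ler_wpM2l//.
  apply: le_trans (Ex_sqr_sum2 sx0 sN) _; rewrite lerD2l ler_wpM2l//.
under [X in Ex _ X]eq_fun do rewrite exprMn sqrrN.
rewrite ExZ ?ler_wpM2l ?sqr_ge0//; last exact: sD.2.
by apply: le_trans ED _; rewrite subr0 ler_wpM2r.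
Qed.

Section moments.
Hypothesis sx : forall t, 0 <= t <= T -> sqint P (x t).
Let v t := Ex P (fun w => x t w ^+ 2).

Lemma component_lipschitz (BH BG Bx : R) :
  (forall r, 0 <= r <= T -> sqint P (H r) /\ Ex P (fun w => H r w ^+ 2) <= BH) ->
  (forall r, 0 <= r <= T -> sqint P (G r) /\ Ex P (fun w => G r w ^+ 2) <= BG) ->
  (forall r, 0 <= r <= T -> v r <= Bx) ->
  exists2 C, 0 <= C & forall s t, 0 <= s -> s <= t -> t <= T ->
    Ex P (fun w => (x t w - x s w) ^+ 2) <= C * (t - s).
Proof.
move=> bH bG bx.
exists (2 * (`|BH| + `|BG|) + 2 * (c ^+ 2 * (`|T| * `|Bx|))).
  by rewrite addr_ge0// ?mulr_ge0 ?addr_ge0 ?sqr_ge0// mulr_ge0.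
move=> s t s0 st tT.
have inT r : s < r <= t -> 0 <= r <= T.
  by move=> /andP[sr rt]; rewrite (le_trans s0 (ltW sr)) (le_trans rt).
have HA := strip_le s0 st tT mH (fun r h => bH r (inT r h)).
have GA := strip_le s0 st tT mG (fun r h => bG r (inT r h)).
have xA := strip_le s0 st tT mx (fun r h => conj (sx (inT r h)) (bx r (inT r h))).
have [sN EN] := increment_N s0 st tT HA GA.
have [sD ED] := sqint_tint s0 st tT mx cx xA.
have E : (fun w => (x t w - x s w) ^+ 2) = (fun w => (N s t w + (- c) * tint s t (fun r => x r w)) ^+ 2).
  by apply/funext => w; rewrite /N; congr (_ ^+ 2); ring.
rewrite E; apply: le_trans (Ex_sqr_sum2 sN (sqintZ (- c) sD)) _.
have ts : 0 <= t - s by rewrite subr_ge0.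
rewrite [leRHS]mulrDl; apply: lerD.
  by rewrite -mulrA ler_wpM2l// (le_trans EN)// -mulrDl ler_wpM2r// lerD// ler_norm.
rewrite -mulrA ler_wpM2l//.
under [X in Ex _ X]eq_fun do rewrite exprMn sqrrN.
rewrite ExZ; last exact: sD.2.
rewrite -!mulrA; do 2 rewrite ler_wpM2l//.
apply: (le_trans ED).
apply: (@le_trans _ _ ((t - s) * (`|Bx| * (t - s)))).
  by rewrite ler_wpM2l// ler_wpM2r// ler_norm.
rewrite ler_wpM2r ?mulr_ge0// (le_trans _ (ler_norm T))//; lra.
Qed.

(** From [X_t + c D = X_s + N], [D] the time integral of [X], one has
    [E X_t^2 + 2 c E (X_t D) <= E X_s^2 + E N^2], the term [c^2 D^2] being
    nonnegative. Polarisation turns the cross term into the damping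
    [c (t - s) (E X_t^2 + b)] up to the error [eta] of the time modulus. *)
Lemma component_energy s t (A A' b eta Bx : R) : 0 <= s -> s <= t -> t <= T ->
  (forall r, s < r <= t -> sqint P (H r) /\ Ex P (fun w => H r w ^+ 2) <= A) ->
  (forall r, s < r <= t -> sqint P (G r) /\ Ex P (fun w => G r w ^+ 2) <= A') ->
  0 <= b -> (forall r, s < r <= t -> b <= v r <= Bx) ->
  (forall r, s < r <= t -> Ex P (fun w => (x t w - x r w) ^+ 2) <= eta) ->
  v t - v s <= (t - s) * (A + A' - c * (v t + b - eta)).
Proof.
move=> s0 st tT bH bG b0 bx bxx.
have inT r : s < r <= t -> 0 <= r <= T.
  by move=> /andP[sr rt]; rewrite (le_trans s0 (ltW sr)) (le_trans rt).
have tT' : 0 <= t <= T by rewrite (le_trans s0 st).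
have sT' : 0 <= s <= T by rewrite s0 (le_trans st).
have HA := strip_le s0 st tT mH bH.
have GA := strip_le s0 st tT mG bG.
have [sq E] := increment_xN s0 st tT HA GA (sx sT').
have bx1 r : s < r <= t -> b <= v r by move=> /bx/andP[].
have bx2 r : s < r <= t -> v r <= Bx by move=> /bx/andP[].
have lo := strip_ge s0 st tT mx cx b0 (fun r h => conj (sx (inT r h)) (bx1 r h)).
have xA := strip_le s0 st tT mx (fun r h => conj (sx (inT r h)) (bx2 r h)).
pose dx r w := x t w - x r w.
have mdx : measurable_fun (@time_sample R d Omega T) (fun z => dx z.1 z.2).
  apply: measurable_funB => //.
  apply: (measurable_comp measurableT _ (xmeas tT')) => //.
  exact: measurable_funTS measurable_snd.
have cdx : continuous_paths T dx.
  by move=> w; apply: contTB; [exact: contT_cst|exact: cx].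
have sdx r : s < r <= t -> sqint P (dx r) by move=> h; apply: sqintB; [exact: sx|exact/sx/inT].
have up := strip_le s0 st tT mdx (fun r h => conj (sdx r h) (bxx r h)).
have i2 := int1_tint_sqr s0 tT mx cx (le_lt_trans xA (ltry _)).
have i3 := int1_tint_sqr s0 tT mdx cdx (le_lt_trans up (ltry _)).
set S2 := (fun w => tint s t (fun r => x r w ^+ 2)) in i2.
set S3 := (fun w => tint s t (fun r => dx r w ^+ 2)) in i3.
have ES2 : b * (t - s) <= Ex P S2 by rewrite -lee_fin -Ex_EFin.
have ES3 : Ex P S3 <= eta * (t - s).
  rewrite -lee_fin -Ex_EFin//; apply: le_trans up.
  by rewrite (strip_tint P s0 tT mdx cdx).
have ix := (sx tT').2.
have pw w : x t w ^+ 2 + c * ((t - s) * x t w ^+ 2 + S2 w - S3 w) <=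
    (x t w + c * tint s t (fun r => x r w)) ^+ 2.
  rewrite /S2 /S3 -(tint_polar s0 st tT (x t w) (@cx w)).
  rewrite -subr_ge0 (_ : _ - _ = (c * tint s t (x^~ w)) ^+ 2) ?sqr_ge0//; ring.
have i1 : int1 P (fun w => (t - s) * x t w ^+ 2 + S2 w - S3 w).
  by apply: int1B => //; apply: int1D => //; exact: int1Z.
have := le_trans (Ex_le (int1D ix (int1Z c i1)) sq.2 pw) E.
rewrite ExD; [|exact: ix|exact: int1Z].
rewrite ExZ// ExB//; last by apply: int1D => //; exact: int1Z.
rewrite ExD//; last exact: int1Z.
rewrite ExZ// -/(v t) -/(v s) => fin.
have h1 := ler_wpM2l c0 ES2; have h2 := ler_wpM2l c0 ES3.
move: fin h1 h2; set a1 := Ex P S2; set a2 := Ex P S3 => fin h1 h2.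
lra.
Qed.

End moments.
End component.

(** * Differential inequalities and the Huber function *)
Section telescoping.
Context {R : realType}.

Lemma sum_by_parts (b D : nat -> R) M :
  \sum_(n < M) b n * (D n - D n.+1) =
  b 0%N * D 0%N - b M * D M - \sum_(n < M) (b n - b n.+1) * D n.+1.
Proof.
elim: M => [|M IH]; first by rewrite !big_ord0; ring.
by rewrite !big_ord_recr /= IH; ring.
Qed.

(** A uniform one-sided form of [f' <= 0] suffices for monotonicity: add the
    increments over a fine equidistant partition. *)
Lemma local_nonincreasing (f : R -> R) (a b : R) : a <= b ->
  (forall e, 0 < e -> exists2 dl, 0 < dl & forall s t, a <= s -> s <= t -> t <= b ->
     t - s < dl -> f t - f s <= e * (t - s)) -> f b <= f a.
Proof.
move=> ab H; apply/ler_addgt0Pr => e e0.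
have ba : 0 <= b - a by rewrite subr_ge0.
pose e' := e / (b - a + 1).
have e'0 : 0 < e' by rewrite divr_gt0// ltr_wpDl.
have [dl dl0 Hd] := H e' e'0.
pose N := (Num.truncn ((b - a) / dl)).+1.
have N0 : (0 : R) < N%:R by rewrite ltr0n.
pose h := (b - a) / N%:R.
have h0 : 0 <= h by rewrite divr_ge0// ltW.
have hd : h < dl.
  rewrite /h ltr_pdivrMr// mulrC -ltr_pdivrMr//; exact: truncnS_gt.
have key i : (i <= N)%N -> f (a + i%:R * h) - f a <= e' * (i%:R * h).
  elim: i => [_|i IH iN]; first by rewrite !mul0r addr0 subrr mulr0.
  have tb : a + i.+1%:R * h <= b.
    have : i.+1%:R * h <= N%:R * h by rewrite ler_wpM2r// ler_nat.
    have -> : N%:R * h = b - a by rewrite /h mulrC divfK// gt_eqF.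
    lra.
  have := Hd (a + i%:R * h) (a + i.+1%:R * h).
  rewrite lerDl mulr_ge0// lerD2l ler_wpM2r ?ler_nat// => /(_ isT isT tb).
  have -> : a + i.+1%:R * h - (a + i%:R * h) = h by rewrite -natr1; ring.
  move=> /(_ hd) step; have IH' := IH (ltnW iN).
  have E : i.+1%:R * h = i%:R * h + h by rewrite -natr1; ring.
  rewrite [in leRHS]E mulrDr; lra.
have := key N (leqnn N).
have -> : N%:R * h = b - a by rewrite /h mulrC divfK// gt_eqF.
have -> : a + (b - a) = b by ring.
have : e' * (b - a) <= e.
  by rewrite /e' mulrAC ler_pdivrMr ?ltr_wpDl// ler_wpM2l ?(ltW e0)// lerDl.
lra.
Qed.

(** A convex function that vanishes exactly on nonpositive numbers, has slope in
    [[0, 1]] and is differentiable: a smooth positive part, for which the square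
    is replaced by a line beyond 1 so that it stays below the identity. *)
Definition huber (z : R) : R := if z <= 0 then 0 else if z <= 1 then z ^+ 2 / 2 else z - 2^-1.
Definition huber' (z : R) : R := if z <= 0 then 0 else if z <= 1 then z else 1.

Lemma huber_ge0 z : 0 <= huber z.
Proof. rewrite /huber; case: (leP z 0) => // z0; case: (leP z 1) => z1; nra. Qed.
Lemma huber_le z w : z <= w -> 0 <= w -> huber z <= w.
Proof. rewrite /huber => zw w0; case: (leP z 0) => // z0; case: (leP z 1) => z1; nra. Qed.
Lemma huber_le0 z : huber z <= 0 -> z <= 0.
Proof. by rewrite /huber; case: (leP z 0) => // z0; case: (leP z 1) => z1; nra. Qed.
Lemma huber_np z : z <= 0 -> huber z = 0.
Proof. by rewrite /huber => ->. Qed.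
Lemma huber'_itv z : 0 <= huber' z <= 1.
Proof. rewrite /huber'; case: (leP z 0) => z0; [lra|case: (leP z 1) => z1; lra]. Qed.
Lemma huber_convex z w : huber' z * (w - z) <= huber w - huber z.
Proof.
rewrite /huber'; case: (leP z 0) => z0.
  by rewrite mul0r (huber_np z0) subr0 huber_ge0.
case: (leP z 1) => z1; rewrite /huber [z <= 0]leNgt z0 /=.
  rewrite z1; case: (leP w 0) => w0; first nra.
  case: (leP w 1) => w1; first by have := sqr_ge0 (w - z); nra.
  have := sqr_ge0 (1 - z); have := mulr_ge0 (_ : 0 <= 1 - z) (_ : 0 <= w - 1).
  rewrite !subr_ge0 => /(_ z1 (ltW w1)); nra.
rewrite [z <= 1]leNgt z1 /=; case: (leP w 0) => w0; first lra.
case: (leP w 1) => w1; first by have := sqr_ge0 (w - 1); nra.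
lra.
Qed.

End telescoping.

(** * The birth-death system of second moments *)
Section birth_death.
Context {R : realType}.
Local Notation leb := (@lebesgue_measure R).
Variables (T rho sigma2 : R) (y : nat -> R -> R).
Hypothesis T0 : 0 < T.
Hypothesis rho0 : 0 < rho.
Hypothesis rho1 : rho < 1.
Hypothesis sigma20 : 0 <= sigma2.
Hypothesis y_ge0 : forall n t, 0 <= y n t.
Hypothesis uc : forall n e, 0 < e -> exists2 dl, 0 < dl &
  forall s t, 0 <= s -> s <= t -> t <= T -> t - s < dl -> `|y n t - y n s| <= e.

(** [flux src x n] is the flux that enters site [n] from below; site 0 is fed by
    the source. *)
Definition flux (src : R) (x : nat -> R) n : R :=
  if n is m.+1 then rho ^- n * (x m - x n) else src.

Arguments flux : simpl never.

Hypothesis subsol : forall n e, 0 < e -> exists2 dl, 0 < dl &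
  forall s t, 0 <= s -> s <= t -> t <= T -> t - s < dl ->
  y n t - y n s <= (t - s) * (flux sigma2 (y ^~ t) n - flux sigma2 (y ^~ t) n.+1 + e).

(** The tail [sum_(j >= n) rho^(j+1)]. As a function of [n], the sequence
    [green_weight (maxn n m)] is the Green function with pole [m] of the generator
    of the system with absorption at infinity. *)
Definition green_weight n : R := rho ^+ n.+1 / (1 - rho).

Lemma green_weight_gt0 n : 0 < green_weight n.
Proof. by rewrite divr_gt0 ?exprn_gt0// subr_gt0. Qed.

Lemma green_weight_diff n : green_weight n - green_weight n.+1 = rho ^+ n.+1.
Proof. by rewrite /green_weight [rho ^+ n.+2]exprS; field; rewrite subr_eq0 gt_eqF. Qed.

Lemma green_weight_le m n : (m <= n)%N -> green_weight n <= green_weight m.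
Proof.
move=> mn; rewrite /green_weight ler_wpM2r ?invr_ge0 ?subr_ge0 ?(ltW rho1)//.
by apply: ler_wiXn2l => //; exact: ltW.
Qed.

Lemma contT_y n : contT T (y n).
Proof.
pose pr (t : R) := Num.max 0 (Num.min T t).
have prT t : 0 <= pr t <= T.
  by rewrite /pr le_max lexx /= ge_max (ltW T0) ge_min lexx.
have pr_id t : 0 <= t <= T -> pr t = t.
  by move=> /andP[t0 tT]; rewrite /pr (min_idPr tT) (max_idPr t0).
have pr_lip s t : s <= t -> 0 <= pr t - pr s <= t - s.
  move=> st; rewrite /pr /Num.max /Num.min; case_ifs; lra.
have : continuous (fun t => y n (pr t)).
  move=> t; apply/cvgrPdist_le => e e0; have [dl dl0 Hd] := uc n e0.
  near=> u; have : `|t - u| < dl by near: u; exact: cvgr_dist_lt.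
  have [/andP[pt1 pt2] /andP[pu1 pu2]] := (prT t, prT u).
  have [tu|/ltW ut] := leP t u.
    have /andP[l1 l2] := pr_lip _ _ tu; rewrite distrC (distrC (y n _)) ger0_norm ?subr_ge0// => lt.
    by apply: Hd => //; [rewrite -subr_ge0|exact: le_lt_trans l2 lt].
  have /andP[l1 l2] := pr_lip _ _ ut; rewrite ger0_norm ?subr_ge0// => lt.
  by apply: Hd => //; [rewrite -subr_ge0|exact: le_lt_trans l2 lt].
move=> /(@continuous_subspaceT _ _ `[0, T]).
apply: subspace_eq_continuous => t; rewrite inE /= in_itv /= => tT.
by rewrite /from_subspace /= pr_id.
Unshelve. all: by end_near. Qed.

Definition primitive (f : R -> R) t : R := \int[leb]_(r in `[0, t]) f r.

Lemma primitive_sub f s t : contT T f -> 0 <= s -> s <= t -> t <= T ->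
  primitive f t - primitive f s = tint s t f.
Proof.
move=> cf s0 st tT; rewrite /primitive Rintegral_itvB ?bnd_simp//.
have := integrable_contT cf; apply: integrableS => // r /=; rewrite !in_itv /= => /andP[-> rt].
by rewrite (le_trans rt).
Qed.

Lemma tint_le f g s t : contT T f -> contT T g -> 0 <= s -> t <= T ->
  (forall r, s < r <= t -> f r <= g r) -> tint s t f <= tint s t g.
Proof.
move=> cf cg s0 tT fg; exact: (le_Rintegral _ (integrable_sub s0 tT cf) (integrable_sub s0 tT cg)).
Qed.

Let U n t := primitive (y n) t.

Lemma U_sub n s t : 0 <= s -> s <= t -> t <= T -> U n t - U n s = tint s t (y n).
Proof. by move=> s0 st tT; rewrite /U primitive_sub//; exact: contT_y. Qed.

Lemma U_mono n s t : 0 <= s -> s <= t -> t <= T -> U n s <= U n t.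
Proof. by move=> s0 st tT; rewrite -subr_ge0 U_sub//; apply: tint_ge0. Qed.

Lemma U_ge0 n t : 0 <= U n t.
Proof. by apply: Rintegral_ge0. Qed.

Lemma U_local n e : 0 < e -> exists2 dl, 0 < dl & forall s t, 0 <= s -> s <= t ->
  t <= T -> t - s < dl -> `|U n t - U n s - (t - s) * y n t| <= e * (t - s).
Proof.
move=> e0; have [dl dl0 Hd] := uc n e0; exists dl => // s t s0 st tT std.
have cy : contT T (y n) := @contT_y n.
have H r : s < r <= t -> `|y n t - y n r| <= e.
  move=> /andP[sr rt]; apply: Hd => //; first exact: le_trans s0 (ltW sr).
  by apply: le_lt_trans std; rewrite lerD2l lerN2 ltW.
have lo : (y n t - e) * (t - s) <= tint s t (y n).
  rewrite -(tint_cst st); apply: tint_le => //; first exact: contT_cst.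
  by move=> r /H; rewrite ler_norml => /andP[_]; lra.
have up : tint s t (y n) <= (y n t + e) * (t - s).
  rewrite -(tint_cst st); apply: tint_le => //; first exact: contT_cst.
  by move=> r /H; rewrite ler_norml => /andP[+ _]; lra.
by rewrite U_sub// ler_norml; apply/andP; split; lra.
Qed.

(** A mean value argument for infinitely many sites at once: the weighted sum of
    the [y m] is integrable over time, so it is finite at some time. *)
Lemma pick_time (w : nat -> R) a b C : 0 <= a -> a < b -> b <= T ->
  (forall m, 0 <= w m) ->
  (forall M, \sum_(m < M) w m * (U m b - U m a) <= C) ->
  exists t, a < t <= b /\ exists C', forall M, \sum_(m < M) w m * y m t <= C'.
Proof.
move=> a0 ab bT w0 HC.
pose g r := (\sum_(m <oo) (w m * y m r)%:E)%E.
have g0 m r : (0 <= (w m * y m r)%:E)%E by rewrite lee_fin mulr_ge0.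
have mwy m : measurable_fun `]a, b] (fun r => (w m * y m r)%:E).
  by apply: (measurable_int leb); apply: (integrable_sub a0 bT); apply: contTM; [exact: contT_cst|exact: contT_y].
have Ig : (\int[leb]_(r in `]a, b]) g r <= C%:E)%E.
  rewrite /g integral_nneseries//.
  apply: lime_le; first by apply: is_cvg_nneseries => m _ _; exact: integral_ge0.
  near=> M; rewrite /= big_mkord.
  rewrite (eq_bigr (fun m : 'I_M => (w m * (U m b - U m a))%:E)); first by rewrite sumEFin lee_fin; exact: HC.
  move=> m _; rewrite U_sub ?(ltW ab)//.
  rewrite (tint_EFin a0 bT); last by apply: contTM; [exact: contT_cst|exact: contT_y].
  by rewrite (tintZ a0 bT)//; exact: contT_y.
have [t [tab gt]] : exists t, a < t <= b /\ g t != +oo%E.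
  apply: contrapT => /forallNP H.
  have : (\int[leb]_(r in `]a, b]) g r = +oo)%E.
    rewrite (eq_integral (cst +oo%E)).
      by rewrite integral_cst//= lebesgue_measure_itv /= lte_fin ab -EFinB gt0_mulye// lte_fin subr_gt0.
    move=> r; rewrite inE /= in_itv /= => rab; apply/eqP/negPn/negP => gr.
    by apply: (H r).
  by move=> E; move: Ig; rewrite E leye_eq.
exists t; split => //; exists (fine (g t)) => M.
have gfin : g t \is a fin_num.
  by rewrite ge0_fin_numE ?ltey//; apply: nneseries_ge0.
rewrite -lee_fin fineK// -sumEFin -(big_mkord xpredT (fun m => (w m * y m t)%:E)).
exact: nneseries_lim_ge.
Unshelve. all: by end_near. Qed.

Lemma subsol_unif M e : 0 < e -> exists2 dl, 0 < dl & forall n, (n < M)%N ->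
  forall s t, 0 <= s -> s <= t -> t <= T -> t - s < dl ->
  y n t - y n s <= (t - s) * (flux sigma2 (y ^~ t) n - flux sigma2 (y ^~ t) n.+1 + e).
Proof.
move=> e0; elim: M => [|M [d1 d10 H1]]; first by exists 1.
have [d2 d20 H2] := subsol M e0.
exists (Num.min d1 d2); first by rewrite lt_min d10.
move=> n; rewrite ltnS leq_eqVlt => nM s t s0 st tT; rewrite lt_min => /andP[l1 l2].
by move: nM => /orP[/eqP->|nM]; [exact: H2|exact: H1].
Qed.

(** Subtracting the value at [N.+1] makes the weight vanish beyond [N], so the
    partial sum has no flux boundary term; the only trace of the truncation is the
    value [x N.+1]. *)
Lemma sum_flux (src : R) (x : nat -> R) m N : (m <= N)%N ->
  \sum_(n < N.+1) (green_weight (maxn n m) - green_weight N.+1) * (flux src x n - flux src x n.+1) =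
  (green_weight m - green_weight N.+1) * src - (x m - x N.+1).
Proof.
move=> mN; rewrite (sum_by_parts (fun n => green_weight (maxn n m) - green_weight N.+1)).
rewrite max0n (maxn_idPl (leqW mN)) subrr mul0r subr0 /flux; congr (_ - _).
suff H M : (m <= M)%N -> \sum_(n < M) (green_weight (maxn n m) - green_weight N.+1 - (green_weight (maxn n.+1 m) - green_weight N.+1)) *
   (rho ^- n.+1 * (x n - x n.+1)) = x m - x M by apply: H; exact: leqW.
have d n : green_weight (maxn n m) - green_weight N.+1 - (green_weight (maxn n.+1 m) - green_weight N.+1) =
    if (m <= n)%N then rho ^+ n.+1 else 0.
  have [mn|] := boolP (m <= n)%N.
    by rewrite (maxn_idPl mn) (maxn_idPl (leqW mn)) -green_weight_diff; ring.
  by rewrite -ltnNge => nm; rewrite (maxn_idPr (ltnW nm)) (maxn_idPr nm) subrr.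
elim: M => [|M IH]; first by rewrite leqn0 => /eqP ->; rewrite big_ord0 subrr.
rewrite leq_eqVlt ltnS => /orP[/eqP mE|mM].
  by rewrite -mE big1 ?subrr// => -[n nM] _ /=; rewrite d leqNgt nM mul0r.
rewrite big_ord_recr /= IH// d mM mulrA divff ?expf_neq0 ?gt_eqF//; ring.
Qed.

(** The functional [Phi] below is nonincreasing by [sum_flux]. *)
Lemma green m N t0 t1 : (m <= N)%N -> 0 <= t0 -> t0 <= t1 -> t1 <= T ->
  U m t1 - U m t0 <= \sum_(n < N.+1) green_weight (maxn n m) * y n t0 +
    (U N.+1 t1 - U N.+1 t0) + sigma2 * green_weight m * (t1 - t0).
Proof.
move=> mN t00 t01 t1T.
pose b n := green_weight (maxn n m) - green_weight N.+1.
have b0 (n : 'I_N.+1) : 0 <= b n.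
  by rewrite subr_ge0 green_weight_le// geq_max ltnW// leqW.
pose Phi t := \sum_(n < N.+1) b n * y n t + U m t - U N.+1 t - sigma2 * green_weight m * t.
have dec : Phi t1 <= Phi t0.
  apply: local_nonincreasing => // e e0.
  pose B := \sum_(n < N.+1) b n.
  have B0 : 0 <= B by exact: sumr_ge0.
  have B2 : 0 < B + 2 by rewrite ltr_wpDl.
  pose e' := e / (B + 2).
  have e'0 : 0 < e' by rewrite divr_gt0.
  have [d1 d10 H1] := subsol_unif N.+1 e'0.
  have [d2 d20 H2] := U_local m e'0.
  have [d3 d30 H3] := U_local N.+1 e'0.
  exists (Num.min d1 (Num.min d2 d3)); first by rewrite !lt_min d10 d20.
  move=> s t t0s st tt1; rewrite !lt_min => /and3P[l1 l2 l3].
  have s0 : 0 <= s := le_trans t00 t0s.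
  have tT : t <= T := le_trans tt1 t1T.
  have ts : 0 <= t - s by rewrite subr_ge0.
  have h2 := H2 s t s0 st tT l2; have h3 := H3 s t s0 st tT l3.
  have h1 : \sum_(n < N.+1) b n * y n t - \sum_(n < N.+1) b n * y n s <=
      (t - s) * ((green_weight m - green_weight N.+1) * sigma2 - (y m t - y N.+1 t) + e' * B).
    rewrite -sumrB -(sum_flux sigma2 (y ^~ t) mN) /B mulr_sumr -big_split mulr_sumr /=.
    apply: ler_sum => n _; rewrite -mulrBr.
    have := ler_wpM2l (b0 n) (H1 n (ltn_ord n) s t s0 st tT l1); rewrite /b; lra.
  have h4 : 0 <= (t - s) * (green_weight N.+1 * sigma2) by do 2 (apply: mulr_ge0 => //); exact/ltW/green_weight_gt0.
  have -> : e = e' * (B + 2) by rewrite /e' divfK// gt_eqF.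
  move: h2 h3; rewrite !ler_norml => /andP[_ h2] /andP[h3 _].
  rewrite /Phi; set S1 := \sum_(n < _) _ in h1 *; set S2 := \sum_(n < _) _ in h1 *.
  lra.
have P1 : 0 <= \sum_(n < N.+1) b n * y n t1 by apply: sumr_ge0 => n _; exact: mulr_ge0.
have P0 : \sum_(n < N.+1) b n * y n t0 <= \sum_(n < N.+1) green_weight (maxn n m) * y n t0.
  by apply: ler_sum => n _; rewrite ler_wpM2r// lerBlDr lerDl ltW// green_weight_gt0.
by move: dec; rewrite /Phi; lra.
Qed.

Hypothesis dirichlet : forall e, 0 < e -> exists n0, forall n, (n0 <= n)%N -> U n T <= e.

Lemma green_limit m t0 t1 S : 0 <= t0 -> t0 <= t1 -> t1 <= T ->
  (forall N, \sum_(n < N) green_weight (maxn n m) * y n t0 <= S) ->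
  U m t1 - U m t0 <= S + sigma2 * green_weight m * (t1 - t0).
Proof.
move=> t00 t01 t1T HS; apply/ler_addgt0Pr => e e0.
have [n0 Hn0] := dirichlet e0.
pose N := maxn n0 m; have mN : (m <= N)%N by rewrite leq_maxr.
have := green mN t00 t01 t1T; have := HS N.+1.
have := Hn0 N.+1 (leqW (leq_maxl _ _)).
have := U_mono N.+1 (le_trans t00 t01) t1T (lexx T); have := U_ge0 N.+1 t0.
by lra.
Qed.

(** Kato's argument: [huber (y - b)] is again a subsolution, without source. Its
    sum against the Green function with pole 0, truncated at [N], starts from 0 and
    grows at most by the time integral of [y N.+1], which the Dirichlet condition
    makes small. *)
Lemma comparison (b : nat -> R) t1 : (forall n, 0 <= b n) ->
  (forall n, flux sigma2 b n <= flux sigma2 b n.+1) ->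
  0 <= t1 -> t1 <= T -> (forall n, y n t1 <= b n) ->
  forall n t, t1 <= t -> t <= T -> y n t <= b n.
Proof.
move=> b0 bsup t10 t1T yb n t t1t tT.
pose z k u := y k u - b k.
pose h k u := huber (z k u).
suff h0 : h n t <= 0 by rewrite -subr_le0; exact: huber_le0.
suff : rho ^+ n.+1 * h n t <= 0 by rewrite pmulr_rle0// exprn_gt0.
apply/ler_addgt0Pr => eps eps0; rewrite add0r.
have [n0 Hn0] := dirichlet eps0.
pose N := maxn n0 n; have nN : (n <= N)%N by rewrite leq_maxr.
have UN : U N.+1 T <= eps by apply: Hn0; rewrite leqW// leq_maxl.
pose c k := green_weight (maxn k 0) - green_weight N.+1.
have c0 (k : 'I_N.+1) : 0 <= c k by rewrite subr_ge0 green_weight_le// maxn0 ltnW.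
pose Phi u := \sum_(k < N.+1) c k * h k u - U N.+1 u.
have dec : Phi t <= Phi t1.
  apply: local_nonincreasing => // e e0.
  pose B := \sum_(k < N.+1) c k.
  have B0 : 0 <= B by exact: sumr_ge0.
  have B2 : 0 < B + 1 by rewrite ltr_wpDl.
  pose e' := e / (B + 1).
  have e'0 : 0 < e' by rewrite divr_gt0.
  have [d1 d10 H1] := subsol_unif N.+1 e'0.
  have [d3 d30 H3] := U_local N.+1 e'0.
  exists (Num.min d1 d3); first by rewrite !lt_min d10.
  move=> s u t1s su ut; rewrite !lt_min => /andP[l1 l3].
  have s0 : 0 <= s := le_trans t10 t1s.
  have uT : u <= T := le_trans ut tT.
  have us : 0 <= u - s by rewrite subr_ge0.
  have h3 := H3 s u s0 su uT l3.
  have kato k : huber' (z k u) * (flux sigma2 (y ^~ u) k - flux sigma2 (y ^~ u) k.+1) <=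
      flux 0 (h ^~ u) k - flux 0 (h ^~ u) k.+1.
    have /andP[p0 _] := huber'_itv (z k u).
    have cv k' := huber_convex (z k u) (z k' u).
    have le : flux sigma2 (y ^~ u) k - flux sigma2 (y ^~ u) k.+1 <=
        flux 0 (z ^~ u) k - flux 0 (z ^~ u) k.+1.
      by have := bsup k; case: k {p0 cv} => [|k]; rewrite /flux /z; lra.
    apply: le_trans (ler_wpM2l p0 le) _; rewrite mulrBr; apply: lerB.
      case: k p0 cv le => [|k] p0 cv _; rewrite /flux ?mulr0//.
      by rewrite mulrCA ler_wpM2l ?invr_ge0 ?exprn_ge0 ?(ltW rho0)//; exact: cv.
    rewrite /flux mulrCA ler_wpM2l ?invr_ge0 ?exprn_ge0 ?(ltW rho0)//.
    by have := cv k.+1; rewrite /h; lra.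
  have hs : \sum_(k < N.+1) c k * h k u - \sum_(k < N.+1) c k * h k s <=
      (u - s) * ((green_weight 0 - green_weight N.+1) * 0 - (h 0%N u - h N.+1 u) + e' * B).
    rewrite -sumrB -(sum_flux 0 (h ^~ u) (leq0n N)) /B mulr_sumr -big_split mulr_sumr /=.
    apply: ler_sum => k _; rewrite -mulrBr.
    have /andP[p0 p1] := huber'_itv (z k u).
    have cv : h k u - h k s <= huber' (z k u) * (y k u - y k s).
      by have := huber_convex (z k u) (z k s); rewrite /h /z; lra.
    have st := ler_wpM2l p0 (H1 k (ltn_ord k) s u s0 su uT l1).
    have st2 := ler_wpM2l us (kato k).
    have st3 : huber' (z k u) * ((u - s) * e') <= (u - s) * e'.
      by rewrite ler_piMl// mulr_ge0// ltW.
    have := ler_wpM2l (c0 k) (_ : h k u - h k s <= (u - s) * (flux 0 (h ^~ u) k - flux 0 (h ^~ u) k.+1 + e')).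
    by rewrite -/(c k) => /(_ _) H; apply: le_trans (H _) _; lra.
  have hN : h N.+1 u <= y N.+1 u by apply: huber_le => //; rewrite /z lerBlDr lerDl.
  have hN' := ler_wpM2l us hN.
  have hp : 0 <= (u - s) * h 0%N u by rewrite mulr_ge0// huber_ge0.
  have -> : e = e' * (B + 1) by rewrite /e' divfK// gt_eqF.
  move: h3; rewrite !ler_norml => /andP[h3 _].
  rewrite /Phi; set S1 := \sum_(k < _) _ in hs *; set S2 := \sum_(k < _) _ in hs *.
  lra.
have z1 : \sum_(k < N.+1) c k * h k t1 = 0.
  by apply: big1 => k _; rewrite /h huber_np ?mulr0// subr_le0.
have mU := U_mono N.+1 (le_trans t10 t1t) tT (lexx T).
have pU := U_ge0 N.+1 t1.
have sing : c n * h n t <= \sum_(k < N.+1) c k * h k t.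
  rewrite (bigD1 (Ordinal (nN : (n < N.+1)%N))) //= lerDl; apply: sumr_ge0 => k _.
  by rewrite mulr_ge0// huber_ge0.
have damping : rho ^+ n.+1 * h n t <= c n * h n t.
  by rewrite ler_wpM2r ?huber_ge0// -green_weight_diff /c maxn0 lerD2l lerN2 green_weight_le.
by move: dec; rewrite /Phi z1; lra.
Qed.

(** Between sites, the flux of a geometric sequence of ratio [r] grows by the
    factor [r / rho], which is at least 1; at site 0 the constant must beat the
    source. *)
Lemma geometric_super C r : rho <= r -> r <= 1 -> 0 <= C ->
  sigma2 * rho <= C * (1 - r) ->
  forall n, flux sigma2 (fun n => C * r ^+ n) n <= flux sigma2 (fun n => C * r ^+ n) n.+1.
Proof.
move=> rr r1 C0 HC [|n]; rewrite /flux.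
  rewrite /= (_ : C * r ^+ 0 - C * r ^+ 1 = C * (1 - r)); last by rewrite expr0 expr1; ring.
  by rewrite expr1 ler_pdivlMl// mulrC.
have r0 : 0 <= r := le_trans (ltW rho0) rr.
have -> : rho ^- n.+1 * (C * r ^+ n - C * r ^+ n.+1) =
   (rho ^- n.+1 * (C * r ^+ n * (1 - r))) * 1 by rewrite [r ^+ n.+1]exprS; ring.
have -> : rho ^- n.+2 * (C * r ^+ n.+1 - C * r ^+ n.+2) =
   (rho ^- n.+1 * (C * r ^+ n * (1 - r))) * (r / rho).
  rewrite [r ^+ n.+2]exprS [r ^+ n.+1]exprS [rho ^+ n.+2]exprS; field.
  by rewrite expf_neq0 ?gt_eqF.
rewrite ler_wpM2l ?mulr_ge0 ?exprn_ge0 ?invr_ge0 ?exprn_ge0 ?subr_ge0 ?(ltW rho0)//.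
by rewrite ler_pdivlMr// mul1r.
Qed.

Lemma geometric_sum_le (q : R) M : 0 <= q -> q < 1 -> \sum_(m < M) q ^+ m <= (1 - q)^-1.
Proof.
move=> q0 q1; have d0 : 0 < 1 - q by rewrite subr_gt0.
rewrite -[leRHS]mul1r ler_pdivlMr//.
have -> : (\sum_(m < M) q ^+ m) * (1 - q) = 1 - q ^+ M.
  elim: M => [|M IH]; first by rewrite big_ord0 expr0 mul0r subrr.
  by rewrite big_ord_recr /= mulrDl IH exprS; ring.
by rewrite lerBlDr lerDl exprn_ge0.
Qed.

(** Half of the time [tau] is spent on each of the two improvements of the bound;
    the weights lose a factor [q] each time a common time is selected. *)
Lemma decay (S0 q tau : R) : (forall M, \sum_(n < M) green_weight n * y n 0 <= S0) ->
  0 < q -> q < 1 -> rho < q ^+ 2 -> 0 < tau -> tau <= T ->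
  exists C, forall n t, tau <= t -> t <= T -> y n t <= C * (rho / q ^+ 2) ^+ n.
Proof.
move=> HS q0 q1 rq tau0 tauT.
have q20 : 0 < q ^+ 2 by rewrite exprn_gt0.
have rho_q : rho < q by rewrite (lt_le_trans rq)// expr2 ler_piMr ?ltW.
have t20 : 0 < tau / 2 by rewrite divr_gt0.
have t2T : tau / 2 <= T by lra.
have t2t : tau / 2 < tau by lra.
have S00 : 0 <= S0 by apply: le_trans (HS 0%N); rewrite big_ord0.
have a00 := green_weight_gt0 0.
pose C1 := S0 + sigma2 * green_weight 0 * T.
have C10 : 0 <= C1 by rewrite addr_ge0// mulr_ge0 ?(ltW T0)// mulr_ge0// ltW.
have step1 m : U m (tau / 2) - U m 0 <= C1.
  apply: (le_trans (@green_limit m 0 (tau / 2) S0 (lexx _) (ltW t20) t2T _)).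
    move=> N; apply: le_trans (HS N); apply: ler_sum => n _.
    by rewrite ler_wpM2r// green_weight_le// leq_maxl.
  rewrite /C1 lerD2l subr0; apply: ler_pM => //.
  - by rewrite mulr_ge0// ltW// green_weight_gt0.
  - exact: ltW.
  - by rewrite ler_wpM2l// green_weight_le.
have qm m : 0 <= q ^+ m by rewrite exprn_ge0// ltW.
have [t0 [/andP[t0a t0b] [C2 HC2]]] : exists t, 0 < t <= tau / 2 /\
    exists C', forall M, \sum_(m < M) q ^+ m * y m t <= C'.
  apply: (@pick_time _ _ _ (C1 / (1 - q))) => // M.
  apply: (@le_trans _ _ (\sum_(m < M) q ^+ m * C1)).
    by apply: ler_sum => m _; rewrite ler_wpM2l.
  by rewrite -mulr_suml mulrC ler_wpM2l// geometric_sum_le// ltW.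
have C20 : 0 <= C2 by apply: le_trans (HC2 0%N); rewrite big_ord0.
have x0 : 0 <= rho / q by rewrite divr_ge0// ltW.
have x1 : rho / q <= 1 by rewrite ler_pdivrMr// mul1r ltW.
have awE n : green_weight n = green_weight 0 * rho ^+ n by rewrite /green_weight exprS expr1; ring.
pose C3 := green_weight 0 * (C2 + sigma2 * T).
have C30 : 0 <= C3 by rewrite mulr_ge0 ?(ltW a00)// addr_ge0// mulr_ge0// ltW.
have step2 m : U m tau - U m (tau / 2) <= C3 * (rho / q) ^+ m.
  have le1 : U m tau - U m (tau / 2) <= U m tau - U m t0.
    by rewrite lerD2l lerN2 U_mono// ltW.
  apply: (le_trans le1).
  apply: (le_trans (@green_limit m t0 tau (green_weight 0 * (rho / q) ^+ m * C2) (ltW t0a) _ tauT _)).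
  - by rewrite (le_trans t0b)// ltW.
  - move=> N; apply: (@le_trans _ _ (\sum_(n < N) green_weight 0 * (rho / q) ^+ m * (q ^+ n * y n t0))).
      apply: ler_sum => n _; rewrite mulrA ler_wpM2r// awE -mulrA ler_wpM2l ?(ltW a00)//.
      apply: (@le_trans _ _ ((rho / q) ^+ (maxn n m) * q ^+ (maxn n m))).
        by rewrite -exprMn divfK ?gt_eqF.
      apply: ler_pM; rewrite ?exprn_ge0 ?(ltW q0)//.
        by apply: ler_wiXn2l => //; exact: leq_maxr.
      by apply: ler_wiXn2l; [exact: ltW|exact: ltW|exact: leq_maxl].
    by rewrite -mulr_sumr ler_wpM2l ?HC2// mulr_ge0 ?exprn_ge0 ?(ltW a00).
  - have -> : C3 * (rho / q) ^+ m = green_weight 0 * (rho / q) ^+ m * C2 +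
        sigma2 * (green_weight 0 * (rho / q) ^+ m) * T by rewrite /C3; ring.
    rewrite lerD2l; apply: ler_pM.
    + by rewrite mulr_ge0// ltW// green_weight_gt0.
    + by lra.
    + rewrite ler_wpM2l// awE ler_wpM2l ?(ltW a00)//.
      apply: lerXn2r; rewrite ?nnegrE ?(ltW rho0)//.
      by rewrite ler_pdivlMr// ler_piMr ?ltW.
    + by lra.
pose w m := (q ^+ 2 / rho) ^+ m.
have w0 m : 0 < w m by rewrite exprn_gt0// divr_gt0.
have [t1 [/andP[t1a t1b] [C4 HC4]]] : exists t, tau / 2 < t <= tau /\
    exists C', forall M, \sum_(m < M) w m * y m t <= C'.
  apply: (@pick_time _ _ _ (C3 / (1 - q))) => //; first exact: ltW.
    by move=> m; exact: ltW.
  move=> M; apply: (@le_trans _ _ (\sum_(m < M) C3 * q ^+ m)).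
    apply: ler_sum => m _; apply: (@le_trans _ _ (w m * (C3 * (rho / q) ^+ m))).
      by rewrite ler_wpM2l// ltW.
    rewrite mulrCA /w -exprMn (_ : q ^+ 2 / rho * (rho / q) = q)//.
    by field; rewrite !gt_eqF.
  by rewrite -mulr_sumr ler_wpM2l// geometric_sum_le// ltW.
have C40 : 0 <= C4 by apply: le_trans (HC4 0%N); rewrite big_ord0.
pose r := rho / q ^+ 2.
have r0 : 0 < r by rewrite divr_gt0.
have r1 : r < 1 by rewrite ltr_pdivrMr// mul1r.
have rr : rho <= r by rewrite ler_pdivlMr// ler_piMr ?(ltW rho0)// exprn_ile1// ltW.
have r1' : 0 < 1 - r by rewrite subr_gt0.
pose C := C4 + sigma2 * rho / (1 - r).
have e0 : 0 <= sigma2 * rho / (1 - r) by rewrite divr_ge0 ?mulr_ge0// ltW.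
have C0 : 0 <= C by rewrite addr_ge0.
have HC : sigma2 * rho <= C * (1 - r).
  by rewrite /C mulrDl divfK ?gt_eqF// lerDr mulr_ge0// ltW.
have ub n : y n t1 <= C * r ^+ n.
  have : w n * y n t1 <= C4.
    apply: le_trans (HC4 n.+1); rewrite big_ord_recr /= lerDr.
    by apply: sumr_ge0 => m _; rewrite mulr_ge0// ltW.
  rewrite mulrC -ler_pdivlMr// /w -exprVn invf_div -/r => le.
  by apply: le_trans le _; rewrite ler_wpM2r ?exprn_ge0 ?(ltW r0)// lerDl.
exists C => n t tt tT.
have t10 : 0 <= t1 by lra.
apply: (comparison _ (geometric_super rr (ltW r1) C0 HC) t10 _ ub).
- by move=> k; rewrite mulr_ge0 ?exprn_ge0// ltW.
- by rewrite (le_trans t1b).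
- by rewrite (le_trans t1b).
- exact: tT.
Qed.

End birth_death.

(** * Weighted norms as series of coordinates *)
Section weighted_norms.
Context {R : realType} (lambda : R).
Hypothesis lambda1 : 1 < lambda.
Let lambda0 : 0 < lambda. Proof. exact: lt_trans lambda1. Qed.

(** The coordinates are renumbered from 0: site [n] stands for [X_(n+1)]. *)
Definition hweight (s : R) n : R := wave lambda n.+1 `^ (2 * s).

Lemma hweight_gt0 s n : 0 < hweight s n.
Proof. by rewrite powR_gt0// exprn_gt0. Qed.

Lemma hweight_m1 n : hweight (-1) n = (lambda ^+ 2)^-1 ^+ n.+1.
Proof.
rewrite /hweight mulrN1 powRN powR_mulrn; last by rewrite exprn_ge0// ltW.
by rewrite /wave -exprM mulnC exprM exprVn.
Qed.

Lemma hweight_0 n : hweight 0 n = 1.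
Proof. by rewrite /hweight mulr0 powRr0. Qed.

Lemma sum_from1 (f : nat -> \bar R) : (forall n, (0 <= f n)%E) ->
  (\sum_(1 <= n <oo) f n = \sum_(n <oo) f n.+1)%E.
Proof.
move=> f0; rewrite -(@nneseries_addn _ f 1)//.
by apply: eq_eseriesr => n _; rewrite addn1.
Qed.

Lemma Hnorm_sqr s (x : nat -> R) :
  (Hnorm lambda s x ^+ 2 = \sum_(n <oo) (hweight s n * x n.+1 ^+ 2)%:E)%E.
Proof.
have t0 n : (0 <= (wave lambda n `^ (2 * s) * x n ^+ 2)%:E)%E.
  by rewrite lee_fin mulr_ge0 ?sqr_ge0// powR_ge0.
by rewrite /Hnorm sqr_sqrte ?nneseries_ge0// sum_from1.
Qed.

Context d {U : measurableType d} (mu : {measure set U -> \bar R}) (D : set U).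
Hypothesis mD : measurable D.

Lemma L2H_sum s (Y : U -> nat -> R) :
  (forall n, (1 <= n)%N -> measurable_fun D (fun z => Y z n)) ->
  (\int[mu]_(z in D) (Hnorm lambda s (Y z) ^+ 2) =
   \sum_(n <oo) (hweight s n)%:E * \int[mu]_(z in D) (Y z n.+1 ^+ 2)%:E)%E.
Proof.
move=> mY.
under eq_integral do rewrite Hnorm_sqr.
have mYn n : measurable_fun D (fun z => (Y z n.+1 ^+ 2)%:E).
  by apply/measurable_EFinP; apply: measurable_funX; exact: mY.
rewrite integral_nneseries//; last 2 first.
- move=> n; under eq_fun do rewrite EFinM.
  exact: measurable_funeM.
- by move=> n z _; rewrite lee_fin mulr_ge0 ?sqr_ge0// ltW// hweight_gt0.
apply: eq_eseriesr => n _.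
under eq_integral do rewrite EFinM.
rewrite ge0_integralZl//; first by move=> z _; rewrite lee_fin sqr_ge0.
by rewrite lee_fin ltW// hweight_gt0.
Qed.

Lemma L2Hnorm_sqr s (Y : U -> nat -> R) :
  (L2Hnorm lambda mu D s Y ^+ 2 = \int[mu]_(z in D) (Hnorm lambda s (Y z) ^+ 2))%E.
Proof.
rewrite /L2Hnorm sqr_sqrte//; apply: integral_ge0 => z _.
by rewrite Hnorm_sqr nneseries_ge0// => n _ _; rewrite lee_fin mulr_ge0 ?sqr_ge0// ltW// hweight_gt0.
Qed.

Lemma L2Hnorm_lty s (Y : U -> nat -> R) : (L2Hnorm lambda mu D s Y < +oo)%E ->
  (\int[mu]_(z in D) (Hnorm lambda s (Y z) ^+ 2) < +oo)%E.
Proof.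
rewrite -L2Hnorm_sqr; have := sqrte_ge0 (\int[mu]_(z in D) (Hnorm lambda s (Y z) ^+ 2))%E.
rewrite -/(L2Hnorm lambda mu D s Y); case: (L2Hnorm _ _ _ _ _) => [r|//|//] _ _.
by rewrite -EFin_expe ltry.
Qed.

Lemma in_L2H_bound s (Y : U -> nat -> R) : in_L2H lambda mu D s Y ->
  exists2 S : R, 0 <= S & forall M,
    (\sum_(n < M) (hweight s n)%:E * \int[mu]_(z in D) (Y z n.+1 ^+ 2)%:E <= S%:E)%E.
Proof.
move=> [mY /L2Hnorm_lty fin].
have g0 : (0 <= \int[mu]_(z in D) (Hnorm lambda s (Y z) ^+ 2))%E.
  by rewrite -L2Hnorm_sqr expe2 mule_ge0// sqrte_ge0.
exists (fine (\int[mu]_(z in D) (Hnorm lambda s (Y z) ^+ 2))%E); first exact: fine_ge0.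
move=> M; rewrite fineK ?ge0_fin_numE// L2H_sum//.
rewrite -(big_mkord xpredT (fun n => (hweight s n)%:E * \int[mu]_(z in D) (Y z n.+1 ^+ 2)%:E)%E).
apply: nneseries_lim_ge => k _ _; rewrite mule_ge0 ?lee_fin ?(ltW (hweight_gt0 _ _))//.
by apply: integral_ge0 => z _; rewrite lee_fin sqr_ge0.
Qed.

Lemma cvg_L2H_small s (Y_ : nat -> U -> nat -> R) (Y : U -> nat -> R) (e : R) :
  cvg_L2H lambda mu D s Y_ Y -> 0 < e -> \forall N \near \oo, forall M,
    (\sum_(n < M) (hweight s n)%:E *
      \int[mu]_(z in D) ((Y_ N z n.+1 - Y z n.+1) ^+ 2)%:E <= e%:E)%E.
Proof.
move=> [iY_ iY cv] e0.
have s0 : 0 < Num.sqrt e by rewrite sqrtr_gt0.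
apply: filterS (cvg0_lt cv s0) => N lt M.
pose Z z n := Y_ N z n - Y z n.
have mZ n : (1 <= n)%N -> measurable_fun D (fun z => Z z n).
  by move=> n1; apply: measurable_funB; [exact: (iY_ N).1|exact: iY.1].
have le : (\int[mu]_(z in D) (Hnorm lambda s (Z z) ^+ 2) <= e%:E)%E.
  rewrite -L2Hnorm_sqr -[e in leRHS]sqr_sqrtr ?(ltW e0)// EFin_expe !expe2.
  by apply: lee_pmul => //; rewrite ?sqrte_ge0// ltW.
apply: le_trans le; rewrite L2H_sum//.
rewrite -(big_mkord xpredT (fun n => (hweight s n)%:E * \int[mu]_(z in D) (Z z n.+1 ^+ 2)%:E)%E).
apply: nneseries_lim_ge => k _ _; rewrite mule_ge0 ?lee_fin ?(ltW (hweight_gt0 _ _))//.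
by apply: integral_ge0 => z _; rewrite lee_fin sqr_ge0.
Qed.

End weighted_norms.

(** * Second moments of a solution *)
Section solution.
Context {R : realType} d {Omega : measurableType d} (P : probability Omega R).
Local Notation leb := (@lebesgue_measure R).
Variables (T lambda sigma : R) (F : R -> set (set Omega)) (W : nat -> R -> Omega -> R).
Hypothesis lambda1 : 1 < lambda.
Hypothesis T0 : 0 < T.
Hypothesis filtF : filtration T F.
Hypothesis bmW : forall n, brownian_motion P T F (W n).
Hypothesis indW : independent_processes P T W.
Variables (Xbar : Omega -> nat -> R) (X : R -> Omega -> nat -> R).
Hypothesis cs : componentwise_solution P T lambda sigma F W Xbar X.
Hypothesis init : in_L2H lambda P setT (-1) Xbar.
Hypothesis prod : in_L2H lambda (leb \x P)%E (time_sample T) (-1) (on_product X).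

Local Notation k := (wave lambda).
(** The ratio [k_n^2 / k_(n+1)^2] of consecutive rates. *)
Definition rho_of (l : R) : R := (l ^+ 2)^-1.
Local Notation rho := (rho_of lambda).

Let lambda0 : 0 < lambda. Proof. exact: lt_trans lambda1. Qed.

Lemma rhoV n : rho ^- n = k n ^+ 2.
Proof. by rewrite /rho_of -exprVn invrK /wave -!exprM mulnC. Qed.

Let rho0 : 0 < rho. Proof. by rewrite invr_gt0 exprn_gt0. Qed.

Definition coord n (t : R) (w : Omega) : R := X t w n.+1.
Definition moment n t : R := Ex P (fun w => coord n t w ^+ 2).

Let mX n : measurable_fun (@time_sample R d Omega T) (fun z => coord n z.1 z.2).
Proof. exact: prod.1. Qed.

Let aX n : adapted T F (coord n). Proof. exact: cs_adapted cs _ _. Qed.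
Let cX n : continuous_paths T (coord n). Proof. exact: cs_continuous cs _ _. Qed.

Lemma moment_ge0 n t : 0 <= moment n t.
Proof. by apply: Ex_ge0 => w; exact: sqr_ge0. Qed.

Lemma coord_bound d' (U : measurableType d') (mu : {measure set U -> \bar R}) (D : set U)
    (Y : U -> nat -> R) n : measurable D -> in_L2H lambda mu D (-1) Y ->
  exists2 B : R, 0 <= B & (\int[mu]_(z in D) (Y z n.+1 ^+ 2)%:E <= B%:E)%E.
Proof.
move=> mD iY; have [S S0 HS] := in_L2H_bound lambda1 mD iY.
have w0 := hweight_gt0 lambda1 (-1) n.
exists (S / hweight lambda (-1) n); first by rewrite divr_ge0// ltW.
rewrite -(@lee_pmul2l _ (hweight lambda (-1) n)%:E) ?lte_fin//.
rewrite -EFinM mulrC divfK ?gt_eqF//; apply: le_trans (HS n.+1).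
rewrite big_ord_recr /= leeDr//; apply: sume_ge0 => i _.
rewrite mule_ge0 ?lee_fin ?(ltW (hweight_gt0 _ _ _))//.
by apply: integral_ge0 => z _; rewrite lee_fin sqr_ge0.
Qed.

Let mTS : (measurable : set (set (measurableTypeR R * Omega)%type)) (@time_sample R d Omega T).
Proof. by apply: measurableX. Qed.

Let mX2 n : measurable_fun (@time_sample R d Omega T)
  (fun z : R * Omega => (coord n z.1 z.2 ^+ 2)%:E).
Proof. by apply/measurable_EFinP; apply: measurable_funX; exact: mX. Qed.

Let X20 n (z : R * Omega) : (0 <= (coord n z.1 z.2 ^+ 2)%:E)%E.
Proof. by rewrite lee_fin sqr_ge0. Qed.

Lemma coord_prod_bound n : exists2 B : R, 0 <= B &
  (\int[P]_w \int[leb]_(r in `]0%R, T]) (coord n r w ^+ 2)%:E <= B%:E)%E.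
Proof.
have [B B0 HB] := coord_bound n mTS prod.
exists B => //; apply: le_trans HB.
have mXs : measurable_fun (`]0%R, T]%classic `*` setT) (fun z : R * Omega => (coord n z.1 z.2 ^+ 2)%:E).
  by apply/measurable_EFinP; apply: measurable_funX; exact: strip_sub (mX n).
rewrite (strip_tonelli P (measurable_itv _) mXs (X20 n)) -(strip_prod P (measurable_itv _) mXs (X20 n)).
apply: ge0_subset_integral; [exact: measurableX|exact: mTS|exact: mX2|by move=> z _; exact: X20|].
by move=> [r w] [/= + _]; rewrite /time_sample /= !in_itv /= => /andP[/ltW -> ->].
Qed.

Lemma coord_init n : (\int[P]_w (coord n 0 w ^+ 2)%:E = \int[P]_w (Xbar w n.+1 ^+ 2)%:E)%E.
Proof.
have T00 : 0 <= (0 : R) <= T by rewrite lexx ltW.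
apply: ge0_ae_eq_integral => //.
- apply/measurable_EFinP; apply: measurable_funX.
  exact: (mfor_meas filtF T00 (aX n T00)).
- by apply/measurable_EFinP; apply: measurable_funX; exact: init.1.
- by move=> w _; rewrite lee_fin sqr_ge0.
- by move=> w _; rewrite lee_fin sqr_ge0.
by apply: filterS (cs_init cs) => w E _; rewrite /coord E.
Qed.

Lemma sqint_init n : sqint P (coord n 0).
Proof.
have T00 : 0 <= (0 : R) <= T by rewrite lexx ltW.
have mX0 : measurable_fun setT (coord n 0) := mfor_meas filtF T00 (aX n T00).
split=> //; apply: int1_ge0P; first exact: measurable_funX.
  by move=> w; exact: sqr_ge0.
have [B _ HB] := coord_bound n measurableT init.
by rewrite coord_init (le_lt_trans HB)// ltry.
Qed.

(** The equation of site [n], that is of [X_(n+1)], has noise [noise_in] from the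
    link below, [noise_out] from the link above, and drift [- damping n * X]. The
    forcing plays the part of the link below site 0; since it enters without Ito
    correction, its rate is 0. *)
Definition noise_in n (t : R) (w : Omega) : R :=
  if n is m.+1 then k n * coord m t w else sigma.
Definition noise_out n (t : R) (w : Omega) : R := k n.+1 * coord n.+1 t w.
Definition rate_in n : R := if n is m.+1 then k n ^+ 2 else 0.
Definition damping n : R := 2^-1 * (rate_in n + k n.+1 ^+ 2).

Lemma rate_in_ge0 n : 0 <= rate_in n.
Proof. by case: n => // n; exact: sqr_ge0. Qed.

Lemma damping_ge0 n : 0 <= damping n.
Proof. by rewrite mulr_ge0// addr_ge0 ?sqr_ge0// rate_in_ge0. Qed.

Let mH n : measurable_fun (@time_sample R d Omega T) (fun z => noise_in n z.1 z.2).
Proof. by case: n => [|n]; [exact: measurable_cst|apply: measurable_funM => //; exact: mX]. Qed.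
Let mG n : measurable_fun (@time_sample R d Omega T) (fun z => noise_out n z.1 z.2).
Proof. by apply: measurable_funM => //; exact: mX. Qed.

Lemma coord_equation n : exists I J, [/\ is_ito_integral P T F (W n) (noise_in n) I,
  is_ito_integral P T F (W n.+1) (noise_out n) J &
  forall t, 0 <= t <= T -> {ae P, forall w, coord n t w = coord n 0 w + I t w - J t w
     - \int[leb]_(r in `[0, t]) (damping n * coord n r w)}].
Proof.
case: n => [|n].
  have [I [J [h1 h2 h3]]] := cs_equation1 cs.
  by exists I, J; split => // t tT; rewrite /damping /rate_in add0r; exact: h3.
have [I [J [h1 h2 h3]]] := @cs_equation _ _ _ _ _ _ _ _ _ _ _ cs n.+2 isT.
by exists I, J; split.
Qed.

Let pqn n : n != n.+1 :> nat. Proof. by rewrite neq_ltn leqnn. Qed.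

Lemma moment_bounded n : exists2 M, 0 <= M & forall t, 0 <= t <= T ->
  sqint P (coord n t) /\ moment n t <= M.
Proof.
have [I [J [h1 h2 h3]]] := coord_equation n.
have bnd (a : R) m : exists A : R,
    (\int[P]_w \int[leb]_(r in `]0%R, T]) ((a * coord m r w) ^+ 2)%:E <= A%:E)%E.
  have [B B0 HB] := coord_prod_bound m; exists (a ^+ 2 * B).
  have mXs : measurable_fun (`]0%R, T]%classic `*` setT) (fun z : R * Omega => (coord m z.1 z.2 ^+ 2)%:E).
    by apply/measurable_EFinP; apply: measurable_funX; exact: strip_sub (mX m).
  have ms w : measurable_fun `]0%R, T] (fun r => (coord m r w ^+ 2)%:E).
    exact: (@section_meas _ _ _ _ _ _ (fun z => (coord m z.1 z.2 ^+ 2)%:E) w _ mXs).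
  have E w : (\int[leb]_(r in `]0%R, T]) ((a * coord m r w) ^+ 2)%:E =
      (a ^+ 2)%:E * \int[leb]_(r in `]0%R, T]) (coord m r w ^+ 2)%:E)%E.
    under eq_integral do rewrite exprMn EFinM.
    by rewrite ge0_integralZl//; [exact: ms|move=> r _; rewrite lee_fin sqr_ge0|rewrite lee_fin sqr_ge0].
  rewrite (_ : (\int[P]_w _)%E = (\int[P]_w ((a ^+ 2)%:E *
      \int[leb]_(r in `]0%R, T]) (coord m r w ^+ 2)%:E))%E); last by apply: eq_integral => w _; exact: E.
  rewrite ge0_integralZl//; last 3 first.
  - exact: (strip_meas (measurable_itv _) mXs (X20 m)).
  - by move=> w _; apply: integral_ge0 => r _; rewrite lee_fin sqr_ge0.
  - by rewrite lee_fin sqr_ge0.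
  by rewrite (EFinM (a ^+ 2) B) lee_wpmul2l// lee_fin sqr_ge0.
have [A HA] : exists A : R, (\int[P]_w \int[leb]_(r in `]0%R, T]) (noise_in n r w ^+ 2)%:E <= A%:E)%E.
  case: (n) => [|m]; last exact: bnd.
  exists (sigma ^+ 2 * T); rewrite /noise_in.
  under eq_integral do rewrite integral_cst//= lebesgue_measure_itv /= lte_fin T0 sube0.
  by rewrite -EFinM integral_cst//= probability_setT mule1.
have [A' HA'] := bnd (k n.+1) n.+1.
have [B _ HB] := coord_prod_bound n.
have [M HM] := component_bounded filtF bmW indW (pqn n) h1 h2 (mH n) (mG n) (mX n)
  (aX n) (@cX n) h3 (sqint_init n) HA HA' HB.
have T00 : 0 <= (0 : R) <= T by rewrite lexx ltW.
by exists M => //; apply: le_trans (HM 0 T00).2; exact: moment_ge0.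
Qed.

Lemma coord_sqint n t : 0 <= t <= T -> sqint P (coord n t).
Proof. by have [M _ HM] := moment_bounded n => /HM[]. Qed.

Definition noise_in_moment n t : R := if n is m.+1 then k n ^+ 2 * moment m t else sigma ^+ 2.

Lemma noise_in_momentE n t : 0 <= t <= T ->
  sqint P (noise_in n t) /\ Ex P (fun w => noise_in n t w ^+ 2) = noise_in_moment n t.
Proof.
case: n => [|n] tT.
  by split; [exact: sqint_cst|rewrite /noise_in Ex_cst].
have sX := coord_sqint n tT.
split; first exact: sqintZ.
by under [X in Ex _ X]eq_fun do rewrite exprMn; rewrite ExZ//; exact: sX.2.
Qed.

Lemma noise_out_momentE n t : 0 <= t <= T ->
  sqint P (noise_out n t) /\ Ex P (fun w => noise_out n t w ^+ 2) = k n.+1 ^+ 2 * moment n.+1 t.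
Proof.
move=> tT; have sX := coord_sqint n.+1 tT.
split; first exact: sqintZ.
by under [X in Ex _ X]eq_fun do rewrite exprMn; rewrite ExZ//; exact: sX.2.
Qed.

Lemma noise_in_bounded n : exists M, forall t, 0 <= t <= T -> noise_in_moment n t <= M.
Proof.
case: n => [|n]; first by exists (sigma ^+ 2).
have [M _ HM] := moment_bounded n; exists (k n.+1 ^+ 2 * M) => t /HM[_ le].
by rewrite ler_wpM2l// sqr_ge0.
Qed.

Lemma coord_lipschitz n : exists2 C, 0 <= C & forall s t, 0 <= s -> s <= t -> t <= T ->
  Ex P (fun w => (coord n t w - coord n s w) ^+ 2) <= C * (t - s).
Proof.
have [I [J [h1 h2 h3]]] := coord_equation n.
have [MH bH] := noise_in_bounded n.
have [MG _ bG] := moment_bounded n.+1.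
have [MX _ bX] := moment_bounded n.
have b1 r : 0 <= r <= T -> sqint P (noise_in n r) /\ Ex P (fun w => noise_in n r w ^+ 2) <= MH.
  by move=> rT; have [? ->] := noise_in_momentE n rT; split => //; exact: bH.
have b2 r : 0 <= r <= T ->
    sqint P (noise_out n r) /\ Ex P (fun w => noise_out n r w ^+ 2) <= k n.+1 ^+ 2 * MG.
  move=> rT; have [? ->] := noise_out_momentE n rT; split => //.
  by rewrite ler_wpM2l ?sqr_ge0//; have [] := bG r rT.
have b3 r : 0 <= r <= T -> Ex P (fun w => coord n r w ^+ 2) <= MX by move=> /bX[].
exact: (component_lipschitz filtF bmW indW (pqn n) (damping_ge0 n) h1 h2 (mH n) (mG n) (mX n)
  (aX n) (@cX n) h3 (fun t h => coord_sqint n h) b1 b2 b3).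
Qed.

Lemma moment_uc n e : 0 < e -> exists2 dl, 0 < dl &
  forall s t, 0 <= s -> s <= t -> t <= T -> t - s < dl -> `|moment n t - moment n s| <= e.
Proof.
move=> e0; have [C C0 HC] := coord_lipschitz n; have [M M0 HM] := moment_bounded n.
pose eta := e / (2 * (M + 1)).
have M1 : 0 < 2 * (M + 1) by rewrite mulr_gt0// ltr_wpDl.
have eta0 : 0 < eta by rewrite divr_gt0.
have ei : 0 < 1 + eta^-1 by rewrite addr_gt0// invr_gt0.
have C1 : 0 < 2 * ((1 + eta^-1) * (C + 1)) by rewrite !mulr_gt0// ltr_wpDl.
exists (e / (2 * ((1 + eta^-1) * (C + 1)))); first by rewrite divr_gt0.
move=> s t s0 st tT ts.
have sT' : 0 <= s <= T by rewrite s0 (le_trans st).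
have tT' : 0 <= t <= T by rewrite (le_trans s0).
have [ss sM] := HM s sT'; have [st' tM] := HM t tT'.
have L := HC s t s0 st tT.
have half (a b : R) (Y Z : Omega -> R) : sqint P Y -> sqint P Z -> Ex P (fun w => Z w ^+ 2) <= M ->
    Ex P (fun w => (Y w - Z w) ^+ 2) <= C * (t - s) ->
    Ex P (fun w => Y w ^+ 2) - Ex P (fun w => Z w ^+ 2) <= e.
  move=> sY sZ ZM YZ.
  have sYZ := sqintB sY sZ.
  have := Ex_le sY.2 (int1D (int1Z (1 + eta) sZ.2) (int1Z (1 + eta^-1) sYZ.2))
    (fun w => sqr_youngD (Y w) (Z w) eta0).
  rewrite ExD; [|by apply: int1Z; exact: sZ.2|by apply: int1Z; exact: sYZ.2].
  rewrite ExZ; last exact: sZ.2.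
  rewrite ExZ; last exact: sYZ.2.
  have h1 : eta * Ex P (fun w => Z w ^+ 2) <= e / 2.
    apply: (@le_trans _ _ (eta * (M + 1))).
      by rewrite ler_wpM2l ?(ltW eta0)// (le_trans ZM)// lerDl.
    rewrite /eta le_eqVlt; apply/orP; left; apply/eqP; field; rewrite gt_eqF//; lra.
  have h2 : (1 + eta^-1) * Ex P (fun w => (Y w - Z w) ^+ 2) <= e / 2.
    apply: (@le_trans _ _ ((1 + eta^-1) * ((C + 1) * (t - s)))).
      rewrite ler_wpM2l ?(ltW ei)// (le_trans YZ)// ler_wpM2r ?subr_ge0// lerDl//.
    move: ts; rewrite ltr_pdivlMr// => /ltW; lra.
  lra.
rewrite ler_norml; apply/andP; split.
  rewrite lerBrDr addrC -lerBrDr opprK [leRHS]addrC -lerBlDr.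
  apply: (half 0 0 _ _ ss st' tM).
  by under [X in Ex _ X]eq_fun do rewrite -sqrrN opprB.
exact: (half 0 0 _ _ st' ss sM).
Qed.

(** The energy inequality of one component, with the moments of the neighbours
    frozen at time [t] thanks to uniform continuity. *)
Lemma moment_subsol n e : 0 < e -> exists2 dl, 0 < dl &
  forall s t, 0 <= s -> s <= t -> t <= T -> t - s < dl ->
  moment n t - moment n s <= (t - s) *
   (flux rho (sigma ^+ 2) (moment ^~ t) n - flux rho (sigma ^+ 2) (moment ^~ t) n.+1 + e).
Proof.
move=> e0; have [I [J [h1 h2 h3]]] := coord_equation n.
pose K := rate_in n + k n.+1 ^+ 2 + 2 * damping n + 1.
have K1 := rate_in_ge0 n.
have K2 := sqr_ge0 (k n.+1); have K3 := damping_ge0 n.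
have K0 : 0 < K by rewrite /K; lra.
pose e' := e / K.
have e'0 : 0 < e' by rewrite divr_gt0.
have [C C0 HC] := coord_lipschitz n.
have [d1 d10 H1] := moment_uc n.-1 e'0.
have [d2 d20 H2] := moment_uc n e'0.
have [d3 d30 H3] := moment_uc n.+1 e'0.
have [M _ HM] := moment_bounded n.
have C1 : 0 < C + 1 by rewrite ltr_wpDl.
have d40 : 0 < e' / (C + 1) by rewrite divr_gt0.
exists (Num.min (Num.min d1 d2) (Num.min d3 (e' / (C + 1)))); first by rewrite !lt_min d10 d20 d30.
move=> s t s0 st tT; rewrite !lt_min => /andP[/andP[l1 l2] /andP[l3 l4]].
have inT r : s < r <= t -> 0 <= r <= T.
  by move=> /andP[sr rt]; rewrite (le_trans s0 (ltW sr)) (le_trans rt).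
have close (d0 : R) r : t - s < d0 -> s < r <= t -> [/\ 0 <= r, r <= t & t - r < d0].
  move=> l /andP[sr rt]; split => //; first exact: le_trans s0 (ltW sr).
  by apply: le_lt_trans l; rewrite lerD2l lerN2 ltW.
have rl r : s < r <= t -> [/\ 0 <= r, r <= t & t - r <= t - s].
  move=> /andP[sr rt]; split => //; first exact: le_trans s0 (ltW sr).
  by rewrite lerD2l lerN2 ltW.
have lt_of (m : nat) (d0 : R) : t - s < d0 -> (forall s t, 0 <= s -> s <= t -> t <= T ->
    t - s < d0 -> `|moment m t - moment m s| <= e') -> forall r, s < r <= t ->
    moment m t - e' <= moment m r <= moment m t + e'.
  move=> l H r /rl[r0 rt le]; have := H r t r0 rt tT (le_lt_trans le l).
  by rewrite ler_norml => /andP[]; lra.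
have c1 r : s < r <= t -> sqint P (noise_in n r) /\ Ex P (fun w => noise_in n r w ^+ 2) <=
    noise_in_moment n t + rate_in n * e'.
  move=> sr; have [? ->] := noise_in_momentE n (inT r sr); split => //.
  case: (n) H1 l1 => [|m] H1 l1; first by rewrite /noise_in_moment /rate_in mul0r addr0.
  rewrite /noise_in_moment /rate_in -mulrDr ler_wpM2l ?sqr_ge0//.
  by have /andP[] := lt_of m d1 l1 H1 r sr.
have c2 r : s < r <= t -> sqint P (noise_out n r) /\ Ex P (fun w => noise_out n r w ^+ 2) <=
    k n.+1 ^+ 2 * (moment n.+1 t + e').
  move=> sr; have [? ->] := noise_out_momentE n (inT r sr); split => //.
  rewrite ler_wpM2l ?sqr_ge0//.
  by have /andP[] := lt_of n.+1 d3 l3 H3 r sr.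
have c3 r : s < r <= t -> Num.max 0 (moment n t - e') <= Ex P (fun w => coord n r w ^+ 2) <= M.
  move=> sr; have [_ ->] := HM r (inT r sr); rewrite andbT ge_max.
  by have /andP[-> _] := lt_of n d2 l2 H2 r sr; rewrite moment_ge0.
have c4 r : s < r <= t -> Ex P (fun w => (coord n t w - coord n r w) ^+ 2) <= e'.
  move=> /rl[r0 rt le]; apply: (le_trans (HC r t r0 rt tT)).
  apply: (@le_trans _ _ ((C + 1) * (t - s))).
    by apply: ler_pM; rewrite ?subr_ge0// lerDl.
  by move: l4; rewrite ltr_pdivlMr// => /ltW; rewrite mulrC.
have b0 : 0 <= Num.max 0 (moment n t - e') by rewrite le_max lexx.
have := component_energy filtF bmW indW (pqn n) (damping_ge0 n) h1 h2 (mH n) (mG n) (mX n)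
  (aX n) (@cX n) h3 (fun t h => coord_sqint n h) s0 st tT c1 c2 b0 c3 c4.
rewrite -/(moment n t) -/(moment n s) => le; apply: (le_trans le).
rewrite ler_wpM2l ?subr_ge0//.
have bm : moment n t - e' <= Num.max 0 (moment n t - e') by rewrite le_max lexx orbT.
have h4 := ler_wpM2l K3 bm.
have -> : e = e' * K by rewrite /e' divfK// gt_eqF.
have fl : flux rho (sigma ^+ 2) (moment ^~ t) n - flux rho (sigma ^+ 2) (moment ^~ t) n.+1 =
    noise_in_moment n t + k n.+1 ^+ 2 * moment n.+1 t - 2 * damping n * moment n t.
  rewrite /flux rhoV /noise_in_moment /damping /rate_in; case: (n) => [|m]; rewrite ?rhoV; lra.
rewrite fl /K; lra.
Qed.

Lemma primitive_moment n : ((primitive (moment n) T)%:E = \int[(leb \x P)%E]_(z in time_sample T) (on_product X z n.+1 ^+ 2)%:E)%E.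
Proof.
have cy : contT T (moment n).
  exact: (@contT_y _ _ moment T0 moment_uc n).
rewrite /primitive /Rintegral fineK; last first.
  by apply: integrable_fin_num (integrable_contT cy).
rewrite [RHS](strip_prod P (measurable_itv _) (mX2 n) (X20 n)).
apply: eq_integral => r; rewrite inE /= in_itv /= => rT.
by rewrite /moment Ex_EFin//; exact: (coord_sqint n rT).2.
Qed.

End solution.

(** * Tails of weighted sums *)
Section summable.
Context {R : realType}.

Lemma real_weighted_sum (w : nat -> R) (g : nat -> \bar R) (S : R) :
  (forall n, 0 < w n) -> (forall n, 0 <= g n)%E ->
  (forall M, (\sum_(n < M) (w n)%:E * g n <= S%:E)%E) ->
  exists2 D : nat -> R, forall n, g n = (D n)%:E &
    forall M, \sum_(n < M) w n * D n <= S.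
Proof.
move=> w0 g0 HS.
have fin n : g n \is a fin_num.
  rewrite ge0_fin_numE//; case E : (g n) (g0 n) => [r| |] // _; first exact: ltry.
  have := HS n.+1; rewrite big_ord_recr/= E gt0_muley ?lte_fin//.
  rewrite addey ?leye_eq// -ltNye (@lt_le_trans _ _ 0%E) ?ltNyr//.
  by apply: sume_ge0 => k _; rewrite mule_ge0// lee_fin ltW.
exists (fun n => fine (g n)) => [n|M]; first by rewrite fineK.
have := HS M; rewrite (eq_bigr (fun n : 'I_M => (w n * fine (g n))%:E)).
  by rewrite sumEFin lee_fin.
by move=> n _; rewrite EFinM fineK.
Qed.

Lemma summable_tail (f : nat -> R) S e : (forall n, 0 <= f n) ->
  (forall M, \sum_(n < M) f n <= S) -> 0 < e ->
  exists K, forall M, \sum_(n < M) f (K + n)%N <= e.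
Proof.
move=> f0 HS e0; pose E := range (fun M => \sum_(n < M) f n).
have sE : has_sup E.
  split; first by exists (\sum_(n < 0) f n); exists 0%N.
  by exists S => _ [M _ <-].
have [_ [K _ <-] lt] := sup_adherent e0 sE.
exists K => M.
have : \sum_(n < K + M) f n <= sup E by apply: ub_le_sup; [exact: sE.2|exists (K + M)%N].
by rewrite big_split_ord /=; lra.
Qed.

Lemma summable_cvg0 (f : nat -> R) S e : (forall n, 0 <= f n) ->
  (forall M, \sum_(n < M) f n <= S) -> 0 < e ->
  exists n0, forall n, (n0 <= n)%N -> f n <= e.
Proof.
move=> f0 HS e0; have [K HK] := summable_tail f0 HS e0.
exists K => n Kn; apply: le_trans (HK (n - K).+1).
by rewrite big_ord_recr /= subnKC// lerDr sumr_ge0.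
Qed.

Variable rho : R.
Hypothesis rho0 : 0 < rho.
Hypothesis rho1 : rho < 1.

Lemma green_weight_small e : 0 < e -> exists n0, forall n, (n0 <= n)%N -> green_weight rho n <= e.
Proof.
move=> e0; apply: (@summable_cvg0 _ (rho / (1 - rho) * (1 - rho)^-1)) => //.
  by move=> n; exact/ltW/green_weight_gt0.
move=> M; rewrite (eq_bigr (fun n : 'I_M => rho / (1 - rho) * rho ^+ n)).
  rewrite -mulr_sumr ler_wpM2l//; first by rewrite divr_ge0 ?subr_ge0// ltW.
  by apply: geometric_sum_le => //; exact: ltW.
by move=> n _; rewrite /green_weight exprS; ring.
Qed.

(** The sites beyond a large [K] contribute little because the sum converges, and
    the sites below [K] because the pole [m] makes their weights small. *)
Lemma green_tail (z : nat -> R) S e : (forall n, 0 <= z n) ->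
  (forall M, \sum_(n < M) green_weight rho n * z n <= S) -> 0 < e ->
  exists m0, forall m M, (m0 <= m)%N -> \sum_(n < M) green_weight rho (maxn n m) * z n <= e.
Proof.
move=> z0 HS e0; have e20 : 0 < e / 2 by rewrite divr_gt0.
have a0 n := green_weight_gt0 rho0 rho1 n.
have [K HK] := summable_tail (fun n => mulr_ge0 (ltW (a0 n)) (z0 n)) HS e20.
pose B := \sum_(n < K) z n.
have B0 : 0 <= B by exact: sumr_ge0.
have B1 : 0 < B + 1 by rewrite ltr_wpDl.
have [m0 Hm0] := green_weight_small (divr_gt0 e20 B1).
exists m0 => m M m0m.
apply: (@le_trans _ _ (\sum_(n < K + M) green_weight rho (maxn n m) * z n)).
  rewrite addnC big_split_ord /= lerDl sumr_ge0// => n _.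
  by rewrite mulr_ge0// ltW.
rewrite big_split_ord /=.
have h1 : \sum_(n < K) green_weight rho (maxn n m) * z n <= e / 2 / (B + 1) * B.
  rewrite /B mulr_sumr; apply: ler_sum => n _; rewrite ler_wpM2r//.
  by apply: Hm0; exact: leq_trans (leq_maxr _ _).
have h2 : e / 2 / (B + 1) * B <= e / 2.
  by rewrite mulrAC ler_pdivrMr// ler_wpM2l ?(ltW e20)// lerDl.
have h3 : \sum_(n < M) green_weight rho (maxn (K + n) m) * z (K + n)%N <= e / 2.
  apply: le_trans (HK M); apply: ler_sum => n _.
  by rewrite ler_wpM2r// green_weight_le// leq_maxl.
lra.
Qed.

End summable.

Lemma sqr_integral_le {R : realType} d (U : measurableType d)
    (mu : {measure set U -> \bar R}) (D : set U) (f g : U -> R) :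
  measurable D -> measurable_fun D f -> measurable_fun D g ->
  (\int[mu]_(z in D) (f z ^+ 2)%:E <= 2%:E * \int[mu]_(z in D) ((g z - f z) ^+ 2)%:E
     + 2%:E * \int[mu]_(z in D) (g z ^+ 2)%:E)%E.
Proof.
move=> mD mf mg.
have msq (h : U -> R) : measurable_fun D h -> measurable_fun D (fun z => (h z ^+ 2)%:E).
  by move=> mh; apply/measurable_EFinP; exact: measurable_funX.
have mgf : measurable_fun D (fun z => g z - f z) by exact: measurable_funB.
have ge (h : U -> R) (z : U) : (0 <= (h z ^+ 2)%:E :> \bar R)%E by rewrite lee_fin sqr_ge0.
have mz (h : U -> R) : measurable_fun D h -> measurable_fun D (fun z => 2%:E * (h z ^+ 2)%:E)%E.
  by move=> mh; apply: measurable_funeM; exact: msq.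
rewrite -!ge0_integralZl//; try exact: msq; last by move=> z _; exact: (ge (fun z => g z - f z)).
rewrite -ge0_integralD//; try exact: (mz (fun z => g z - f z)); try exact: mz;
  try by move=> z _; rewrite mule_ge0// lee_fin sqr_ge0.
apply: ge0_le_integral => //.
- exact: msq.
- by apply: emeasurable_funD; [exact: (mz (fun z => g z - f z))|exact: mz].
- move=> z _; rewrite -!EFinM -EFinD lee_fin.
  by have := sqr_ge0 (2 * g z - f z); nra.
Qed.

(** * The Dirichlet condition at infinity *)
Section dirichlet_condition.
Context {R : realType} d {Omega : measurableType d} (P : probability Omega R).
Local Notation leb := (@lebesgue_measure R).
Variables (T lambda sigma : R) (F : R -> set (set Omega)) (W : nat -> R -> Omega -> R).
Hypothesis lambda1 : 1 < lambda.
Hypothesis T0 : 0 < T.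
Hypothesis filtF : filtration T F.
Hypothesis bmW : forall n, brownian_motion P T F (W n).
Hypothesis indW : independent_processes P T W.
Local Notation rho := (rho_of lambda).
Local Notation solution := (componentwise_solution P T lambda sigma F W).
Local Notation init2 := (in_L2H lambda P setT (-1)).
Local Notation prod2 := (in_L2H lambda (leb \x P)%E (time_sample T) (-1)).
Local Notation vanishing y := (forall e, 0 < e -> exists n0 : nat, forall n, (n0 <= n)%N ->
  primitive (y n) T <= e).

Lemma rho_gt0 : 0 < rho.
Proof. by rewrite invr_gt0 exprn_gt0// (lt_trans ltr01). Qed.

Lemma rho_lt1 : rho < 1.
Proof.
by rewrite invf_lt1 ?exprn_gt0 ?exprn_egt1// (lt_trans ltr01).
Qed.

Lemma hweight_green n : hweight lambda (-1) n = (1 - rho) * green_weight rho n.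
Proof.
by rewrite hweight_m1// /green_weight mulrC divfK// subr_eq0 gt_eqF// rho_lt1.
Qed.

Let mTS : (measurable : set (set (measurableTypeR R * Omega)%type)) (@time_sample R d Omega T).
Proof. exact: measurableX. Qed.

Lemma init_second_moment Xbar X n : solution Xbar X -> init2 Xbar ->
  (\int[P]_w (Xbar w n.+1 ^+ 2)%:E = (moment P X n 0)%:E)%E.
Proof.
move=> cs iX; rewrite -(coord_init T0 filtF cs iX) /moment -Ex_EFin//.
by have [] := sqint_init lambda1 T0 filtF cs iX n.
Qed.

Lemma init_summable Xbar X : solution Xbar X -> init2 Xbar ->
  exists S, forall M, \sum_(n < M) green_weight rho n * moment P X n 0 <= S.
Proof.
move=> cs iX; have [S S0 HS] := in_L2H_bound lambda1 measurableT iX.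
exists (S / (1 - rho)) => M; rewrite ler_pdivlMr ?subr_gt0 ?rho_lt1// mulrC mulr_sumr.
rewrite -lee_fin; apply: le_trans (HS M); rewrite -sumEFin; apply: lee_sum => n _.
by rewrite (init_second_moment _ cs iX) -EFinM mulrA -hweight_green.
Qed.

(** Square integrability in [l^2] says that the time-integrated moments are
    summable. *)
Lemma proper_dirichlet Xbar X : proper_solution P T lambda sigma F W Xbar X ->
  init2 Xbar -> prod2 (on_product X) -> vanishing (moment P X).
Proof.
move=> [cs l2 _] iX pX e e0.
have [S S0 HS] := in_L2H_bound lambda1 mTS l2.
apply: (@summable_cvg0 _ _ S) => // [n|M].
  by apply: Rintegral_ge0 => t _; exact: moment_ge0.
rewrite -lee_fin; apply: le_trans (HS M); rewrite -sumEFin; apply: lee_sum => n _.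
by rewrite hweight_0 mul1e (primitive_moment lambda1 T0 filtF bmW indW cs iX pX).
Qed.

(** For [m] large, apply [green_limit] to a proper solution so close to [X] that
    the differences of the [m]-th coordinates and of the initial conditions are
    negligible. The closeness may depend on [m]; the conclusion does not. *)
Lemma moderate_dirichlet Xbar X : moderate_solution P T lambda sigma F W Xbar X ->
  vanishing (moment P X).
Proof.
move=> [cs iX pX [Xb_ [X_ [prop cvX cvI]]]] e e0.
have d0 : 0 < 1 - rho by rewrite subr_gt0 rho_lt1.
(* 12 = 2 + 2 * (4 + 1): the factors 2 come from bounding the square of a sum,
   and 4 from applying such a bound to the initial condition *)
pose e' := e / 12.
have e'0 : 0 < e' by rewrite divr_gt0.
have [S HS] := init_summable cs iX.
have [m1 Hm1] := green_tail rho_gt0 rho_lt1 (fun n => moment_ge0 P X n 0) HS e'0.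
have s20 : 0 < sigma ^+ 2 * T + 1 by rewrite ltr_wpDl// mulr_ge0 ?sqr_ge0// ltW.
have [m2 Hm2] := green_weight_small rho_gt0 rho_lt1 (divr_gt0 e'0 s20).
exists (maxn m1 m2) => m; rewrite geq_max => /andP[m1m m2m].
have sm : sigma ^+ 2 * green_weight rho m * T <= e'.
  have := Hm2 m m2m; rewrite ler_pdivlMr// mulrDr mulr1.
  by have := green_weight_gt0 rho_gt0 rho_lt1 m; lra.
have wm := hweight_gt0 lambda1 (-1) m.
have near1 := cvg_L2H_small lambda1 mTS cvX (mulr_gt0 e'0 wm).
have near2 := cvg_L2H_small lambda1 measurableT cvI (mulr_gt0 e'0 d0).
pose g1 N n := (\int[(leb \x P)%E]_(z in time_sample T)
  ((on_product (X_ N) z n.+1 - on_product X z n.+1) ^+ 2)%:E)%E.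
pose g2 N n := (\int[P]_z ((Xb_ N z n.+1 - Xbar z n.+1) ^+ 2)%:E)%E.
have [N [H1 H2]] : exists N,
    (forall M, (\sum_(n < M) (hweight lambda (-1) n)%:E * g1 N n <=
       (e' * hweight lambda (-1) m)%:E)%E) /\
    (forall M, (\sum_(n < M) (hweight lambda (-1) n)%:E * g2 N n <= (e' * (1 - rho))%:E)%E).
  by have [N _ /(_ N (leqnn N))] := filterI near1 near2; exists N.
have [iN _ _] := cvI; have [pN _ _] := cvX; have csN := ps_componentwise (prop N).
have w0 := hweight_gt0 lambda1 (-1).
have g10 n : (0 <= g1 N n)%E by apply: integral_ge0 => z _; rewrite lee_fin sqr_ge0.
have g20 n : (0 <= g2 N n)%E by apply: integral_ge0 => z _; rewrite lee_fin sqr_ge0.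
have [D1 D1E HD1] := real_weighted_sum w0 g10 H1.
have [D2 D2E HD2] := real_weighted_sum w0 g20 H2.
have D10 n : 0 <= D1 n by rewrite -lee_fin -D1E.
have D20 n : 0 <= D2 n by rewrite -lee_fin -D2E.
have D1m : D1 m <= e'.
  rewrite -(ler_pM2l wm) [leRHS]mulrC; apply: le_trans (HD1 m.+1).
  by rewrite big_ord_recr /= lerDr sumr_ge0// => n _; rewrite mulr_ge0// ltW.
have le1 : primitive (moment P X m) T <= 2 * D1 m + 2 * primitive (moment P (X_ N) m) T.
  rewrite -lee_fin EFinD !EFinM -D1E (primitive_moment lambda1 T0 filtF bmW indW cs iX pX).
  rewrite (primitive_moment lambda1 T0 filtF bmW indW csN (iN N) (pN N)).
  by apply: sqr_integral_le => //; [exact: pX.1|exact: (pN N).1].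
have le2 n : moment P (X_ N) n 0 <= 2 * D2 n + 2 * moment P X n 0.
  rewrite -lee_fin EFinD !EFinM -D2E -(init_second_moment n csN (iN N)).
  rewrite -(init_second_moment n cs iX).
  under [X in (2%:E * X + _)%E]eq_integral do rewrite -sqrrN opprB.
  by apply: sqr_integral_le => //; [exact: (iN N).1|exact: iX.1].
have rhs M : \sum_(n < M) green_weight rho (maxn n m) * moment P (X_ N) n 0 <= 4 * e'.
  apply: (@le_trans _ _ (2 * \sum_(n < M) green_weight rho n * D2 n +
      2 * \sum_(n < M) green_weight rho (maxn n m) * moment P X n 0)).
    rewrite !mulr_sumr -big_split /=; apply: ler_sum => n _.
    have a1 := green_weight_gt0 rho_gt0 rho_lt1 (maxn n m).
    have a2 : green_weight rho (maxn n m) <= green_weight rho n.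
      by apply: green_weight_le; [exact: rho_gt0|exact: rho_lt1|exact: leq_maxl].
    have := ler_wpM2l (ltW a1) (le2 n); have := ler_wpM2r (D20 n) a2; lra.
  have := Hm1 m M m1m.
  suff : \sum_(n < M) green_weight rho n * D2 n <= e' by lra.
  rewrite -(ler_pM2l d0) mulr_sumr [leRHS]mulrC; apply: le_trans (HD2 M).
  by apply: ler_sum => n _; rewrite hweight_green mulrA.
have := green_limit T0 rho_gt0 rho_lt1 (sqr_ge0 sigma) (moment_ge0 P (X_ N))
  (moment_uc lambda1 T0 filtF bmW indW csN (iN N) (pN N))
  (moment_subsol lambda1 T0 filtF bmW indW csN (iN N) (pN N))
  (proper_dirichlet (prop N) (iN N) (pN N)) (lexx 0) (ltW T0) (lexx T) rhs.
have -> : primitive (moment P (X_ N) m) 0 = 0 by rewrite /primitive set_itv1 Rintegral_set1.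
rewrite !subr0 => le3.
have -> : e = 12 * e' by rewrite /e' mulrC divfK.
lra.
Qed.

End dirichlet_condition.

(** * Continuity of a series with geometric tails *)
Section geometric_tail.
Context {R : realType}.
Variables (f : nat -> R -> R) (v : R -> R) (tau T C x : R).
Hypothesis x0 : 0 <= x.
Hypothesis x1 : x < 1.
Hypothesis f0 : forall n t, 0 <= f n t.
Hypothesis fC : forall n t, tau <= t -> t <= T -> f n t <= C * x ^+ n.
Hypothesis fv : forall t, tau <= t -> t <= T -> (\sum_(n <oo) (f n t)%:E <= (v t)%:E)%E /\
  ((v t)%:E <= \sum_(n <oo) (f n t)%:E)%E.

Let C0 t : tau <= t -> t <= T -> 0 <= C.
Proof. by move=> h1 h2; have := fC 0 h1 h2; rewrite expr0 mulr1; exact: le_trans. Qed.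

Lemma geometric_tail M t : tau <= t -> t <= T ->
  \sum_(n < M) f n t <= v t <= \sum_(n < M) f n t + x ^+ M * (C / (1 - x)).
Proof.
move=> h1 h2; have [le1 le2] := fv h1 h2; apply/andP; split.
  rewrite -lee_fin; apply: le_trans le1; rewrite -sumEFin -(big_mkord xpredT (fun n => (f n t)%:E)).
  by apply: nneseries_lim_ge => n _ _; rewrite lee_fin.
rewrite -lee_fin; apply: (le_trans le2); apply: lime_le.
  by apply: is_cvg_nneseries => n _ _; rewrite lee_fin.
apply: nearW => N; rewrite /= big_mkord sumEFin lee_fin.
apply: (@le_trans _ _ (\sum_(n < M + N) f n t)).
  by rewrite addnC big_split_ord /= lerDl sumr_ge0.
rewrite big_split_ord /= lerD2l.
apply: (@le_trans _ _ (\sum_(n < N) x ^+ M * C * x ^+ n)).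
  by apply: ler_sum => n _; rewrite mulrAC -exprD mulrC; exact: fC.
rewrite -mulr_sumr -mulrA ler_wpM2l ?exprn_ge0// ler_wpM2l ?(C0 h1 h2)//.
exact: geometric_sum_le.
Qed.

Hypothesis tau0 : 0 <= tau.
Hypothesis uc : forall n e, 0 < e -> exists2 dl, 0 < dl & forall s t,
  0 <= s -> s <= t -> t <= T -> t - s < dl -> `|f n t - f n s| <= e.

Lemma sum_uc M e : 0 < e -> exists2 dl, 0 < dl & forall s t,
  0 <= s -> s <= t -> t <= T -> t - s < dl ->
  `|\sum_(n < M) f n t - \sum_(n < M) f n s| <= e.
Proof.
elim: M e => [|M IH] e e0.
  by exists 1 => // s t _ _ _ _; rewrite !big_ord0 subrr normr0 ltW.
have e20 : 0 < e / 2 by rewrite divr_gt0.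
have [d1 d10 H1] := IH _ e20; have [d2 d20 H2] := uc M e20.
exists (Num.min d1 d2); first by rewrite lt_min d10.
move=> s t s0 st tT; rewrite lt_min => /andP[l1 l2].
have := H1 s t s0 st tT l1; have := H2 s t s0 st tT l2.
rewrite !big_ord_recr /= !ler_norml => /andP[a1 a2] /andP[b1 b2].
by apply/andP; split; lra.
Qed.

Lemma series_uc e : 0 < e -> exists2 dl, 0 < dl & forall s t,
  tau <= s -> s <= t -> t <= T -> t - s < dl -> `|v t - v s| <= e.
Proof.
move=> e0; have e20 : 0 < e / 2 by rewrite divr_gt0.
have : \forall M \near \oo, x ^+ M * (C / (1 - x)) < e / 2.
  have : x ^+ M * (C / (1 - x)) @[M --> \oo] --> (0 * (C / (1 - x)) : R).
    by apply: cvgM; [apply: cvg_expr; rewrite ger0_norm|exact: cvg_cst].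
  by rewrite mul0r => /cvgr_lt; apply.
move=> [M _ /(_ M (leqnn M)) /= HM].
have [dl dl0 Hd] := sum_uc M e20.
exists dl => // s t ts st tT lt.
have := Hd s t (le_trans tau0 ts) st tT lt.
have /andP[a1 a2] := geometric_tail M ts (le_trans st tT).
have /andP[b1 b2] := geometric_tail M (le_trans ts st) tT.
by rewrite !ler_norml => /andP[c1 c2]; apply/andP; split; lra.
Qed.

End geometric_tail.

(** Continuity is local, so a modulus that degenerates at time 0 is enough. *)
Lemma half_open_continuous {R : realType} (v : R -> R) (T : R) :
  (forall tau, 0 < tau -> tau <= T -> forall e, 0 < e -> exists2 dl, 0 < dl &
     forall s t, tau <= s -> s <= t -> t <= T -> t - s < dl -> `|v t - v s| <= e) ->
  {within `]0, T], continuous (fun t => Num.sqrt (v t))}.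
Proof.
move=> H; apply/subspace_continuousP => t /=; rewrite in_itv /= => /andP[t0 tT].
apply: (@continuous_cvg _ _ _ _ _ v Num.sqrt (v t)); first exact: sqrt_continuous.
apply/cvgrPdist_le => e e0.
have t20 : 0 < t / 2 by rewrite divr_gt0.
have [|dl dl0 Hd] := H (t / 2) t20 _ e e0; first by lra.
have m0 : 0 < Num.min dl (t / 2) by rewrite lt_min dl0.
rewrite /= near_withinE; near=> u => /=; rewrite in_itv /= => /andP[u0 uT].
have : `|t - u| < Num.min dl (t / 2) by near: u; exact: cvgr_dist_lt.
rewrite lt_min !ltr_norml => /andP[/andP[a1 a2] /andP[b1 b2]].
have [tu|/ltW ut] := leP t u.
  by rewrite distrC; apply: Hd => //; lra.
by apply: Hd => //; lra.
Unshelve. all: by end_near. Qed.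

Lemma fine_sqrte {R : realType} (a : \bar R) : fine (sqrte a) = Num.sqrt (fine a).
Proof. by case: a => [r| |]//=; rewrite sqrtr0. Qed.

(** * Regularity of moderate solutions *)
Section hweight_power.
Context {R : realType} (lambda : R).
Hypothesis lambda1 : 1 < lambda.
Let lambda0 : 0 < lambda. Proof. exact: lt_trans lambda1. Qed.

Lemma hweight_exp s n : hweight lambda s n = (lambda `^ (2 * s)) ^+ n.+1.
Proof.
rewrite /hweight /wave -powR_mulrn ?(ltW lambda0)// -powRrM [n.+1%:R * _]mulrC [LHS]powRrM.
by rewrite powR_mulrn ?powR_ge0.
Qed.

Lemma powR_rho_lt1 s : s < 1 -> lambda `^ (2 * s) * rho_of lambda < 1.
Proof.
move=> s1; rewrite ltr_pdivrMr ?exprn_gt0// mul1r -powR_mulrn ?(ltW lambda0)//.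
rewrite /powR gt_eqF// ltr_expR ltr_pM2r ?ln_gt0//.
by rewrite -[ltRHS]mulr1 ltr_pM2l.
Qed.

End hweight_power.

Section moderate.
Context {R : realType} d {Omega : measurableType d} (P : probability Omega R).
Local Notation leb := (@lebesgue_measure R).
Variables (T lambda sigma : R) (F : R -> set (set Omega)) (W : nat -> R -> Omega -> R).
Variables (Xbar : Omega -> nat -> R) (X : R -> Omega -> nat -> R).
Hypothesis lambda1 : 1 < lambda.
Hypothesis T0 : 0 < T.
Hypothesis filtF : filtration T F.
Hypothesis bmW : forall n, brownian_motion P T F (W n).
Hypothesis indW : independent_processes P T W.
Hypothesis mod : moderate_solution P T lambda sigma F W Xbar X.
Local Notation rho := (rho_of lambda).

Let cs := ms_componentwise mod.
Let iX := ms_init_L2 mod.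
Let pX := ms_L2 mod.
Let uc := moment_uc lambda1 T0 filtF bmW indW cs iX pX.
Let w0 := hweight_gt0 lambda1.

(** The weight [k^(2s)] costs a factor [b = lambda^(2s)] per site, with
    [b rho < 1]; any [p = q^2] strictly between [max(rho, b rho)] and 1 leaves
    room for the loss in [decay]. *)
Lemma moderate_decay s tau : s < 1 -> 0 < tau -> tau <= T -> exists C x, [/\ 0 <= x, x < 1 &
  forall n t, tau <= t -> t <= T -> hweight lambda s n * moment P X n t <= C * x ^+ n].
Proof.
move=> s1 tau0 tauT.
have r0 := rho_gt0 lambda1; have r1 := rho_lt1 lambda1.
pose b := lambda `^ (2 * s).
have b0 : 0 < b by rewrite powR_gt0// (lt_trans ltr01).
have br1 : b * rho < 1 := powR_rho_lt1 lambda1 s1.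
have [p [p1 rp brp]] : exists p, [/\ p < 1, rho < p & b * rho < p].
  exists ((Num.max rho (b * rho) + 1) / 2).
  by case: (leP rho (b * rho)) => h; split; lra.
have p0 : 0 < p := lt_trans r0 rp.
have q2 : Num.sqrt p ^+ 2 = p by rewrite sqr_sqrtr// ltW.
have q0 : 0 < Num.sqrt p by rewrite sqrtr_gt0.
have q1 : Num.sqrt p < 1 by rewrite -sqrtr1 ltr_sqrt.
have [S HS] := init_summable lambda1 T0 filtF cs iX.
have dir := moderate_dirichlet lambda1 T0 filtF bmW indW mod.
have [|C HC] := decay T0 r0 r1 (sqr_ge0 sigma) (moment_ge0 P X) uc
  (moment_subsol lambda1 T0 filtF bmW indW cs iX pX) dir HS q0 q1 _ tau0 tauT.
  by rewrite q2.
exists (C * b), (b * rho / p); split.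
- by rewrite divr_ge0 ?mulr_ge0// ltW.
- by rewrite ltr_pdivrMr// mul1r.
move=> n t tt tT; have := HC n t tt tT; rewrite q2 => le.
rewrite hweight_exp// -/b; apply: (le_trans (ler_wpM2l (exprn_ge0 _ (ltW b0)) le)).
rewrite -[b * rho / p]mulrA (exprMn _ b) [b ^+ n.+1]exprS.
by set u := (rho / p) ^+ n; rewrite le_eqVlt; apply/orP; left; apply/eqP; ring.
Qed.

Lemma L2H_series s t : 0 <= t <= T ->
  (\int[P]_w (Hnorm lambda s (X t w) ^+ 2) =
   \sum_(n <oo) (hweight lambda s n * moment P X n t)%:E)%E.
Proof.
move=> tT; have sq n := coord_sqint lambda1 T0 filtF bmW indW cs iX pX n tT.
rewrite L2H_sum//; last by case=> // n _; exact: (sq n).1.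
apply: eq_eseriesr => n _; rewrite EFinM /moment -Ex_EFin//; exact: (sq n).2.
Qed.

Lemma second_moment_finite s t : s < 1 -> 0 < t -> t <= T ->
  (\int[P]_w (Hnorm lambda s (X t w) ^+ 2) < +oo)%E.
Proof.
move=> s1 t0 tT; have [C [x [x0 x1 HC]]] := moderate_decay s1 t0 tT.
rewrite L2H_series ?(ltW t0)//; apply: (@le_lt_trans _ _ (C / (1 - x))%:E); last exact: ltry.
have f0 n : 0 <= hweight lambda s n * moment P X n t.
  by rewrite mulr_ge0 ?moment_ge0// ltW.
apply: lime_le; first by apply: is_cvg_nneseries => n _ _; rewrite lee_fin.
apply: nearW => N; rewrite /= big_mkord sumEFin lee_fin.
apply: (@le_trans _ _ (\sum_(n < N) C * x ^+ n)); first by apply: ler_sum => n _; exact: HC.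
rewrite -mulr_sumr ler_wpM2l ?geometric_sum_le//.
by have := HC 0%N t (lexx t) tT; rewrite expr0 mulr1; apply: le_trans.
Qed.

Lemma L2Hnorm_continuous s : s < 1 ->
  {within `]0, T], continuous (fun t => fine (L2Hnorm lambda P setT s (X t)))}.
Proof.
move=> s1.
pose v t := fine (\int[P]_w (Hnorm lambda s (X t w) ^+ 2))%E.
have -> : (fun t => fine (L2Hnorm lambda P setT s (X t))) = (fun t => Num.sqrt (v t)).
  by apply/funext => t; rewrite /L2Hnorm fine_sqrte.
apply: half_open_continuous => tau tau0 tauT.
have [C [x [x0 x1 HC]]] := moderate_decay s1 tau0 tauT.
apply: (@series_uc _ (fun n t => hweight lambda s n * moment P X n t) v tau T C x) => //.
- by move=> n t; rewrite mulr_ge0 ?moment_ge0// ltW.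
- move=> t tt tT; have t0 := lt_le_trans tau0 tt.
  rewrite /v fineK; first by rewrite L2H_series// (ltW t0).
  rewrite ge0_fin_numE; first exact: second_moment_finite.
  by rewrite L2H_series ?(ltW t0)//; apply: nneseries_ge0 => n _ _; rewrite lee_fin mulr_ge0 ?moment_ge0// ltW.
- exact: ltW.
move=> n e e0; have [dl dl0 Hd] := uc n (divr_gt0 e0 (w0 s n)).
exists dl => // a b a0 ab bT lt.
rewrite -mulrBr normrM gtr0_norm// mulrC -ler_pdivlMr//; exact: Hd.
Qed.

End moderate.

Lemma Hnorm_measurable {R : realType} (lambda s : R) d (U : measurableType d)
    (Y : U -> nat -> R) : 1 < lambda -> (forall n, measurable_fun setT (fun w => Y w n.+1)) ->
  measurable_fun setT (fun w => Hnorm lambda s (Y w) ^+ 2)%E.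
Proof.
move=> lambda1 mY; under eq_fun do rewrite Hnorm_sqr.
apply: ge0_emeasurable_sum => [n w _ _|n _].
  by rewrite lee_fin mulr_ge0 ?sqr_ge0// ltW// hweight_gt0.
by apply/measurable_EFinP; apply: measurable_funM => //; exact: measurable_funX.
Qed.

Unset Implicit Arguments.
Set Strict Implicit.

Theorem corollary27 (R : realType) (d : measure_display)
    (Omega : measurableType d) (P : probability Omega R)
    (lambda sigma T : R) (F : R -> set (set Omega))
    (W : nat -> R -> Omega -> R)
    (Xbar : Omega -> nat -> R) (X : R -> Omega -> nat -> R)
    (lambda_gt1 : 1 < lambda) (sigma_ge0 : 0 <= sigma) (T_gt0 : 0 < T)
    (F_filtration : filtration T F)
    (W_brownian : forall n, brownian_motion P T F (W n))
    (W_independent : independent_processes P T W)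
    (X_moderate : moderate_solution P T lambda sigma F W Xbar X) :
  (forall s : R, s < 1 ->
     (forall t, 0 < t <= T -> (L2Hnorm lambda P setT s (X t) < +oo)%E) /\
     {within `]0, T], continuous
        (fun t => fine (L2Hnorm lambda P setT s (X t)))}) /\
  (forall t, 0 < t <= T ->
     {ae P, forall w, (Hnorm lambda 0 (X t w) < +oo)%E}).
Proof.
have ge0 s Z : (0 <= \int[P]_w (Hnorm lambda s (Z w) ^+ 2))%E.
  by apply: integral_ge0 => w _; rewrite expe2 mule_ge0// sqrte_ge0.
have fin s t : s < 1 -> 0 < t <= T -> (\int[P]_w (Hnorm lambda s (X t w) ^+ 2) < +oo)%E.
  move=> s1 /andP[t0 tT].
  exact: (second_moment_finite lambda_gt1 T_gt0 F_filtration W_brownian W_independent X_moderate).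
split=> [s s1|t tT].
  split=> [t tT|].
    by rewrite -ge0_fin_numE ?sqrte_ge0// sqrte_fin_num// ge0_fin_numE//; exact: fin.
  exact: (L2Hnorm_continuous lambda_gt1 T_gt0 F_filtration W_brownian W_independent X_moderate).
have tT' : 0 <= t <= T by case/andP: tT => t0 ->; rewrite ltW.
have mY n : measurable_fun setT (fun w => X t w n.+1).
  apply: (mfor_meas F_filtration tT').
  exact: (cs_adapted (ms_componentwise X_moderate) (ltn0Sn n) tT').
have iH : P.-integrable setT (fun w => Hnorm lambda 0 (X t w) ^+ 2)%E.
  apply/integrableP; split; first exact: Hnorm_measurable.
  under eq_integral do rewrite gee0_abs ?expe2 ?mule_ge0 ?sqrte_ge0//.
  under eq_integral do rewrite -expe2.
  exact: fin.
apply: filterS (integrable_ae measurableT iH) => w /(_ I).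
have := sqrte_ge0 (\sum_(1 <= n <oo) (wave lambda n `^ (2 * 0) * X t w n ^+ 2)%:E)%E.
rewrite -/(Hnorm lambda 0 (X t w)); case: (Hnorm _ _ _) => [r|//|//] _ _.
exact: ltry.
Qed.
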